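(* Let $\mathcal X$ be a category, $\mathcal C$ a continuous category, $T^0$ and $T^1$ flexible functors from $\mathcal X$ to $\mathcal C$, and $G$ a morphism of flexible functors from $T^0$ to $T^1$. Let $u:1\to0$ be the non-identity morphism of $I$. The space of equivalences $F$ from $T^0$ to $T^1$ whose restriction to $\mathcal X\times I\subset\mathcal X\times\overline I$ is $G$ is nonempty if and only if for every object $X\in\mathcal X$ the morphism $G(1_X,u):T^0_X\to T^1_X$ is invertible in $\pi_0\mathcal C$. If this space of equivalences is nonempty, then it is weakly contractible.
   Context: A continuous category $\mathcal C$ is a category enriched over topological spaces (a set of objects, morphism spaces $\mathcal C(A,B)$, continuous associative composition, identities). $\pi_0\mathcal C$ is the ordinary category with the same objects and morphism sets $\pi_0(\mathcal C(A,B))$ (path components). **Flexible functors** (always contravariant). For a category $\mathcal Y$, a flexible functor $T:\mathcal Y\to\mathcal C$ consists of an object $T_X$ of $\mathcal C$ for each object $X$ and, for each $n\ge1$ and each composable sequence $\varphi_i:X_i\to X_{i-1}$ ($1\le i\le n$) in $\mathcal Y$, a continuous map $(t_1,\dots,t_{n-1})\mapsto T(\varphi_1,\dots,\varphi_n;t_1,\dots,t_{n-1})$ from $[0,1]^{n-1}$ to $\mathcal C(T_{X_0},T_{X_n})$ such that: if $t_i=0$ it equals $T(\varphi_1,\dots,\varphi_i\varphi_{i+1},\dots,\varphi_n;t_1,\dots,\widehat{t_i},\dots,t_{n-1})$; if $t_i=1$ it equals $T(\varphi_{i+1},\dots,\varphi_n;t_{i+1},\dots,t_{n-1})\circ T(\varphi_1,\dots,\varphi_i;t_1,\dots,t_{i-1})$;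 and $T(1_X)=1_{T_X}$. Flexible functors with prescribed objects $T_X$ form a topological space, as a subspace of the product over all composable sequences of the spaces of continuous maps $[0,1]^{n-1}\to\mathcal C(T_{X_0},T_{X_n})$ with the compact-open topology. Flexible functors restrict along functors. $I$ is the category with two objects $0,1$ and one non-identity morphism $1\to0$. $\overline I\supset I$ is the category with objects $0,1$ and exactly one morphism between any two objects (so $0$ and $1$ are isomorphic). A morphism from $T^0$ to $T^1$ is a flexible functor $G:\mathcal X\times I\to\mathcal C$ with $G|_{\mathcal X\times\{i\}}=T^i$, $i=0,1$. An equivalence from $T^0$ to $T^1$ is a flexible functor $F:\mathcal X\times\overline I\to\mathcal C$ with $F|_{\mathcal X\times\{i\}}=T^i$, $i=0,1$. *)

(* Defs.v *)
From HB Require Import structures.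
From mathcomp Require Import all_boot all_order all_algebra generic_quotient.
From mathcomp Require Import mathcomp_extra boolp classical_sets functions.
From mathcomp Require Import set_interval reals topology normedtype.

Set Implicit Arguments.
Unset Strict Implicit.
Unset Printing Implicit Defensive.

Import Order.TTheory GRing.Theory Num.Theory numFieldNormedType.Exports.
(* [continuousType U V] carries the compact-open topology. *)
Import ArrowAsCompactOpen.

Local Open Scope classical_set_scope.
Local Open Scope ring_scope.
Local Open Scope quotient_scope.

Section interval.
Context {R : realType}.

Definition unitI : topologicalType := set_type (`[0, 1]%classic : set R).

Lemma clamp_subproof (x : R) :
  Num.max 0 (Num.min x 1) \in (`[0, 1]%classic : set R).
Proof.
rewrite inE /= in_itv /= le_max lexx /= ge_max ler01 /=.
by rewrite ge_min lexx orbT.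
Qed.

Definition clamp (x : R) : unitI := SigSub (clamp_subproof x).

Lemma val_clamp (x : R) : 0 <= x <= 1 -> set_val (clamp x) = x.
Proof.
by move=> /andP[x0 x1]; rewrite set_valE /= (min_l x1) (max_r x0).
Qed.

Lemma clampK (t : unitI) : clamp (set_val t) = t.
Proof.
apply: val_inj; rewrite -!set_valE val_clamp //.
by case: t => x xI; rewrite set_valE /=; move: (xI); rewrite inE /= in_itv.
Qed.

Lemma clamp_continuous : continuous clamp.
Proof.
apply: continuous_comp_initial => x.
have -> : set_val \o clamp = (fun x : R => Num.max 0 (Num.min x 1)) by [].
apply: (@continuous_max _ _ (fun=> 0) (fun x : R => Num.min x 1)).
  exact: cst_continuous.
by apply: (@continuous_min _ _ id (fun=> 1)) => //; exact: cst_continuous.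
Qed.

Definition I0 : unitI := clamp 0.
Definition I1 : unitI := clamp 1.

Definition cube (n : nat) : topologicalType :=
  prod_topology (fun _ : 'I_n => unitI).

Definition cube_boundary (n : nat) : set (cube n) :=
  [set t | exists i, t i = I0 \/ t i = I1].

Definition joined (T : topologicalType) (x y : T) : Prop :=
  exists2 p : unitI -> T, continuous p & p I0 = x /\ p I1 = y.

End interval.
Arguments unitI : clear implicits.
Arguments cube : clear implicits.
Arguments cube_boundary : clear implicits.
Arguments joined : clear implicits.

Section joined_equivalence.
Context {R : realType} {T : topologicalType}.

Lemma joined_refl (x : T) : joined R T x x.
Proof. by exists (fun=> x); [exact: cst_continuous|]. Qed.

Lemma I0E : set_val (I0 : unitI R) = 0.
Proof. by rewrite val_clamp // lexx ler01. Qed.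

Lemma I1E : set_val (I1 : unitI R) = 1.
Proof. by rewrite val_clamp // lexx ler01. Qed.

Lemma unitI_val_continuous : continuous (set_val : unitI R -> R).
Proof. exact: initial_continuous. Qed.

Lemma joined_sym (x y : T) : joined R T x y -> joined R T y x.
Proof.
move=> [p pc [p0 p1]]; exists (fun t => p (clamp (1 - set_val t))).
  have rc : continuous (fun x : R => clamp (1 - x)).
    move=> r; apply: (@continuous_comp _ _ _ (fun r : R => 1 - r));
      last exact: clamp_continuous.
    by apply: continuousB; [exact: cst_continuous|].
  move=> t; apply: (@continuous_comp _ _ _
    (fun t : unitI R => clamp (1 - set_val t)) p); last exact: pc.
  apply: (@continuous_comp _ _ _ (set_val : unitI R -> R)
    (fun x => clamp (1 - x))); last exact: rc.
  exact: unitI_val_continuous.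
by rewrite I0E I1E subr0 subrr.
Qed.

Lemma joined_trans (x y z : T) :
  joined R T x y -> joined R T y z -> joined R T x z.
Proof.
move=> [p pc [p0 p1]] [q qc [q0 q1]].
pose h (s : R) := if s <= 2^-1 then p (clamp (2 * s)) else q (clamp (2 * s - 1)).
have hc : continuous h.
  have lin (b : R) : continuous (fun s : R => clamp (2 * s - b)).
    move=> s; apply: (@continuous_comp _ _ _ (fun s : R => 2 * s - b));
      last exact: clamp_continuous.
    apply: continuousB; last exact: cst_continuous.
    by apply: continuousM => //; exact: cst_continuous.
  have half : 2 * 2^-1 = 1 :> R by rewrite divff ?pnatr_eq0.
  apply/continuous_subspace_setT.
  have <- : [set s : R | s <= 2^-1] `|` [set s | 2^-1 <= s] = setT.
    by apply/seteqP; split => // s _ /=; apply/orP; exact: le_total.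
  apply: withinU_continuous.
  - exact: closed_le.
  - exact: closed_ge.
  - apply: (@subspace_eq_continuous R [set s | s <= 2^-1] T
      (fun s : R => p (clamp (2 * s - 0)))).
      by move=> s; rewrite inE /= => sle; rewrite /from_subspace /h sle subr0.
    apply: continuous_subspaceT => s.
    by apply: continuous_comp; [exact: lin|exact: pc].
  - apply: (@subspace_eq_continuous R [set s | 2^-1 <= s] T
      (fun s : R => q (clamp (2 * s - 1)))).
      move=> s; rewrite inE /= => sge; rewrite /from_subspace /h.
      case: ifPn => // sle; have -> : s = 2^-1 by apply/eqP; rewrite eq_le sle.
      by rewrite half subrr -/I0 -/I1 q0 p1.
    apply: continuous_subspaceT => s.
    by apply: continuous_comp; [exact: lin|exact: qc].
exists (h \o set_val).
  by move=> t; apply: continuous_comp; [exact: unitI_val_continuous|exact: hc].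
split => /=; rewrite /h ?I0E ?I1E.
  by rewrite invr_ge0 ler0n mulr0 -/I0.
rewrite ifF; last by apply/negbTE; rewrite -ltNge invf_lt1 ?ltr0n ?ltr1n.
by rewrite mulr1 (_ : 2 - 1 = 1) // -[2]/(1 + 1) addrK.
Qed.

Definition joinedb (x y : T) : bool := `[< joined R T x y >].

Lemma joinedb_equiv : equiv_class_of joinedb.
Proof.
split.
- by move=> x; apply/asboolP; exact: joined_refl.
- by move=> x y; apply/asboolP/asboolP; exact: joined_sym.
- move=> y x z /asboolP xy /asboolP yz; apply/asboolP.
  exact: joined_trans xy yz.
Qed.

Canonical joined_equiv := EquivRelPack joinedb_equiv.

End joined_equivalence.
Arguments joinedb : clear implicits.

Lemma joined_map {R : realType} (T U : topologicalType) (f : T -> U) (x y : T) :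
  continuous f -> joined R T x y -> joined R U (f x) (f y).
Proof.
move=> fc [p pc [<- <-]]; exists (f \o p) => // t.
by apply: continuous_comp; [exact: pc|exact: fc].
Qed.

Definition pi0_set (R : realType) (T : topologicalType) : Type :=
  {eq_quot (@joined_equiv R T)}.

Section weakly_contractible.
Context (R : realType) (Z : topologicalType).

(* Representatives of the elements of [pi_n (Z, z)]; for n = 0 the boundary is
   empty and these are the points of Z. *)
Definition spheroid (n : nat) (z : Z) (f : cube R n -> Z) : Prop :=
  continuous f /\ forall t, cube_boundary R n t -> f t = z.

Definition homotopic_rel (n : nat) (z : Z) (f g : cube R n -> Z) : Prop :=
  exists2 H : unitI R * cube R n -> Z, continuous H &
    [/\ forall t, H (I0, t) = f t,
        forall t, H (I1, t) = g t &
        forall s t, cube_boundary R n t -> H (s, t) = z].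

Definition pi_trivial (n : nat) (z : Z) : Prop :=
  forall f g, spheroid z f -> spheroid z g -> @homotopic_rel n z f g.

Definition weakly_contractible : Prop :=
  (exists z : Z, True) /\ forall (n : nat) (z : Z), pi_trivial n z.

End weakly_contractible.

Record category := Category {
  ob :> Type;
  hom : ob -> ob -> Type;
  idm : forall A, hom A A;
  compm : forall A B C, hom B C -> hom A B -> hom A C;
  compmA : forall A B C D (f : hom C D) (g : hom B C) (h : hom A B),
    compm f (compm g h) = compm (compm f g) h;
  comp1m : forall A B (f : hom A B), compm (idm B) f = f;
  compm1 : forall A B (f : hom A B), compm f (idm A) = f }.

Definition invertible (Y : category) (A B : Y) (f : hom A B) : Prop :=
  exists2 g : hom B A, compm g f = idm A & compm f g = idm B.

Record functor (Y Z : category) := Functor {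
  fob :> Y -> Z;
  fhom : forall A B : Y, hom A B -> hom (fob A) (fob B);
  fhom1 : forall A, fhom (idm A) = idm (fob A);
  fhomM : forall (A B C : Y) (f : hom B C) (g : hom A B),
    fhom (compm f g) = compm (fhom f) (fhom g) }.

Record contCategory := ContCategory {
  cob :> Type;
  chom : cob -> cob -> topologicalType;
  cidm : forall A, chom A A;
  ccomp : forall A B C, chom B C -> chom A B -> chom A C;
  ccompA : forall A B C D (f : chom C D) (g : chom B C) (h : chom A B),
    ccomp f (ccomp g h) = ccomp (ccomp f g) h;
  ccomp1m : forall A B (f : chom A B), ccomp (cidm B) f = f;
  ccompm1 : forall A B (f : chom A B), ccomp f (cidm A) = f;
  ccomp_continuous : forall A B C,
    continuous (fun p : chom B C * chom A B => ccomp p.1 p.2) }.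

Section pi0_category.
Context (R : realType) (C : contCategory).

Definition pi0_hom (A B : C) : Type := pi0_set R (chom A B).

Definition pi0_class (A B : C) (f : chom A B) : pi0_hom A B :=
  \pi_{eq_quot (@joined_equiv R (chom A B))} f.

Definition pi0_comp (A B D : C) (f : pi0_hom B D) (g : pi0_hom A B) :
    pi0_hom A D :=
  pi0_class (ccomp (repr f) (repr g)).

Lemma pi0_classP (A B : C) (f g : chom A B) :
  joined R (chom A B) f g <-> pi0_class f = pi0_class g.
Proof.
split=> [fg|/eqmodP /asboolP //].
by apply/eqmodP/asboolP.
Qed.

Lemma pi0_class_surj (A B : C) (f : pi0_hom A B) : pi0_class (repr f) = f.
Proof. exact: reprK. Qed.

Lemma joined_ccomp (A B D : C) (f f' : chom B D) (g g' : chom A B) :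
  joined R _ f f' -> joined R _ g g' -> joined R _ (ccomp f g) (ccomp f' g').
Proof.
move=> [p pc [<- <-]] [q qc [<- <-]].
exists (fun t => ccomp (p t) (q t)) => // t.
apply: (@continuous_comp _ _ _ (fun t => (p t, q t))
  (fun u : chom B D * chom A B => ccomp u.1 u.2)).
  apply: (@cvg_pair _ _ _ (nbhs t)).
    exact: pc.
  exact: qc.
exact: ccomp_continuous.
Qed.

Lemma pi0_compE (A B D : C) (f : chom B D) (g : chom A B) :
  pi0_comp (pi0_class f) (pi0_class g) = pi0_class (ccomp f g).
Proof.
by apply/pi0_classP/joined_ccomp; apply/pi0_classP; rewrite pi0_class_surj.
Qed.

Lemma pi0_compA (A B D E : C)
  (f : pi0_hom D E) (g : pi0_hom B D) (h : pi0_hom A B) :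
  pi0_comp f (pi0_comp g h) = pi0_comp (pi0_comp f g) h.
Proof.
rewrite -(pi0_class_surj f) -(pi0_class_surj g) -(pi0_class_surj h).
by rewrite !pi0_compE ccompA.
Qed.

Lemma pi0_comp1m (A B : C) (f : pi0_hom A B) :
  pi0_comp (pi0_class (cidm B)) f = f.
Proof. by rewrite -(pi0_class_surj f) pi0_compE ccomp1m. Qed.

Lemma pi0_compm1 (A B : C) (f : pi0_hom A B) :
  pi0_comp f (pi0_class (cidm A)) = f.
Proof. by rewrite -(pi0_class_surj f) pi0_compE ccompm1. Qed.

Definition pi0 : category :=
  @Category C pi0_hom (fun A => pi0_class (cidm A)) pi0_comp
    pi0_compA pi0_comp1m pi0_compm1.

End pi0_category.

Section chains.
Context {Y : category}.

(* [chain n A B] is the type of composable sequences of [n.+1] morphisms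
   [phi_1, ..., phi_(n+1)] with [phi_i : X_i -> X_(i-1)], [X_0 = A] and
   [X_(n+1) = B]; such a sequence comes with [n] parameters in [0, 1]. *)
Fixpoint chain (n : nat) (A B : Y) : Type :=
  if n is m.+1 then {X : Y & (hom X A * chain m X B)%type} else hom B A.

Fixpoint chain_cat (p q : nat) (A X B : Y) :
    chain p A X -> chain q X B -> chain (p + q.+1) A B :=
  match p return chain p A X -> chain q X B -> chain (p + q.+1) A B with
  | 0 => fun f d => existT _ X (f, d)
  | p'.+1 => fun c d =>
    existT _ (projT1 c) ((projT2 c).1, chain_cat (projT2 c).2 d)
  end.

Definition chain_precomp (n : nat) (A X B : Y) (f : hom X A) :
    chain n X B -> chain n A B :=
  match n return chain n X B -> chain n A B with
  | 0 => fun g => compm f g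
  | _.+1 => fun c => existT _ (projT1 c) (compm f (projT2 c).1, (projT2 c).2)
  end.

(* Replaces the morphisms in positions [i] and [i + 1], counted from 0, by
   their composite. Meant for [i <= n]. *)
Fixpoint chain_merge (n : nat) (i : nat) (A B : Y) :
    chain n.+1 A B -> chain n A B :=
  match i with
  | 0 => fun c => @chain_precomp n A _ B (projT2 c).1 (projT2 c).2
  | i'.+1 =>
    match n return chain n.+1 A B -> chain n A B with
    | 0 => fun c => @chain_precomp 0 A _ B (projT2 c).1 (projT2 c).2
    | n'.+1 => fun c =>
      existT _ (projT1 c) ((projT2 c).1, @chain_merge n' i' _ _ (projT2 c).2)
    end
  end.

Record cseq := CSeq {
  cdim : nat;
  csrc : Y;
  ctgt : Y;
  cchain : chain cdim csrc ctgt }.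

End chains.
Arguments cseq : clear implicits.

Section chain_map.
Context {Y Z : category} (F : functor Y Z).

Fixpoint chain_map (n : nat) (A B : Y) : chain n A B -> chain n (F A) (F B) :=
  match n return chain n A B -> chain n (F A) (F B) with
  | 0 => fun f => fhom F f
  | _.+1 => fun c =>
    existT _ (F (projT1 c)) (fhom F (projT2 c).1, chain_map (projT2 c).2)
  end.

Definition cseq_map (s : cseq Y) : cseq Z := CSeq (chain_map (cchain s)).

Lemma chain_map_cat (p q : nat) (A X B : Y)
    (c : chain p A X) (d : chain q X B) :
  chain_map (chain_cat c d) = chain_cat (chain_map c) (chain_map d).
Proof. by elim: p A c => [|p IH] A c //=; rewrite IH. Qed.

Lemma chain_map_merge (n i : nat) (A B : Y) (c : chain n.+1 A B) :
  chain_map (chain_merge i c) = chain_merge i (chain_map c).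
Proof.
have pre m A' X (f : hom X A') (d : chain m X B) :
    chain_map (chain_precomp f d) = chain_precomp (fhom F f) (chain_map d).
  by case: m d => [|m] d /=; rewrite fhomM.
elim: n i A c => [|n IH] [|i] A c; try exact: pre.
by rewrite /= IH.
Qed.

End chain_map.

Section flexible.
Context (R : realType) (Y : category) (C : contCategory) (T : Y -> C).

Definition flexFamily : topologicalType :=
  prod_topology (fun s : cseq Y =>
    continuousType (cube R (cdim s)) (chom (T (csrc s)) (T (ctgt s)))).

Definition family_app (G : flexFamily) (n : nat) (A B : Y) (c : chain n A B) :
    cube R n -> chom (T A) (T B) :=
  G (CSeq c).

Definition face0 (G : flexFamily) : Prop :=
  forall (n : nat) (A B : Y) (c : chain n.+1 A B) (t : cube R n.+1)
    (i : 'I_n.+1), t i = I0 ->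
  family_app G c t = family_app G (chain_merge i c) (fun j => t (lift i j)).

(* The parameters of [chain_cat c d] are those of [c], then one for the
   junction, then those of [d]; every t_i is the junction of some such
   decomposition. *)
Definition face1 (G : flexFamily) : Prop :=
  forall (p q : nat) (A X B : Y) (c : chain p A X) (d : chain q X B)
    (t : cube R (p + q.+1)), t (rshift p ord0) = I1 ->
  family_app G (chain_cat c d) t =
    ccomp (family_app G d (fun j => t (rshift p (lift ord0 j))))
          (family_app G c (fun j => t (lshift q.+1 j))).

Definition preserves_id (G : flexFamily) : Prop :=
  forall (A : Y) (t : cube R 0),
  family_app G (idm A : chain 0 A A) t = cidm (T A).

Definition is_flexible : set flexFamily :=
  [set G | [/\ face0 G, face1 G & preserves_id G]].

Definition flexible : topologicalType := set_type is_flexible.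

Definition flexible_app (G : flexible) (n : nat) (A B : Y) (c : chain n A B) :
    cube R n -> chom (T A) (T B) :=
  family_app (set_val G) c.

Definition flexible_hom (G : flexible) (A B : Y) (f : hom B A) :
    chom (T A) (T B) :=
  flexible_app G (f : chain 0 A B) (fun=> I0).

End flexible.
Arguments flexible R {Y C} T.

Section restriction.
Context (R : realType) (Y Z : category) (C : contCategory) (F : functor Y Z).
Context (T : Z -> C).

Definition family_restrict (G : flexFamily R T) : flexFamily R (fun A => T (F A)) :=
  fun s => G (cseq_map F s).

Lemma family_restrict_flexible (G : flexible R T) :
  family_restrict (set_val G) \in is_flexible (R := R) (T := fun A => T (F A)).
Proof.
case: G => G Gflex; rewrite set_valE /= inE.
have [G0 G1 Gid] : is_flexible G by move: Gflex; rewrite inE.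
have appE n A B (c : chain n A B) t :
    family_app (family_restrict G) c t = family_app G (chain_map F c) t by [].
split.
- move=> n A B c t i ti.
  by rewrite !appE (G0 _ _ _ _ _ _ ti) chain_map_merge.
- move=> p q A X B c d t tp.
  by rewrite !appE chain_map_cat (G1 _ _ _ _ _ _ _ _ tp).
- move=> A t; rewrite appE -[RHS](Gid (F A) t).
  by congr (family_app G _ t); exact: fhom1.
Qed.

Definition flexible_restrict (G : flexible R T) : flexible R (fun A => T (F A)) :=
  SigSub (family_restrict_flexible G).

End restriction.

Record flexFunctor (R : realType) (Y : category) (C : contCategory) :=
  FlexFunctor {
    flex_ob :> Y -> C;
    flex_map : flexible R flex_ob }.

Section products.
Context (Y Z : category).

Definition prod_hom (A B : Y * Z) : Type := hom A.1 B.1 * hom A.2 B.2.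

Definition prodC : category.
refine (@Category (Y * Z)%type prod_hom (fun A => (idm A.1, idm A.2))
  (fun A B D f g => (compm f.1 g.1, compm f.2 g.2)) _ _ _).
- by move=> A B D E f g h; rewrite /= !compmA.
- by move=> A B [f g]; rewrite /= !comp1m.
- by move=> A B [f g]; rewrite /= !compm1.
Defined.

Definition slice (i : Z) : functor Y prodC.
refine (@Functor Y prodC (fun A => (A, i)) (fun A B f => (f, idm i)) _ _).
- by [].
- by move=> A B D f g; rewrite /= comp1m.
Defined.

End products.

Definition prod_functor (Y Z W : category) (F : functor Z W) :
  functor (prodC Y Z) (prodC Y W).
refine (@Functor (prodC Y Z) (prodC Y W) (fun A => (A.1, F A.2))
  (fun A B f => (f.1, fhom F f.2)) _ _).
- by move=> A; rewrite /= fhom1.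
- by move=> A B D f g; rewrite /= fhomM.
Defined.

(* The object 1 is [true] and the object 0 is [false]; there is a morphism
   a -> b, unique by proof irrelevance, unless a is 0 and b is 1. *)
Lemma arrowI_comp (a b c : bool) : b ==> c -> a ==> b -> a ==> c.
Proof. by move: a b c => [] [] []. Qed.

Definition arrowI : category :=
  @Category bool (fun a b : bool => b ==> a) implybb
    (fun a b c f g => arrowI_comp g f)
    (fun _ _ _ _ _ _ _ => bool_irrelevance _ _)
    (fun _ _ _ => bool_irrelevance _ _) (fun _ _ _ => bool_irrelevance _ _).

Definition arrow_u : @hom arrowI true false := isT.

Definition isoI : category :=
  @Category bool (fun _ _ => unit) (fun=> tt) (fun _ _ _ _ _ => tt)
    (fun _ _ _ _ _ _ _ => erefl)
    (fun _ _ f => let: tt := f in erefl) (fun _ _ f => let: tt := f in erefl).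

Definition inclI : functor arrowI isoI :=
  @Functor arrowI isoI id (fun _ _ _ => tt) (fun=> erefl)
    (fun _ _ _ _ _ => erefl).

Section morphisms.
Context (R : realType) (X : category) (C : contCategory).
Context (T0 T1 : flexFunctor R X C).

Definition ends (A : X * bool) : C := if A.2 then T1 A.1 else T0 A.1.

Definition is_flexMorphism
    : set (flexible R (ends : prodC X arrowI -> C)) :=
  [set G | flexible_restrict (slice X (false : arrowI)) G = flex_map T0 /\
           flexible_restrict (slice X (true : arrowI)) G = flex_map T1].

Definition flexMorphism : topologicalType := set_type is_flexMorphism.

Definition is_flexEquivalence
    : set (flexible R (ends : prodC X isoI -> C)) :=
  [set F | flexible_restrict (slice X (false : isoI)) F = flex_map T0 /\
           flexible_restrict (slice X (true : isoI)) F = flex_map T1].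

(* [G (1_A, u)] *)
Definition component (G : flexMorphism) (A : X) : chom (T0 A) (T1 A) :=
  flexible_hom (set_val G) (A := (A, false) : prodC X arrowI)
    (B := (A, true) : prodC X arrowI) (idm A, arrow_u).

Definition equivalences_extending (G : flexMorphism) : topologicalType :=
  set_type [set F | is_flexEquivalence F /\
                    flexible_restrict (prod_functor X inclI) F = set_val G].

End morphisms.

(* Main.v *)
(* Write (x, e) for the objects of X x isoI. An extension F of G is given by its
   values on the cells of the sequences (x_0, e_0), ..., (x_n, e_n) in which some
   object over 1 precedes an object over 0. These sequences come in pairs: if the
   first object over 1 is (x_a, 1) and is preceded by an even number of
   consecutive identities of X, insert (x_a, 0) in front of it. All faces of the
   larger sequence p' of a pair come earlier in a suitable order, except for an odd
   number of them, which are the smaller sequence p; if a = 0, this face is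
   outer and is F(p) composed with the component of G at x_0. The faces t_i = 0 and
   t_(i + 1) = 0 which carry the same map have opposite orientations and cancel, so
   that p and p' amount to filling a cube with one free face, up to precomposition
   with the homotopy equivalence given by the component. Hence every family of
   extensions over the boundary of a cube extends to the cube, which gives both
   existence (for the cube of dimension 0) and weak contractibility. *)

From HB Require Import structures.
From mathcomp Require Import all_boot all_order all_algebra.
From mathcomp Require Import mathcomp_extra boolp classical_sets functions.
From mathcomp Require Import reals topology normedtype.
From mathcomp Require Import zify ring lra.
(* Last, so that the [hom] of Defs is not shadowed. *)
Require Import Defs.

Set Implicit Arguments.
Unset Strict Implicit.
Unset Printing Implicit Defensive.

Import Order.TTheory GRing.Theory Num.Theory numFieldNormedType.Exports.
Import ArrowAsCompactOpen.

Local Open Scope classical_set_scope.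

(** * Filling cubes *)

Section topology.
Local Open Scope ring_scope.
Context (R : realType).
Local Notation I := (unitI R).
Local Notation I0 := (@I0 R).
Local Notation I1 := (@I1 R).

(** Inserting (x_a, 0) lengthens by one the run of identities that ends at (x_a, 1). So the parity
    of this run tells the two members of a pair apart, and every sequence on which F is not
    prescribed lies in exactly one pair. If the run of p has length r, the lengthened run contains r
    + 1 objects over 0, and removing any of them undoes the insertion; removing the initial object
    is the outer face. As r is even, r + 1 is odd.

    The obstacle is that F(p) is unknown on all of these faces at once, so a horn cannot be filled
    directly. Two neighbouring faces that cancel meet in a face common to both, hence any map whose
    remaining boundary is right may be put on both of them provisionally. Filling the cube with such
    maps puts some map on the one face left over; the weak equivalence turns it into F(p), and the
    provisional maps are then deformed into F(p) as well. Since F(p) must keep the boundary given by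
    its own faces, weak equivalences enter as a lifting property relative to the boundary. *)

Lemma unitI_inj (a b : I) : set_val a = set_val b -> a = b.
Proof. by rewrite !set_valE; exact: val_inj. Qed.

Lemma unitI_itv (a : I) : 0 <= (set_val a : R) <= 1.
Proof. by case: a => x xI; rewrite set_valE /=; move: (xI); rewrite inE /= in_itv. Qed.

Lemma I0_neq_I1 : I0 <> I1.
Proof. by move=> /(congr1 set_val); rewrite I0E I1E => /eqP; rewrite eq_sym oner_eq0. Qed.

Definition endp (b : bool) : I := if b then I1 else I0.

Lemma endp_inj : injective endp.
Proof. by move=> [] [] //= => [/esym|] /I0_neq_I1. Qed.

Lemma closed_unitI (a : I) : closed [set a].
Proof.
have -> : [set a] = set_val @^-1` [set (set_val a : R)].
  by apply/seteqP; split=> x /= [] => [->|/unitI_inj] //.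
apply: preimage_closed; first by move=> x _; exact: unitI_val_continuous.
exact: closed_eq.
Qed.

Lemma prod_continuous (T : topologicalType) (J : Type) (U : J -> topologicalType)
    (f : T -> prod_topology U) :
  (forall j, continuous (fun x => f x j)) -> continuous f.
Proof.
move=> fc x; apply/cvg_sup => j.
by apply: continuous_comp_initial; exact: fc.
Qed.

Lemma component_continuous (J : Type) (U : J -> topologicalType) (j : J) :
  continuous (fun s : prod_topology U => s j).
Proof.
move=> s; have /cvg_sup/(_ j) : nbhs s --> s by exact: cvg_id.
move=> h; apply: cvg_trans; last exact: (@initial_continuous _ _ (fun f : forall j, U j => f j) s).
exact: (cvg_app (fun f : forall j, U j => f j) h).
Qed.


Local Notation Q := (prod_topology (fun _ : nat => I)).

(** The N-cube is encoded by maps on the infinite cube [Q] that see only the first N coordinates, so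
    that changes of dimension need no casts. *)
Definition dep (Z : Type) (N : nat) (f : Q -> Z) :=
  forall s s' : Q, (forall j, (j < N)%N -> s j = s' j) -> f s = f s'.

Lemma dep_leq (Z : Type) (N M : nat) (f : Q -> Z) :
  (N <= M)%N -> dep N f -> dep M f.
Proof. by move=> NM fN s s' ss'; apply: fN => j jN; apply: ss'; apply: leq_trans NM. Qed.

(** Pasting along a finite closed cover: the preimage of a closed set under [h] is a finite union of
    closed sets. *)
Lemma glue_continuous (T Z : topologicalType) (J : choiceType) (l : seq J)
    (C : J -> set T) (g : J -> T -> Z) (h : T -> Z) :
  (forall j, j \in l -> closed (C j)) -> (forall j, j \in l -> continuous (g j)) ->
  (forall x, exists2 j, j \in l & C j x) ->
  (forall j x, j \in l -> C j x -> h x = g j x) -> continuous h.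
Proof.
move=> Ccl gc Ccov hg; apply/continuous_closedP => D Dcl.
have -> : h @^-1` D = \big[setU/set0]_(j <- l) (if j \in l then C j `&` g j @^-1` D else set0).
  rewrite -bigcup_seq; apply/seteqP; split=> [x hx|x [j jl]].
    have [j jl Cx] := Ccov x; exists j => //=.
    by rewrite jl; split=> //=; rewrite -(hg j).
  by rewrite /= in jl *; rewrite jl => -[Cx]; rewrite /= -(hg j).
apply: closed_bigsetU => j jl; rewrite jl; apply: closedI; first exact: Ccl.
by move/continuous_closedP : (gc _ jl); apply.
Qed.

Lemma continuous_real_max (T : topologicalType) (f g : T -> R) :
  continuous f -> continuous g -> continuous (fun x => Num.max (f x) (g x)).
Proof.
by move=> fc gc x; apply: (@continuous_max _ _ f g); [exact: fc|exact: gc].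
Qed.

Lemma continuous_realD (T : topologicalType) (f g : T -> R) :
  continuous f -> continuous g -> continuous (fun x => f x + g x).
Proof. by move=> fc gc x; apply: (@continuousD _ _ _ f g); [exact: fc|exact: gc]. Qed.

Lemma continuous_realB (T : topologicalType) (f g : T -> R) :
  continuous f -> continuous g -> continuous (fun x => f x - g x).
Proof. by move=> fc gc x; apply: (@continuousB _ _ _ f g); [exact: fc|exact: gc]. Qed.

Lemma continuous_realM (T : topologicalType) (f g : T -> R) :
  continuous f -> continuous g -> continuous (fun x => f x * g x).
Proof. by move=> fc gc x; apply: (@continuousM _ _ f g); [exact: fc|exact: gc]. Qed.

Lemma continuous_realV (T : topologicalType) (f : T -> R) :
  (forall x, f x != 0) -> continuous f -> continuous (fun x => (f x)^-1).
Proof. by move=> f0 fc x; apply: (@continuousV _ _ f) => //; exact: fc. Qed.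

Lemma comp_continuous (S T U : topologicalType) (f : S -> T) (g : T -> U) :
  continuous f -> continuous g -> continuous (fun x => g (f x)).
Proof. by move=> fc gc x; apply: (@continuous_comp _ _ _ f g); [exact: fc|exact: gc]. Qed.

(** * Retraction of a cube onto all of its faces but one *)

Section retraction.
Variables (N i0 : nat) (b0 : bool).
Hypothesis i0N : (i0 < N)%N.

Local Notation y s j := (2 * set_val (s j : I) - 1 : R).

(** Sup norm of the coordinates below [n] other than [i0], recentred to [-1, 1]. *)
Fixpoint sidedist (n : nat) (s : Q) : R :=
  if n is m.+1 then
    Num.max (sidedist m s) (if m == i0 then 0 else `|y s m|)
  else 0.

(** [u] is the height above the face opposite to (i0, b0). The ray from the apex u = 2, y = 0
    reaches height 0 after stretching by 1 / (1 - u / 2) and the side faces after stretching by 1 /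
    [sidedist]; [scale] is the smaller of the two factors. *)
Let u (s : Q) : R := if b0 then set_val (s i0) else 1 - set_val (s i0).
Let scale (s : Q) : R := (Num.max (1 - u s / 2) (sidedist N s))^-1.

(* Central projection, from the point at distance 2 from the opposite face, of
   the cube in the first N coordinates onto its faces other than (i0, b0). *)
Definition hornr (s : Q) : Q := fun j =>
  if j == i0 then
    clamp (if b0 then 2 - scale s * (2 - u s) else 1 - (2 - scale s * (2 - u s)))
  else if (j < N)%N then clamp ((1 + scale s * y s j) / 2) else s j.

Let y_le1 (s : Q) j : `|y s j| <= 1.
Proof. by have /andP[] := unitI_itv (s j); rewrite ler_norml => ? ?; apply/andP; split; lra. Qed.

Let sidedist_le1 n s : sidedist n s <= 1.
Proof.
by elim: n => [|n IH] /=; rewrite ?ler01// ge_max IH; case: ifP => _; [exact: ler01|exact: y_le1].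
Qed.

Let sidedist_ge n s j : (j < n)%N -> j != i0 -> `|y s j| <= sidedist n s.
Proof.
move=> + ji; elim: n => //= n IH; rewrite ltnS leq_eqVlt le_max => /orP[/eqP <-|/IH -> //].
by rewrite (negbTE ji) lexx orbT.
Qed.

Let sidedist_attained n s : 0 < sidedist n s ->
  exists2 j, (j < n)%N && (j != i0) & sidedist n s = `|y s j|.
Proof.
elim: n => /= [|n IH]; first by rewrite ltxx.
case: (leP (sidedist n s)); last first.
  by move=> _ /IH[j /andP[jn ji] ->]; exists j; rewrite // ji andbT (ltn_trans jn).
by case: eqP => [_ h0|/eqP ni _ _]; [rewrite ltxx|exists n; rewrite // ltnSn].
Qed.

Let u_itv s : 0 <= u s <= 1.
Proof. by rewrite /u; have /andP[? ?] := unitI_itv (s i0); case: b0; apply/andP; split; lra. Qed.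

Let denom_gt0 s : 0 < Num.max (1 - u s / 2) (sidedist N s).
Proof. by have /andP[? ?] := u_itv s; rewrite lt_max; apply/orP; left; lra. Qed.

Definition onhorn (i : nat) (b : bool) := (i < N)%N && ((i, b) != (i0, b0)).

(** On a horn face the maximum in [scale] is 1, so the projection does not move the point. *)
Lemma hornr_id s i b : onhorn i b -> s i = endp b -> hornr s = s.
Proof.
move=> /andP[iN nib] sib.
have sc1 : scale s = 1.
  rewrite /scale; suff -> : Num.max (1 - u s / 2) (sidedist N s) = 1 by rewrite invr1.
  have /andP[u0 u1] := u_itv s.
  have [ii0|ni] := eqVneq i i0.
    have bb : b = ~~ b0 by move: nib; rewrite xpair_eqE ii0 eqxx /=; case: (b) (b0) => [] [].
    have -> : u s = 0.
      rewrite /u -ii0 sib bb; case: (b0) => /=; first by rewrite I0E.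
      by rewrite I1E subrr.
    by rewrite mul0r subr0; apply/max_idPl.
  have : sidedist N s = 1.
    apply/eqP; rewrite eq_le sidedist_le1 /=; apply: le_trans (sidedist_ge _ iN ni).
    rewrite sib; case: (b) => /=; rewrite ?I1E ?I0E ler_normr; apply/orP; [left|right]; lra.
  by move=> ->; apply/max_idPr; lra.
apply/funext => j; rewrite /hornr sc1; case: eqP => [->|_].
  rewrite -[RHS]clampK; congr clamp; rewrite /u; case: b0; lra.
case: ifP => // _; rewrite -[RHS]clampK; congr clamp; lra.
Qed.

(** According to the term that attains the maximum in [scale], the ray leaves through the face
    opposite to (i0, b0) or through a side face of the coordinate that realises [sidedist]. *)
Lemma hornr_onhorn s : exists ib : nat * bool, onhorn ib.1 ib.2 /\ hornr s ib.1 = endp ib.2.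
Proof.
have /andP[u0 u1] := u_itv s.
have [le1|lt1] := leP (sidedist N s) (1 - u s / 2).
  exists (i0, ~~ b0); split; first by rewrite /onhorn i0N /= xpair_eqE eqxx; case: b0.
  have sc : scale s * (2 - u s) = 2.
    have -> : 2 - u s = 2 * (1 - u s / 2) by field.
    by rewrite /scale (max_idPl le1) mulrCA mulVf ?mulr1 //; lra.
  rewrite /hornr eqxx sc /endp; case: b0 => /=; rewrite /I0 /I1; congr clamp; lra.
have [|j /andP[jN ji] sj] := @sidedist_attained N s; first lra.
have sc : scale s * `|y s j| = 1.
  by rewrite /scale (max_idPr (ltW lt1)) sj mulVf //; rewrite -sj; lra.
exists (j, 0 <= y s j); split; first by rewrite /onhorn jN /= xpair_eqE (negbTE ji).
rewrite /hornr /= (negbTE ji) jN /endp.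
move: sc; case: ifP => y0 sc.
  by rewrite ger0_norm // in sc; rewrite sc /I1; congr clamp; lra.
rewrite ltr0_norm ?ltNge ?y0 // mulrN in sc.
by rewrite /I0; congr clamp; lra.
Qed.

Let x_continuous j : continuous (fun s : Q => set_val (s j) : R).
Proof.
exact: (@comp_continuous Q I R (fun s => s j) set_val (@component_continuous _ _ j) (@unitI_val_continuous R)).
Qed.

Let y_continuous j : continuous (fun s : Q => y s j).
Proof.
apply: continuous_realB; last exact: cst_continuous.
by apply: continuous_realM; [exact: cst_continuous|exact: x_continuous].
Qed.

Let sidedist_continuous n : continuous (sidedist n).
Proof.
elim: n => [|n IH]; first exact: cst_continuous.
apply: continuous_real_max => //; case: eqP => _; first exact: cst_continuous.
by apply: comp_continuous; [exact: y_continuous|exact: norm_continuous].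
Qed.

Let u_continuous : continuous u.
Proof.
rewrite /u; case: b0; first exact: x_continuous.
by apply: continuous_realB; [exact: cst_continuous|exact: x_continuous].
Qed.

Let scale_continuous : continuous scale.
Proof.
apply: continuous_realV => [s|]; first by rewrite gt_eqF.
apply: continuous_real_max => //.
apply: continuous_realB; first exact: cst_continuous.
by apply: continuous_realM; [exact: u_continuous|exact: cst_continuous].
Qed.

Lemma hornr_continuous : continuous hornr.
Proof.
have c2 : continuous (fun s : Q => 2 - scale s * (2 - u s)).
  apply: continuous_realB; first exact: cst_continuous.
  apply: continuous_realM; first exact: scale_continuous.
  by apply: continuous_realB; [exact: cst_continuous|exact: u_continuous].
apply: prod_continuous => j; rewrite /hornr; case: (j == i0).
  apply: comp_continuous; last exact: clamp_continuous.
  by case: b0 => //; apply: continuous_realB => //; exact: cst_continuous.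
case: (j < N)%N; last exact: component_continuous.
apply: comp_continuous; last exact: clamp_continuous.
apply: continuous_realM; last exact: cst_continuous.
apply: continuous_realD; first exact: cst_continuous.
by apply: continuous_realM; [exact: scale_continuous|exact: y_continuous].
Qed.

Lemma hornr_dep (s s' : Q) : (forall j, (j < N)%N -> s j = s' j) ->
  forall j, (j < N)%N -> hornr s j = hornr s' j.
Proof.
move=> ss j jN.
have sd n : (n <= N)%N -> sidedist n s = sidedist n s'.
  by elim: n => //= n IH nN; rewrite IH ?(ltnW nN) // ss.
by rewrite /hornr /scale /u jN sd // !ss.
Qed.

(** The map glued on the horn from the restrictions of [v i b] to the face (i, b) is composed with
    the retraction [hornr]. *)
Lemma horn_fill (Z : topologicalType) (v : nat -> bool -> Q -> Z) :
  (forall i b, onhorn i b -> continuous (v i b) /\ dep N (v i b)) ->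
  (forall i b j c s, (i < j)%N -> onhorn i b -> onhorn j c ->
     s i = endp b -> s j = endp c -> v i b s = v j c s) ->
  exists F : Q -> Z, [/\ continuous F, dep N F &
    forall i b s, onhorn i b -> s i = endp b -> F s = v i b s].
Proof.
move=> vcd vv.
have {}vv i b j c s : onhorn i b -> onhorn j c ->
     s i = endp b -> s j = endp c -> v i b s = v j c s.
  case: (ltngtP i j) => [ij|ji|->]; first exact: vv.
    by move=> *; apply: esym; exact: vv.
  by move=> _ _ -> /endp_inj ->.
(* An arbitrary choice of a horn face through the projected point; by [vv] the value does not depend
   on it. *)
pose p s := sval (cid (hornr_onhorn s)).
have pP s : onhorn (p s).1 (p s).2 /\ hornr s (p s).1 = endp (p s).2 := svalP (cid (hornr_onhorn s)).
pose F s := v (p s).1 (p s).2 (hornr s).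
have FE i b s : onhorn i b -> hornr s i = endp b -> F s = v i b (hornr s).
  by move=> ib hib; have [pp hp] := pP s; exact: vv.
exists F; split.
- pose l := [seq x <- [seq (i, b) | i <- iota 0 N, b <- [:: true; false]] | onhorn x.1 x.2].
  have memE i b : ((i, b) \in l) = onhorn i b.
    rewrite mem_filter; apply/andb_idr => /andP[iN _].
    by apply: allpairs_f; [rewrite mem_iota|case: (b)].
  apply: (@glue_continuous _ _ _ l (fun x => [set s | hornr s x.1 = endp x.2])
    (fun x => v x.1 x.2 \o hornr)).
  + move=> [i b] _ /=.
    have -> : [set s | hornr s i = endp b] = (fun s => hornr s i) @^-1` [set endp b] by [].
    apply: preimage_closed; last exact: closed_unitI.
    move=> x _; apply: (@continuous_comp _ _ _ hornr (fun s : Q => s i)).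
      exact: hornr_continuous.
    exact: component_continuous.
  + move=> [i b]; rewrite memE => /vcd[vc _] s.
    by apply: continuous_comp; [exact: hornr_continuous|exact: vc].
  + by move=> s; have [pp hp] := pP s; exists (p s) => //; case: (p s) pp => i b; rewrite memE.
  + by move=> [i b] s; rewrite memE => ib; exact: FE.
- move=> s s' ss; have [pp hp] := pP s.
  have hs := hornr_dep ss.
  have pN : ((p s).1 < N)%N by case/andP: pp.
  rewrite (FE _ _ s' pp); last by rewrite -hs.
  by rewrite /F; have [_] := vcd _ _ pp; apply.
- by move=> i b s ib sib; have h := hornr_id ib sib; rewrite (FE i b) ?h.
Qed.

End retraction.

End topology.

(** * Weak equivalences as a lifting property relative to the boundary *)

Section coordinates.
Local Open Scope ring_scope.
Context (R : realType).
Local Notation I := (unitI R).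
Local Notation I0 := (@I0 R).
Local Notation I1 := (@I1 R).
Local Notation Q := (prod_topology (fun _ : nat => I)).

Definition upd (i : nat) (x : I) (s : Q) : Q := fun j => if j == i then x else s j.
Definition del (i : nat) (s : Q) : Q := fun j => s (bump i j).
Definition ins (i : nat) (x : I) (s : Q) : Q :=
  fun j => if j == i then x else s (unbump i j).

Lemma updE i x s : upd i x s i = x.
Proof. by rewrite /upd eqxx. Qed.

Lemma updN i x s j : j != i -> upd i x s j = s j.
Proof. by rewrite /upd => /negbTE ->. Qed.

Lemma upd_id i x s : s i = x -> upd i x s = s.
Proof. by move=> <-; apply/funext => j; rewrite /upd; case: eqP => // ->. Qed.

Lemma insK i x s : del i (ins i x s) = s.
Proof.
by apply/funext => j; rewrite /del /ins eq_sym (negbTE (neq_bump _ _)) bumpK.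
Qed.

Lemma delK i s : ins i (s i) (del i s) = s.
Proof.
by apply/funext => j; rewrite /del /ins; case: eqP => [->//|/eqP ji]; rewrite unbumpKcond (negbTE ji).
Qed.

Lemma upd_continuous (T : topologicalType) i (x : T -> I) (f : T -> Q) :
  continuous x -> continuous f -> continuous (fun t => upd i (x t) (f t)).
Proof.
move=> xc fc; apply: prod_continuous => j; rewrite /upd; case: (j == i); first exact: xc.
exact: (@comp_continuous _ Q _ f (fun s => s j) fc (@component_continuous _ _ j)).
Qed.

Lemma reindex_continuous (f : nat -> nat) :
  continuous (fun s : Q => (fun j => s (f j)) : Q).
Proof. by apply: prod_continuous => j; exact: component_continuous. Qed.

Lemma del_continuous i : continuous (del i).
Proof. exact: reindex_continuous. Qed.

Lemma ins_continuous i x : continuous (ins i x).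
Proof.
apply: prod_continuous => j; rewrite /ins; case: (j == i).
  exact: cst_continuous.
exact: component_continuous.
Qed.

Lemma continuous_updc (Z : topologicalType) (f : Q -> Z) i x :
  continuous f -> continuous (fun s => f (upd i x s)).
Proof.
move=> fc; apply: comp_continuous fc; apply: upd_continuous; first exact: cst_continuous.
by move=> ?; exact: cvg_id.
Qed.

Lemma pair_continuous (T U V : topologicalType) (f : T -> U) (g : T -> V) :
  continuous f -> continuous g -> continuous (fun t => (f t, g t)).
Proof.
by move=> fc gc t; apply: (@cvg_pair _ _ _ (nbhs t)); [exact: fc|exact: gc].
Qed.

Definition onface (N : nat) (s : Q) := exists i c, (i < N)%N /\ s i = endp R c.

(** Boundary data are total functions with arbitrary interior values; continuity is therefore asked
    only after projection to a face. *)
Definition facewise_continuous (Z : topologicalType) (N : nat) (b : Q -> Z) :=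
  forall i c, (i < N)%N -> continuous (fun s => b (upd i (endp R c) s)).

(* The relative homotopy lifting property which characterises weak
   equivalences: a map of (cube, boundary) into the mapping cylinder of phi can
   be deformed into Z1 relative to the boundary. *)
Definition weak_equiv (Z1 Z0 : topologicalType) (phi : Z1 -> Z0) :=
  forall N (b : Q -> Z1) (g' : Q -> Z0),
    dep N b -> facewise_continuous N b -> dep N g' -> continuous g' ->
    (forall s, onface N s -> phi (b s) = g' s) ->
  exists g H, [/\ continuous g /\ dep N g, forall s, onface N s -> g s = b s,
    continuous H /\ dep N.+1 H,
    (forall s, s N = I0 -> H s = g' s) /\ (forall s, s N = I1 -> H s = phi (g s)) &
    forall s, onface N s -> H s = g' s].

Lemma onface_leq N M s : (N <= M)%N -> onface N s -> onface M s.
Proof. by move=> NM [i [c [iN sic]]]; exists i, c; split => //; apply: leq_trans NM. Qed.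

Lemma onface_dep N s s' : (forall j, (j < N)%N -> s j = s' j) -> onface N s -> onface N s'.
Proof. by move=> ss [i [c [iN sic]]]; exists i, c; rewrite -ss. Qed.

Lemma onface_upd N i x s : (N <= i)%N -> onface N s -> onface N (upd i x s).
Proof. by move=> Ni; apply: onface_dep => j jN; rewrite updN // neq_ltn (leq_trans jN). Qed.

(** The track of [b] under [h], run backwards, transports g' to a map g with boundary b; comparing
    this with the track of g itself gives the homotopy. *)
Lemma weak_equiv_homotopic_id (Z : topologicalType) (h : I * Z -> Z) :
  continuous h -> (forall z, h (I0, z) = z) -> weak_equiv (fun z => h (I1, z)).
Proof.
move=> hc h0 N b g' bN bc g'N g'c bg.
have updb i c s x : (i < N)%N -> b (upd i c (upd N x s)) = b (upd i c s).
  move=> iN; apply: bN => j jN; rewrite /upd; case: eqP => // _.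
  by rewrite ltn_eqF.
have hcont (f : Q -> Z) n : continuous f -> continuous (fun s : Q => h (s n, f s)).
  move=> fc; apply: comp_continuous hc; apply: pair_continuous fc.
  exact: component_continuous.
have valid1 i c : onhorn N.+1 N false i c -> (i = N /\ c = true) \/ (i < N)%N.
  rewrite /onhorn ltnS leq_eqVlt => /andP[/orP[/eqP -> |]]; last by right.
  by rewrite xpair_eqE eqxx /=; case: c; left.
(* Coordinate N is time: g' at time 1, the track of b on the sides. Time 0 is left open, and the
   filling restricts to g there. *)
have [|||F [Fc FN FE]] := @horn_fill R N.+1 N false _ Z
    (fun i c => if i == N then g' else fun s => h (s N, b (upd i (endp R c) s))).
- exact: ltnSn.
- move=> i c /valid1[[-> _]|iN]; rewrite ?eqxx; first by split => //; exact: dep_leq g'N.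
  rewrite ltn_eqF //; split; first exact/hcont/bc.
  move=> s s' ss; rewrite ss //; congr (h (_, _)); apply: bN => j jN.
  by rewrite /upd ss // (leq_trans jN).
- move=> i b1 j b2 s ij /valid1[[iE _]|iN] /valid1[[jE b2E]|jN] si sj; try by lia.
  + rewrite jE eqxx ltn_eqF // upd_id // -bg; last by exists i, b1.
    by move: sj; rewrite jE b2E => ->.
  + by rewrite !ltn_eqF // !upd_id.
have F1 s : s N = I1 -> F s = g' s.
  by move=> sN; rewrite (FE N true) ?eqxx // /onhorn ltnSn xpair_eqE andbF.
have Fb s : onface N s -> F s = h (s N, b s).
  move=> [i [c [iN sic]]]; rewrite (FE i c) ?(ltn_eqF iN) ?upd_id //.
  by rewrite /onhorn xpair_eqE (ltn_eqF iN) /= andbT ltnS ltnW.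
pose g s := F (upd N I0 s).
have gc : continuous g by exact: continuous_updc.
have gN : dep N g.
  move=> s s' ss; apply: FN => j jN; rewrite /upd; case: eqP => // /eqP nj.
  by apply: ss; rewrite ltn_neqAle nj.
have gb s : onface N s -> g s = b s.
  move=> sN; rewrite /g Fb; last exact: onface_upd.
  by rewrite updE h0; apply: bN => j jN; rewrite updN // ltn_eqF.
have valid2 i c : onhorn N.+2 N true i c ->
    [\/ i = N.+1, i = N /\ c = false | (i < N)%N].
  rewrite /onhorn ltnS leq_eqVlt => /andP[/orP[/eqP ->|]]; first by constructor 1.
  rewrite ltnS leq_eqVlt => /orP[/eqP -> |]; last by constructor 3.
  by rewrite xpair_eqE eqxx /=; case: c; constructor 2.
have N1 : (N.+1 == N) = false by lia.
(* F and the track of g both start at g and follow the track of b on the boundary. Filling between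
   them in coordinate N + 1 leaves open the face at time 1, which is the required homotopy from g'
   to h(1, g). *)
have [|||K [Kc KN KE]] := @horn_fill R N.+2 N true _ Z
    (fun i c => if i == N.+1 then (if c then fun s => h (s N, g s) else F)
     else if i == N then g else fun s => h (s N, b (upd i (endp R c) s))).
- by [].
- move=> i c /valid2[->|[-> _]|iN].
  + rewrite eqxx; case: c; split => //; first exact: hcont.
      move=> s s' ss; rewrite ss //; congr (h (_, _)); apply: gN => j jN; apply: ss.
      by apply: leq_trans jN _; rewrite leqW.
    exact: dep_leq FN.
  + rewrite eqxx ltn_eqF //; split => //; apply: dep_leq gN; lia.
  + have -> : (i == N.+1) = false by lia.
    rewrite ltn_eqF //; split; first exact/hcont/bc.
    move=> s s' ss; rewrite ss //; congr (h (_, _)); apply: bN => j jN.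
    by rewrite /upd ss //; lia.
- move=> i b1 j b2 s ij /valid2[iE|[iE b1E]|iN] /valid2[jE|[jE b2E]|jN] si sj; try by lia.
  + rewrite jE iE eqxx eq_sym N1 eqxx; case: b2 sj => _.
      by move: si; rewrite iE b1E => ->; rewrite h0.
    by rewrite /g upd_id //; move: si; rewrite iE b1E.
  + have sN : onface N s by exists i, b1.
    have -> : (i == N.+1) = false by lia.
    rewrite jE eqxx (ltn_eqF iN) upd_id //.
    by case: b2 sj => _; [rewrite gb|rewrite Fb].
  + have sN : onface N s by exists i, b1.
    have -> : (i == N.+1) = false by lia.
    rewrite jE eqxx (ltn_eqF iN) (ltn_eqF (ltnSn N)) upd_id //.
    by rewrite gb //; move: sj; rewrite jE b2E => ->; rewrite h0.
  + have -> : (i == N.+1) = false by lia.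
    have -> : (j == N.+1) = false by lia.
    by rewrite (ltn_eqF iN) (ltn_eqF jN) !upd_id.
have onN1 c : onhorn N.+2 N true N.+1 c by rewrite /onhorn ltnSn xpair_eqE N1.
have K0 s : s N.+1 = I0 -> K s = F s by move=> s0; rewrite (KE N.+1 false) ?eqxx.
have K1 s : s N.+1 = I1 -> K s = h (s N, g s) by move=> s0; rewrite (KE N.+1 true) ?eqxx.
have Kb s : onface N s -> K s = h (s N, b s).
  move=> [i [c [iN sic]]]; rewrite (KE i c) //; last first.
    by rewrite /onhorn xpair_eqE (ltn_eqF iN) /= andbT; lia.
  have -> : (i == N.+1) = false by lia.
  by rewrite ltn_eqF // upd_id.
(* Restricts K to its face at time 1 and lets coordinate N take the place of coordinate N + 1. *)
pose m (s : Q) : Q := upd N.+1 (s N) (upd N I1 s).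
have mN s : m s N = I1 by rewrite /m updN ?updE // eq_sym N1.
have mN1 s : m s N.+1 = s N by rewrite /m updE.
have mj s j : (j < N)%N -> m s j = s j by move=> jN; rewrite /m !updN //; lia.
have monface s : onface N s -> onface N (m s).
  by apply: onface_dep => j jN; rewrite mj.
exists g, (fun s => K (m s)); split => //.
- split.
    apply: comp_continuous Kc; apply: upd_continuous; first exact: component_continuous.
    by apply: upd_continuous; [exact: cst_continuous|move=> ?; exact: cvg_id].
  move=> s s' ss; apply: KN => j jN; rewrite /m /upd.
  case: (j =P N.+1) => [_|j1]; first exact: ss.
  by case: (j =P N) => // j2; apply: ss; lia.
- split=> s sN.
    rewrite K0 ?mN1 // F1 ?mN //; apply: g'N => j jN; exact: mj.
  rewrite K1 ?mN1 // mN; congr (h (_, _)); apply: gN => j jN; exact: mj.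
- move=> s sN; rewrite Kb; last exact: monface.
  by rewrite mN bg ?(g'N _ s) // => [j jN|]; [exact: mj|exact: monface].
Qed.

(** Lifting for psi phi produces g and a homotopy from psi g' to psi phi g. Its image under phi
    fills the boundary of the wanted homotopy after phi psi has been applied, and lifting for phi
    psi, one dimension higher, removes phi psi. *)
Lemma weak_equiv_cancel (Z1 Z0 : topologicalType) (phi : Z1 -> Z0) (psi : Z0 -> Z1) :
  continuous phi -> continuous psi ->
  weak_equiv (fun z => psi (phi z)) -> weak_equiv (fun z => phi (psi z)) ->
  weak_equiv phi.
Proof.
move=> phic psic w1 w0 N b g' bN bc g'N g'c bg.
have [|||g [H1 [[gc gN] gb [H1c H1N] [H10 H11] H1b]]] :=
    w1 N b (fun s => psi (g' s)) bN bc.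
- by move=> s s' ss; rewrite (g'N s s').
- exact: comp_continuous psic.
- by move=> s /bg ->.
(* Boundary of the wanted homotopy from g' to phi g, constant in time on the sides. *)
pose d s := if s N == I1 then phi (g s) else g' s.
have db s : onface N s -> d s = g' s by move=> sN; rewrite /d gb // bg //; case: ifP.
have d1 s : s N = I1 -> d s = phi (g s) by rewrite /d => ->; rewrite eqxx.
have d0 s : s N = I0 -> d s = g' s.
  by rewrite /d => ->; case: eqP => // /I0_neq_I1.
have faceN s : onface N.+1 s -> [\/ onface N s, s N = I0 | s N = I1].
  move=> [i [c [+ sic]]]; rewrite ltnS leq_eqVlt => /orP[/eqP iN|iN].
    by move: sic; rewrite iN; case: c => ->; [constructor 3|constructor 2].
  by constructor 1; exists i, c.
have [|||||g2 [_ [[g2c g2N] g2b _ _ _]]] := w0 N.+1 d (fun s => phi (H1 s)).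
- move=> s s' ss; rewrite /d ss // (gN s s') ?(g'N s s') // => j jN; apply: ss; exact: leqW.
- move=> i c; rewrite ltnS leq_eqVlt => /orP[/eqP ->|iN].
    case: c.
      have -> : (fun s => d (upd N (endp R true) s)) = (fun s => phi (g (upd N (endp R true) s))).
        by apply/funext => s; rewrite d1 // updE.
      exact/comp_continuous/phic/continuous_updc.
    have -> : (fun s => d (upd N (endp R false) s)) = (fun s => g' (upd N (endp R false) s)).
      by apply/funext => s; rewrite d0 // updE.
    exact: continuous_updc.
  have -> : (fun s => d (upd i (endp R c) s)) = (fun s => g' (upd i (endp R c) s)).
    by apply/funext => s; rewrite db //; exists i, c; rewrite updE.
  exact: continuous_updc.
- by move=> s s' ss; rewrite (H1N s s').
- exact: comp_continuous phic.
- move=> s /faceN[sN|sN|sN]; first by rewrite db // H1b.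
    by rewrite d0 // H10.
  by rewrite d1 // H11.
exists g, g2; split => //.
- split=> s sN; rewrite g2b.
  + exact: d0.
  + by exists N, false.
  + exact: d1.
  + by exists N, true.
- by move=> s sN; rewrite g2b ?db //; apply: onface_leq sN.
Qed.

End coordinates.

(** * Cubes several faces of which carry the same unknown map *)

Section multiple_faces.
Local Open Scope ring_scope.
Context (R : realType).
Local Notation I := (unitI R).
Local Notation I0 := (@I0 R).
Local Notation I1 := (@I1 R).
Local Notation Q := (prod_topology (fun _ : nat => I)).
Local Notation endp := (endp R).

Lemma dep_del (Z : Type) N i (f : Q -> Z) : (i <= N)%N -> dep N f -> dep N.+1 (fun s => f (del i s)).
Proof.
move=> iN fN s s' ss; apply: fN => j jN; apply: ss.
by rewrite /bump; case: (i <= j)%N; lia.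
Qed.

Lemma bump_ge i j : (i <= j)%N -> bump i j = j.+1.
Proof. by rewrite /bump => ->. Qed.

Variables (Z1 Z0 : topologicalType) (phi : Z1 -> Z0).
Hypotheses (phic : continuous phi) (phiW : weak_equiv R phi).
Variables (M : nat) (J : pred nat) (i1 : nat) (b1 : bool).
Hypotheses (i1M : (i1 <= M)%N) (JM : forall p, J p -> (p < M)%N)
  (JJ : forall p, J p -> ~~ J p.+1)
  (Ji1 : forall p, J p -> b1 = false -> i1 <> p /\ i1 <> p.+1).

(** [J p] pairs the faces (p, 0) and (p + 1, 0); (i1, b1) is the designated face left without a
    partner. *)
Definition pairface (i : nat) (c : bool) := ~~ c && (J i || (0 < i)%N && J i.-1).
Definition designated (i : nat) (c : bool) := ((i, c) == (i1, b1)) || pairface i c.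

Variables (b : Q -> Z1) (v : nat -> bool -> Q -> Z0).
Hypotheses (bM : dep M b) (bc : facewise_continuous M b).
Hypothesis vc : forall i c, (i <= M)%N -> ~~ designated i c ->
  continuous (v i c) /\ dep M.+1 (v i c).
(** The common map on the designated faces is still to be found; [b] carries its boundary. *)
Hypothesis vd : forall i c s, (i <= M)%N -> designated i c -> s i = endp c ->
  v i c s = phi (b (del i s)).
Hypothesis vv : forall i c j d s, (i < j <= M)%N -> s i = endp c -> s j = endp d ->
  v i c s = v j d s.

Let vv' i c j d s : i != j -> (i <= M)%N -> (j <= M)%N -> s i = endp c -> s j = endp d ->
  v i c s = v j d s.
Proof.
case: (ltngtP i j) => // ij _ iM jM si sj; first by apply: vv; rewrite ?ij.
by apply: esym; apply: vv; rewrite ?ij.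
Qed.

(** For a pair face i, the index p of its pair. *)
Let pr i := if J i then i else i.-1.

Let pairfaceP i c : (i <= M)%N -> pairface i c ->
  [/\ c = false, J (pr i), (pr i <= i)%N & (pr i < M)%N].
Proof.
move=> iM; rewrite /pairface /pr; case: c => //=.
case Ji: (J i) => /=; first by split => //; exact: JM.
by move=> /andP[i0 Jp]; split => //; [exact: leq_pred|exact: JM].
Qed.

Let pair_single : ~~ pairface i1 b1.
Proof.
apply/negP => /(pairfaceP i1M)[b1F Jp _ _]; move: Jp; rewrite /pr; case: ifP => Ji Jp.
  by have [] := Ji1 Jp b1F.
have [_ ] := Ji1 Jp b1F; have [i10|] := posnP i1; last by lia.
by move: Ji Jp; rewrite i10 /= => ->.
Qed.

(** The faces (p, 0) and (p + 1, 0) meet where both coordinates vanish. There deleting either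
    coordinate gives the same point, which lies on the face (p, 0) of the smaller cube. So [Y p] is
    free on that face, provided that it equals phi b on the rest of the boundary. *)
Let pair_consistent (X : nat -> bool -> Q -> Z0) (Y : nat -> Q -> Z0) :
  (forall i c j d s, (i <= M)%N -> (j <= M)%N -> i != j -> ~~ pairface i c ->
     s i = endp c -> s j = endp d -> X i c s = v i c s) ->
  (forall i c s, (i <= M)%N -> pairface i c -> X i c s = Y (pr i) (del i s)) ->
  (forall p j d t, J p -> (j < M)%N -> (j, d) != (p, false) -> t j = endp d -> Y p t = phi (b t)) ->
  forall i c j d s, i != j -> (i <= M)%N -> (j <= M)%N -> s i = endp c -> s j = endp d ->
    X i c s = X j d s.
Proof.
move=> Xn Xp Yb.
have key i c j d s : i != j -> (i <= M)%N -> (j <= M)%N -> s i = endp c -> s j = endp d ->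
    X i c s = v i c s \/ [/\ pairface i c, d = false & unbump i j = pr i].
  move=> ij iM jM si sj; case pic: (pairface i c); last by left; apply: Xn sj => //; rewrite pic.
  have [_ Jp _ _] := pairfaceP iM pic.
  have [E|nE] := eqVneq (unbump i j, d) (pr i, false); first by right; case: E.
  left; rewrite Xp // vd //; last by rewrite /designated pic orbT.
  apply: Yb nE _ => //; last by rewrite /del unbumpK // inE eq_sym.
  by move: ij; rewrite /unbump; case: ltnP; lia.
have partner i c j d s : i != j -> (i <= M)%N -> (j <= M)%N -> s i = endp c -> s j = endp d ->
    [/\ pairface i c, d = false & unbump i j = pr i] -> X i c s = X j d s.
  move=> ij iM jM si sj [pic dF uij].
  have [cF Jp pi pM] := pairfaceP iM pic.
  have [jE|iE] : (j = i.+1 /\ J i) \/ (i = j.+1 /\ J j).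
    move: Jp uij; rewrite /pr /unbump; case Ji: (J i) => Jp uij.
      by left; move: uij; case: ltnP; move: ij => /eqP; lia.
    right; have [i0|i0] := posnP i; first by rewrite i0 /= in Jp; rewrite i0 Jp in Ji.
    have jE : j = i.-1 by move: uij; case: ltnP; move: ij => /eqP; lia.
    by rewrite jE prednK.
  - have [jE' Ji] := jE.
    have pj : pairface j d by rewrite /pairface dF jE' /= Ji orbT.
    rewrite (Xp i) // (Xp j) // /pr Ji jE' (negbTE (JJ Ji)) /=; congr (Y _ _).
    apply/funext => n; rewrite /del /bump.
    have [ni|ni|->] := ltngtP n i; [congr (s _); lia|congr (s _); lia|].
    by rewrite ?leqnn ?ltnn ?add1n ?add0n -jE' si sj cF dF.
  - have [iE' Jj] := iE.
    have pj : pairface j d by rewrite /pairface dF Jj.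
    rewrite (Xp i) // (Xp j) // /pr Jj iE' (negbTE (JJ Jj)) /=; congr (Y _ _).
    apply/funext => n; rewrite /del /bump.
    have [nj|nj|->] := ltngtP n j; [congr (s _); lia|congr (s _); lia|].
    by rewrite ?leqnn ?ltnn ?add1n ?add0n -iE' si sj cF dF.
move=> i c j d s ij iM jM si sj.
have [XE|] := key i c j d s ij iM jM si sj; last exact: partner.
have ji : j != i by rewrite eq_sym.
have [XE'|] := key j d i c s ji jM iM sj si; last by move=> h; apply: esym; exact: partner h.
by rewrite XE XE'; exact: vv'.
Qed.

Let onhorn_le N i0 b0 i c : onhorn N.+1 i0 b0 i c -> (i <= N)%N.
Proof. by case/andP; rewrite ltnS. Qed.

Let onhorn_neq N i0 b0 i c : (i <= N)%N -> i != i0 -> onhorn N.+1 i0 b0 i c.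
Proof. by move=> iN ii; rewrite /onhorn ltnS iN xpair_eqE (negbTE ii). Qed.

Let bump_le i j N : (i <= N)%N -> (j < N)%N -> (bump i j <= N)%N.
Proof. by rewrite /bump; case: (i <= j)%N; lia. Qed.

(** Provisional maps for the pairs: horn fillings of phi b that leave the face (p, 0) open. *)
Let pairfill : exists D : nat -> Q -> Z0, forall p, J p ->
  [/\ continuous (D p), dep M (D p) &
    forall j d t, (j < M)%N -> (j, d) != (p, false) -> t j = endp d -> D p t = phi (b t)].
Proof.
suff: forall p, exists Dp : Q -> Z0, J p -> [/\ continuous Dp, dep M Dp &
    forall j d t, (j < M)%N -> (j, d) != (p, false) -> t j = endp d -> Dp t = phi (b t)].
  by move=> /choice[D0 D0P]; exists D0.
move=> p; have [Jp|nJ] := boolP (J p); last by exists (fun s => phi (b s)).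
have [||F [Fc FN FE]] := @horn_fill R M p false (JM Jp) Z0
    (fun j d s => phi (b (upd j (endp d) s))).
- move=> j d /andP[jM _]; split; first by apply: comp_continuous phic; exact: bc.
  move=> s s' ss; congr phi; apply: bM => n nM; rewrite /upd; case: (n == j) => //.
  exact: ss.
- by move=> i c j d s _ _ _ si sj; rewrite !upd_id.
exists F => _; split => // j d t jM jd tj.
by rewrite (FE j d) ?upd_id // /onhorn jM.
Qed.

(** Once g is known, the provisional maps are deformed into phi g; the face (p, 0) stays open during
    the deformation. *)
Let pairhomotopy (D : nat -> Q -> Z0) (g : Q -> Z1) :
  (forall p, J p -> [/\ continuous (D p), dep M (D p) &
    forall j d t, (j < M)%N -> (j, d) != (p, false) -> t j = endp d -> D p t = phi (b t)]) ->
  continuous g -> dep M g -> (forall t, onface M t -> g t = b t) ->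
  exists E : nat -> Q -> Z0, forall p, J p ->
  [/\ continuous (E p), dep M.+1 (E p),
    forall j d t, (j < M)%N -> (j, d) != (p, false) -> t j = endp d -> E p t = phi (b t),
    forall t, t M = I0 -> E p t = D p t & forall t, t M = I1 -> E p t = phi (g t)].
Proof.
move=> DP gc gM gb.
suff: forall p, exists Ep : Q -> Z0, J p -> [/\ continuous Ep, dep M.+1 Ep,
    forall j d t, (j < M)%N -> (j, d) != (p, false) -> t j = endp d -> Ep t = phi (b t),
    forall t, t M = I0 -> Ep t = D p t & forall t, t M = I1 -> Ep t = phi (g t)].
  by move=> /choice[D0 D0P]; exists D0.
move=> p; have [Jp|nJ] := boolP (J p); last by exists (fun s => phi (b s)).
have [Dc DM DE] := DP p Jp; have pM := JM Jp.
have [||F [Fc FN FE]] := @horn_fill R M.+1 p false (ltnW pM) Z0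
    (fun j d s => if j == M then if d then phi (g s) else D p s
                  else phi (b (upd j (endp d) s))).
- move=> j d /onhorn_le; rewrite leq_eqVlt => /orP[/eqP ->|jM].
    rewrite eqxx; case: d; split => //.
    + exact: comp_continuous phic.
    + by move=> s s' ss; rewrite (gM s s') // => n nM; apply: ss; exact: leqW.
    + exact: dep_leq DM.
  rewrite ltn_eqF //; split; first by apply: comp_continuous phic; exact: bc.
  move=> s s' ss; congr phi; apply: bM => n nM; rewrite /upd; case: (n == j) => //.
  by apply: ss; exact: leqW.
- move=> i c j d s ij /andP[_ ic] /onhorn_le jM si sj.
  have iM : (i < M)%N by lia.
  rewrite (ltn_eqF iM) upd_id //; case: eqP => [jE|_]; last by rewrite upd_id.
  case: d sj => _; last by rewrite (DE i c).
  by rewrite gb //; exists i, c.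
exists F => _; split => //.
- move=> j d t jM jd tj; rewrite (FE j d) ?(ltn_eqF jM) ?upd_id //.
  by rewrite /onhorn ltnS (ltnW jM).
- move=> t tM; rewrite (FE M false) ?eqxx //; apply: onhorn_neq => //.
  by rewrite eq_sym ltn_eqF.
- move=> t tM; rewrite (FE M true) ?eqxx //; apply: onhorn_neq => //.
  by rewrite eq_sym ltn_eqF.
Qed.

(* The two faces (p, 0) and (p + 1, 0) of a pair have opposite orientations, so
   the same map can be placed on both of them independently of its choice;
   hence only the remaining designated face constrains g. *)
Lemma multi_fill : exists (g : Q -> Z1) (F : Q -> Z0),
  [/\ continuous g /\ dep M g, forall t, onface M t -> g t = b t,
    continuous F /\ dep M.+1 F,
    forall i c s, (i <= M)%N -> ~~ designated i c -> s i = endp c -> F s = v i c s &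
    forall i c s, (i <= M)%N -> designated i c -> s i = endp c -> F s = phi (g (del i s))].
Proof.
have [D DP] := pairfill.
pose X i c s := if pairface i c then D (pr i) (del i s) else v i c s.
have Xpair i c s : pairface i c -> X i c s = D (pr i) (del i s) by rewrite /X => ->.
have Xnpair i c s : ~~ pairface i c -> X i c s = v i c s by rewrite /X => /negbTE ->.
have Xcons i c j d s : i != j -> (i <= M)%N -> (j <= M)%N -> s i = endp c -> s j = endp d ->
    X i c s = X j d s.
  apply: (@pair_consistent X D) => {i c j d s}.
  - by move=> i c j d s _ _ _ pic _ _; rewrite Xnpair.
  - by move=> i c s _ pic; rewrite Xpair.
  - by move=> p j d t /DP[_ _]; apply.
(* With provisional maps on the pairs, the single face is the only open one; the filling puts the
   map [gh] on it. *)
have [||F0 [F0c F0N F0E]] := @horn_fill R M.+1 i1 b1 i1M Z0 X.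
- move=> i c /[dup] /onhorn_le iM /andP[_ ic].
  case pic: (pairface i c).
    have [_ /DP[Dc DN _] _ _] := pairfaceP iM pic.
    rewrite /X pic; split; last exact: dep_del.
    by apply: comp_continuous Dc; exact: del_continuous.
  rewrite /X pic; apply: vc => //.
  by rewrite /designated (negbTE ic) pic.
- move=> i c j d s ij /onhorn_le iM /onhorn_le jM si sj.
  by apply: Xcons => //; rewrite ltn_eqF.
pose gh t := F0 (ins i1 (endp b1) t).
have ghc : continuous gh by apply: comp_continuous F0c; exact: ins_continuous.
have ghM : dep M gh.
  move=> s s' ss; apply: F0N => n nM; rewrite /ins; case: eqP => // /eqP ni.
  apply: ss; rewrite /unbump; move: ni nM i1M; case: ltnP; lia.
have ghb t : onface M t -> phi (b t) = gh t.
  move=> [j [d [jM tj]]].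
  have sj : ins i1 (endp b1) t (bump i1 j) = endp d.
    by rewrite /ins eq_sym (negbTE (neq_bump _ _)) bumpK.
  have si : ins i1 (endp b1) t i1 = endp b1 by rewrite /ins eqxx.
  have bj : bump i1 j != i1 by rewrite eq_sym neq_bump.
  have bM' := bump_le i1M jM.
  rewrite /gh (F0E _ _ _ (onhorn_neq _ _ bM' bj) sj) (Xcons _ _ i1 b1) //.
  by rewrite Xnpair // vd // ?insK // /designated eqxx.
(* The weak equivalence replaces [gh] by phi g, up to a homotopy that is fixed on the boundary. *)
have [g [H [[gc gM] gb [Hc HM] [H0 H1] Hb]]] := phiW bM bc ghM ghc ghb.
have [E EP] := pairhomotopy DP gc gM gb.
(* Coordinate M + 1 is time. [W] deforms [gh] and the provisional maps into phi g and keeps the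
   other faces; a filling that starts at [F0] is the desired cube at time 1. *)
pose W i c s := if pairface i c then E (pr i) (del i s) else
  if (i, c) == (i1, b1) then H (del i s) else v i c s.
have Wpair i c s : pairface i c -> W i c s = E (pr i) (del i s) by rewrite /W => ->.
have Wsingle s : W i1 b1 s = H (del i1 s) by rewrite /W (negbTE pair_single) eqxx.
have Wother i c s : ~~ designated i c -> W i c s = v i c s.
  by rewrite /W negb_or => /andP[/negbTE -> /negbTE ->].
have Wcons i c j d s : i != j -> (i <= M)%N -> (j <= M)%N -> s i = endp c -> s j = endp d ->
    W i c s = W j d s.
  apply: (@pair_consistent W E) => {i c j d s}.
  - move=> i c j d s iM jM ij pic si sj; have [E1|ic] := eqVneq (i, c) (i1, b1); last first.
      by apply: Wother; rewrite /designated (negbTE ic).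
    case: E1 iM jM ij pic si sj => -> -> iM jM ij pic si sj.
    rewrite Wsingle vd //; last by rewrite /designated eqxx.
    have oM : onface M (del i1 s).
      exists (unbump i1 j), d; split; first by move: ij jM; rewrite /unbump; case: ltnP; lia.
      by rewrite /del unbumpK // inE eq_sym.
    by rewrite Hb // ghb.
  - by move=> i c s _ pic; rewrite Wpair.
  - by move=> p j d t /EP[_ _ + _ _]; apply.
have delM i s : (i <= M)%N -> del i s M = s M.+1 by move=> iM; rewrite /del bump_ge.
have [||F [Fc FN FE]] := @horn_fill R M.+2 M.+1 true (ltnSn _) Z0
    (fun i c => if i == M.+1 then F0 else W i c).
- move=> i c /andP[]; rewrite ltnS leq_eqVlt => /orP[/eqP -> _|].
    by rewrite eqxx; split => //; exact: dep_leq F0N.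
  move=> iM _; rewrite (ltn_eqF iM); rewrite ltnS in iM.
  case pic: (pairface i c).
    have [_ /EP[Ec EN _ _ _] _ _] := pairfaceP iM pic.
    rewrite /W pic; split; last by apply: dep_del => //; exact: leqW.
    by apply: comp_continuous Ec; exact: del_continuous.
  have [[-> ->]|ic] := eqVneq (i, c) (i1, b1).
    rewrite /W (negbTE pair_single) eqxx; split; last by apply: dep_del => //; exact: leqW.
    by apply: comp_continuous Hc; exact: del_continuous.
  have nd : ~~ designated i c by rewrite /designated (negbTE ic) pic.
  have -> : W i c = v i c by apply/funext => s; exact: Wother.
  by have [? vN] := vc iM nd; split => //; exact: dep_leq vN.
- move=> i c j d s ij /andP[iM _] /andP[jM jd] si sj.
  have {}iM : (i <= M)%N by lia.
  rewrite [i == _]ltn_eqF; last by lia.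
  case: eqP => [jE|jN]; last by apply: Wcons => //; lia.
  have {}sj : s M.+1 = I0 by move: jd sj; rewrite jE xpair_eqE eqxx /=; case: (d).
  case pic: (pairface i c).
    have [_ /EP[_ _ _ E0 _] _ _] := pairfaceP iM pic.
    rewrite Wpair // E0 ?delM // -(Xpair i c) // -(F0E i c) //.
    rewrite /onhorn ltnS iM /=; apply/negP => /eqP[ii cc].
    by move: pair_single; rewrite -ii -cc pic.
  have [[ii cc]|ic] := eqVneq (i, c) (i1, b1).
    by move: si; rewrite ii cc => si; rewrite Wsingle H0 ?delM // /gh -si delK.
  rewrite Wother ?/designated ?(negbTE ic) ?pic // -(Xnpair i c) ?pic // -(F0E i c) //.
  by rewrite /onhorn ltnS iM.
pose m (s : Q) : Q := upd M.+1 I1 s.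
have mE s i : (i <= M)%N -> m s i = s i by move=> iM; rewrite /m updN // ltn_eqF.
have FW s i c : (i <= M)%N -> s i = endp c -> F (m s) = W i c (m s).
  move=> iM si; rewrite (FE i c) ?mE //; last by apply: onhorn_neq; lia.
  by rewrite ltn_eqF.
have delm i s j : (i <= M)%N -> (j < M)%N -> del i (m s) j = del i s j.
  by move=> iM jM; rewrite /del mE // bump_le.
exists g, (fun s => F (m s)); split => //.
- split; first exact: continuous_updc.
  move=> s s' ss; apply: FN => j jM; rewrite /m /upd; case: eqP => // ?.
  by apply: ss; lia.
- move=> i c s iM nd si; rewrite (FW _ i c) // Wother //.
  by have [_] := vc iM nd; apply => j jM; rewrite mE.
- move=> i c s iM dic si; rewrite (FW _ i c) //.
  have gm : g (del i (m s)) = g (del i s) by apply: gM => j jM; rewrite delm.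
  have mM : del i (m s) M = I1 by rewrite delM // /m updE.
  case pic: (pairface i c).
    have [_ /EP[_ _ _ _ E1] _ _] := pairfaceP iM pic.
    by rewrite Wpair // E1 // gm.
  move: dic; rewrite /designated pic orbF => /eqP[ii cc].
  by rewrite ii cc Wsingle -ii H1 // gm.
Qed.

End multiple_faces.

(** * Sequences in X x isoI *)

(** Proof irrelevance gives uniqueness of identity proofs for every index type. *)
Lemma existT_inj (T : Type) (P : T -> Type) x (a b : P x) :
  existT P x a = existT P x b -> a = b.
Proof.
by move=> E; have := projT2_eq E; rewrite (Prop_irrelevance (projT1_eq E) erefl).
Qed.

Section bipaths.
Local Open Scope nat_scope.
Context (X : category).

(* Composable sequences in the product of X with isoI, from the object (x, e)
   to (y, d); only the components in X of the morphisms are recorded. *)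
Inductive bipath (y : X) (d : bool) : X -> bool -> Type :=
| BOne x e (f : hom y x) : bipath y d x e
| BCons x e x' e' (f : hom x' x) (p : bipath y d x' e') : bipath y d x e.

Fixpoint bdim y d x e (p : bipath y d x e) : nat :=
  if p is BCons _ _ _ _ _ q then (bdim q).+1 else 0.

Fixpoint bcat z c x e (p : bipath z c x e) y d (q : bipath y d z c) : bipath y d x e :=
  match p with
  | BOne x e f => BCons e f q
  | BCons x e _ _ f p' => BCons e f (bcat p' q)
  end.

Definition bpre y d x' e' (q : bipath y d x' e') : forall x (e : bool), hom x' x -> bipath y d x e :=
  match q with
  | BOne x' _ g => fun x e f => BOne d e (compm f g)
  | BCons x' _ _ _ g r => fun x e f => BCons e (compm f g) r
  end.

(* Meant for i < bdim p. *)
Fixpoint bmerge (i : nat) y d x e (p : bipath y d x e) {struct p} : bipath y d x e :=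
  match p with
  | BOne x e f => BOne d e f
  | BCons x e x' e' f q =>
    if i is j.+1 then BCons e f (bmerge j q) else bpre q e f
  end.

(** These are the sequences that lie in the product of X with [arrowI], where G prescribes the
    values. *)
Fixpoint sorted y d x e (p : bipath y d x e) : bool :=
  match p with
  | BOne x e _ => e ==> d
  | BCons x e _ e' _ q => (e ==> e') && sorted q
  end.

Lemma bdim_cat z c x e (p : bipath z c x e) y d (q : bipath y d z c) :
  bdim (bcat p q) = (bdim p + bdim q).+1.
Proof. by elim: p y d q => //= {x e} x e x' e' f p IH y d q; rewrite IH. Qed.

Lemma bdim_pre y d x' e' (q : bipath y d x' e') x e (f : hom x' x) :
  bdim (bpre q e f) = bdim q.
Proof. by case: q x e f. Qed.

Lemma bdim_merge i y d x e (p : bipath y d x e) : i < bdim p ->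
  (bdim (bmerge i p)).+1 = bdim p.
Proof.
elim: p i => //= {x e} x e x' e' f p IH [|i] ip; first by rewrite bdim_pre.
by rewrite /= IH.
Qed.

Lemma bpre_bpre y d x2 e2 (q : bipath y d x2 e2) x1 e1 x e (f : hom x1 x) (g : hom x2 x1) :
  bpre (bpre q e1 g) e f = bpre q e (compm f g).
Proof. by case: q x1 e1 x e f g => [x' e' h|x' e' x'' e'' h r] x1 e1 x e f g /=; rewrite compmA. Qed.

Lemma bpre_merge i y d x' e' (q : bipath y d x' e') x e (f : hom x' x) :
  i < bdim q -> bmerge i (bpre q e f) = bpre (bmerge i q) e f.
Proof.
case: q x e f => //= {x' e'} x' e' x1 e1 h r x e f; case: i => [|i] _ //.
by rewrite bpre_bpre.
Qed.

Lemma bmerge_merge i j y d x e (p : bipath y d x e) : i < j -> j < bdim p ->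
  bmerge j.-1 (bmerge i p) = bmerge i (bmerge j p).
Proof.
elim: p i j => //= {x e} x e x' e' f p IH [|i] [|j] //= ij jp.
  by rewrite bpre_merge.
by rewrite -IH // ; case: j ij jp {IH}.
Qed.

Lemma bpre_cat z c x' e' (p : bipath z c x' e') y d (q : bipath y d z c) x e (f : hom x' x) :
  bpre (bcat p q) e f = bcat (bpre p e f) q.
Proof. by case: p x e f q. Qed.

Lemma bmerge_catl i z c x e (p : bipath z c x e) y d (q : bipath y d z c) :
  i < bdim p -> bmerge i (bcat p q) = bcat (bmerge i p) q.
Proof.
elim: p i y d q => //= {x e} x e x' e' f p IH [|i] y d q ip; first by rewrite /= bpre_cat.
by rewrite /= IH.
Qed.

Lemma bmerge_catr i z c x e (p : bipath z c x e) y d (q : bipath y d z c) :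
  bmerge ((bdim p).+1 + i) (bcat p q) = bcat p (bmerge i q).
Proof. by elim: p y d q => //= {x e} x e x' e' f p IH y d q; rewrite IH. Qed.

Lemma bcatA z c x e (p : bipath z c x e) z' c' (q : bipath z' c' z c) y d (r : bipath y d z' c') :
  bcat (bcat p q) r = bcat p (bcat q r).
Proof. by elim: p z' c' q y d r => //= {x e} x e x' e' f p IH z' c' q y d r; rewrite IH. Qed.

Lemma bcat_split i y d x e (p : bipath y d x e) : i < bdim p ->
  exists z c (p1 : bipath z c x e) (p2 : bipath y d z c), p = bcat p1 p2 /\ bdim p1 = i.
Proof.
elim: p i => //= {x e} x e x' e' f p IH [|i] ip.
  by exists x', e', (BOne e' e f), p.
have [z [c [p1 [p2 [-> <-]]]]] := IH i ip.
by exists z, c, (BCons e f p1), p2.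
Qed.

(** Injectivity in Leibniz form, because the intermediate objects on the two sides are different
    indices. *)
Lemma BCons_inj y d x e x1 e1 (f1 : hom x1 x) (p1 : bipath y d x1 e1)
    x2 e2 (f2 : hom x2 x) (p2 : bipath y d x2 e2)
    (P : forall x2 e2 (f2 : hom x2 x) (p2 : bipath y d x2 e2), Prop) :
  BCons e f1 p1 = BCons e f2 p2 -> P x1 e1 f1 p1 -> P x2 e2 f2 p2.
Proof.
pose tl x0 e0 (p : bipath y d x0 e0) : {x2 : X & {e2 : bool & (hom x2 x0 * bipath y d x2 e2)%type}} + hom y x0 :=
  match p with BOne x e f => inr f | BCons x e x2 e2 f q => inl (existT _ x2 (existT _ e2 (f, q))) end.
move=> /(congr1 (@tl _ _)) /=.
set a := existT _ x1 _; set b := existT _ x2 _.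
move=> /(congr1 (fun s => if s is inl t then t else a)) ab.
pose P' (t : {x2 : X & {e2 : bool & (hom x2 x * bipath y d x2 e2)%type}}) :=
  P (projT1 t) (projT1 (projT2 t)) (projT2 (projT2 t)).1 (projT2 (projT2 t)).2.
have -> : P x1 e1 f1 p1 = P' a by [].
have -> : P x2 e2 f2 p2 = P' b by [].
by rewrite ab.
Qed.

(** Recovers the two factors from the position of a cut, so that an outer face can be computed for a
    sequence that is not presented as a concatenation. *)
Fixpoint bsplit (i : nat) y d x e (p : bipath y d x e) {struct p} :
    option {z : X & {c : bool & (bipath z c x e * bipath y d z c)%type}} :=
  match p with
  | BOne _ _ _ => None
  | BCons x e x' e' f q =>
    if i is j.+1 then
      if bsplit j q is Some t then
        Some (existT _ (projT1 t) (existT _ (projT1 (projT2 t))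
          (BCons e f (projT2 (projT2 t)).1, (projT2 (projT2 t)).2)))
      else None
    else Some (existT _ x' (existT _ e' (BOne e' e f, q)))
  end.

Lemma bsplit_cat z c x e (p : bipath z c x e) y d (q : bipath y d z c) :
  bsplit (bdim p) (bcat p q) = Some (existT _ z (existT _ c (p, q))).
Proof. by elim: p y d q => //= {x e} x e x' e' f p IH y d q; rewrite IH. Qed.

Lemma sorted_pre y d x' e' (q : bipath y d x' e') x e (f : hom x' x) :
  e ==> e' -> sorted q -> sorted (bpre q e f).
Proof.
case: q x e f => [x1 e1 g|x1 e1 x2 e2 g r] x e f /= /implyP h1.
  by move=> /implyP h2; apply/implyP => /h1/h2.
by move=> /andP[/implyP h2 ->]; rewrite andbT; apply/implyP => /h1/h2.
Qed.

Lemma sorted_merge i y d x e (p : bipath y d x e) : sorted p -> sorted (bmerge i p).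
Proof.
elim: p i => //= {x e} x e x' e' f p IH [|i] /andP[ee ps]; first exact: sorted_pre.
by rewrite /= ee IH.
Qed.

Lemma sorted_cat z c x e (p : bipath z c x e) y d (q : bipath y d z c) :
  sorted (bcat p q) = sorted p && sorted q.
Proof. by elim: p y d q => //= {x e} x e x' e' f p IH y d q; rewrite IH andbA. Qed.

(** * The pairing of sequences by insertion *)

Definition isid (x' x : X) (f : hom x' x) : bool :=
  `[< existT (fun z => hom z x) x' f = existT (fun z => hom z x) x (idm x) >].

Lemma isid1 (x : X) : isid (idm x).
Proof. exact/asboolP. Qed.

(** [isid] compares dependent pairs because source and target are different variables; this
    eliminator replaces the source and the morphism at once. *)
Lemma isid_elim (x : X) (P : forall x', hom x' x -> Prop) x' (f : hom x' x) :
  isid f -> P x (idm x) -> P x' f.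
Proof.
move=> /asboolP fE; pose P' (t : {z & hom z x}) := P (projT1 t) (projT2 t).
by rewrite -[P x' f]/(P' (existT (fun z => hom z x) x' f)) fE.
Qed.

Lemma isid_compl (x2 x1 x : X) (f : hom x1 x) (g : hom x2 x1) :
  isid f -> isid (compm f g) = isid g.
Proof.
move=> fid; apply: (isid_elim (P := fun x1 f => forall g : hom x2 x1, isid (compm f g) = isid g) fid).
by move=> {}g; rewrite comp1m.
Qed.

(** Counts the objects over 1 and the morphisms whose component in X is not an identity; an
    insertion adds neither. *)
Fixpoint weight y d x e (p : bipath y d x e) : nat :=
  match p with
  | BOne x e f => e + d + ~~ isid f
  | BCons x e _ _ f q => e + ~~ isid f + weight q
  end.

(* Inserts (x, 0) in front of the first object of the form (x, 1); meant for
   paths which are not sorted, the other ones get a junk value. *)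
Fixpoint hat y d x e (p : bipath y d x e) : bipath y d x false :=
  match p with
  | BOne x e f =>
    if e then BCons false (idm x) (BOne d e f) else BCons false f (BOne d false (idm y))
  | BCons x e x' e' f q =>
    if e then BCons false (idm x) (BCons e f q) else BCons false f (hat q)
  end.

(* The index of the first object over 1. *)
Fixpoint fone y d x e (p : bipath y d x e) : nat :=
  match p with
  | BOne x e f => ~~ e
  | BCons x e _ _ f q => if e then 0 else (fone q).+1
  end.

(* The number of consecutive morphisms with identity component which end at the
   first object over 1. *)
Fixpoint krun y d x e (p : bipath y d x e) : nat :=
  match p with
  | BOne x e f => 0
  | BCons x e _ _ f q => if e then 0 else krun q + ((krun q == fone q) && isid f)
  end.

Lemma krun_le_fone y d x e (p : bipath y d x e) : krun p <= fone p.
Proof. by elim: p => //= {x e} x e x' e' f p IH; case: e => //; case: eqP => //= [->|_]; case: (isid f) => /=; lia. Qed.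

Lemma fone_le_bdim y d x e (p : bipath y d x e) : ~~ sorted p -> fone p <= bdim p.
Proof. by elim: p => {x e} [x [] f|x [] x' e' f p IH]. Qed.

Lemma krun_fone_cons y d x x' e' (f : hom x' x) (q : bipath y d x' e') :
  (krun (BCons false f q) == fone (BCons false f q)) = (krun q == fone q) && isid f.
Proof.
rewrite /=; have := krun_le_fone q; case: (krun q =P fone q) => /= [->|]; first by case: (isid f) => /=; lia.
by move=> *; apply/eqP; lia.
Qed.

Lemma krun1 y d x (p : bipath y d x true) : krun p = 0 /\ fone p = 0.
Proof.
suff H e (p' : bipath y d x e) : e = true -> krun p' = 0 /\ fone p' = 0 by exact: H.
by case: p' => //= {p} x {}e => [f|x' e' f q] ->.
Qed.

Lemma hat1 y d x (p : bipath y d x true) : hat p = BCons false (idm x) p.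
Proof.
suff H e (p' : bipath y d x e) : e = true -> hat p' = BCons false (idm x) p' by exact: H.
by case: p' => //= {p x} x {}e => [f|x' e' f q] ->.
Qed.

Lemma new_cons0 y d x x' e' (f : hom x' x) (q : bipath y d x' e') :
  sorted (BCons false f q) = sorted q.
Proof. by []. Qed.

Lemma sorted_hat y d x e (p : bipath y d x e) : sorted (hat p) = sorted p.
Proof. by elim: p => {x e} [x [] f|x [] x' e' f p IH]. Qed.

Lemma weight_hat y d x e (p : bipath y d x e) : weight (hat p) = weight p.
Proof.
elim: p => {x e} [x [] f|x [] x' e' f p IH] /=; rewrite ?isid1 ?IH //=.
by rewrite !add0n addn0 addnC.
Qed.

Lemma bdim_hat y d x e (p : bipath y d x e) : bdim (hat p) = (bdim p).+1.
Proof. by elim: p => {x e} [x [] f|x [] x' e' f p IH] //=; rewrite IH. Qed.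

Lemma krun_fone_hat y d x e (p : bipath y d x e) : ~~ sorted p ->
  krun (hat p) = (krun p).+1 /\ fone (hat p) = (fone p).+1.
Proof.
elim: p => {x e} [x [] f|x [] x' e' f p IH] //=; rewrite ?isid1 // => /IH[-> ->].
by rewrite eqSS addSn.
Qed.

(** All morphisms before the first object over 1 are identities, so the new identity may as well be
    put at the front. This makes p an outer face of [hat p]. *)
Lemma hat_full y d x e (p : bipath y d x e) : ~~ sorted p -> krun p = fone p ->
  hat p = BCons false (idm x) p.
Proof.
elim: p => {x e} [x [] f|x [] x' e' f p IH] // pn /eqP.
rewrite krun_fone_cons => /andP[/eqP kp fid] /=; rewrite IH //.
exact: (isid_elim (P := fun x1 f => forall p : bipath y d x1 e', _ = BCons false (idm x) (BCons false f p)) fid).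
Qed.

Lemma weight_le y d x e (p : bipath y d x e) : weight p <= (bdim p).*2 + 3.
Proof.
elim: p => /= {x e} [x e f|x e x' e' f p IH]; first by case: e; case: d; case: (isid f).
by case: e; case: (isid f) => /=; lia.
Qed.

Lemma existT_cons y d x x' (f : hom x' x) e e1 e2 (q1 : bipath y d x' e1) (q2 : bipath y d x' e2) :
  existT (bipath y d x') e1 q1 = existT (bipath y d x') e2 q2 ->
  existT (bipath y d x) e (BCons e f q1) = existT (bipath y d x) e (BCons e f q2).
Proof.
exact: (congr1 (fun t : {e' & bipath y d x' e'} => existT (bipath y d x) e (BCons e f (projT2 t)))).
Qed.

(** Merging at i deletes the object number i + 1. If it is one of the objects over 0 in the
    lengthened run, a morphism is composed with an identity and the insertion is undone. There are
    krun p + 1 such i, but only krun p if the run begins at the first object. *)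
Lemma merge_hat i y d x e (p : bipath y d x e) : ~~ sorted p ->
  i < fone p -> fone p <= i.+1 + krun p ->
  existT (bipath y d x) false (bmerge i (hat p)) = existT (bipath y d x) e p.
Proof.
elim: p i => {x e} [x [] f|x [] x' e' f q IH] i // qn ip pi.
rewrite new_cons0 in qn; case: i ip pi => [|i] ip pi /=.
  have qfull : krun q = fone q.
    move: pi; rewrite /= add1n !ltnS; have := krun_le_fone q.
    by case: (krun q =P fone q) => //=; lia.
  by rewrite hat_full //= compm1.
apply: existT_cons; apply: IH => //; move: pi => /=; have := krun_le_fone q.
by case: (krun q =P fone q) => [->|] //=; lia.
Qed.

(** Deleting the first object over 1 lowers the weight. Any other deletion outside the range of
    [merge_hat] keeps the lengthened run or composes two non-identities, which lowers the weight.
    The last equation strengthens the statement for the induction. *)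
Lemma weight_merge_hat i y d x e (p : bipath y d x e) : ~~ sorted p ->
  ~~ ((i < fone p) && (fone p <= i.+1 + krun p)) ->
  ~~ sorted (bmerge i (hat p)) ->
  weight (bmerge i (hat p)) < weight p \/
  krun (bmerge i (hat p)) = (krun p).+1 /\
    (krun (bmerge i (hat p)) == fone (bmerge i (hat p))) = (krun p == fone p).
Proof.
elim: p i => {x e} [x [] f|x e x' e' f q IH] i // pn ndes mn.
  by case: i ndes mn => [|i] _ _ /=; [left; rewrite comp1m; lia|right; rewrite isid1].
case: e pn ndes mn => pn ndes mn.
  case: i ndes mn => [|i] _ _ /=; first by left; rewrite comp1m; lia.
  by right; rewrite isid1; case: i => [|i] //=; case: (krun1 (bpre q true f)) => -> ->.
rewrite new_cons0 in pn; case: i ndes mn => [|i] ndes mn.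
  have nfull : krun q < fone q.
    by move: ndes => /=; lia.
  have kE : krun (BCons false f q) = krun q by rewrite /= ltn_eqF //= addn0.
  rewrite kE; have -> : (krun q == fone (BCons false f q)) = false by apply/eqP => /=; lia.
  clear IH ndes kE mn; destruct q as [x' [] g|x' [] x'' e'' g q] => //=.
  rewrite /= in pn; have [kh fh] := krun_fone_hat pn; have kf := krun_le_fone q.
  rewrite kh fh !eqSS weight_hat; move: nfull => /=.
  have eF : krun q <= fone q -> (krun q + 0 == (fone q).+1) = false by lia.
  have [full|nfull] := eqVneq (krun q) (fone q) => /=.
    have [gid|gid] := boolP (isid g) => /=; first by lia.
    have [fid|fid] := boolP (isid f) => /=; first by rewrite isid_compl // (negbTE gid); right; split; [lia|exact: eF].
    have [fgid|fgid] := boolP (isid (compm f g)) => /=; first by left; lia.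
    by right; split; [lia|exact: eF].
  by right; split; [lia|exact: eF].
have {}ndes : ~~ ((i < fone q) && (i.+1 + krun q >= fone q)).
  move: ndes; rewrite /= !addSn !ltnS; have := krun_le_fone q.
  by case: (krun q =P fone q) => [->|_] //=; case: (isid f) => /=; lia.
rewrite /= in mn; have [lt|[kE kfE]] := IH i pn ndes mn; first by left => /=; rewrite ltn_add2l.
right; rewrite krun_fone_cons.
have -> : bmerge i.+1 (hat (BCons false f q)) = BCons false f (bmerge i (hat q)) by [].
by rewrite krun_fone_cons kfE; split => //=; rewrite kfE kE addSn.
Qed.

Lemma fone0 y d x e (p : bipath y d x e) : fone p = 0 -> e = true.
Proof. by case: p => {x e} x [] //= *. Qed.

(** A non-empty run ends with an identity between (x_a, 0) and (x_a, 1), and this (x_a, 0) counts as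
    inserted. *)
Lemma unhat y d x e (p : bipath y d x e) : ~~ sorted p -> 0 < krun p ->
  exists e' (c : bipath y d x e'), existT (bipath y d x) e p = existT (bipath y d x) false (hat c).
Proof.
elim: p => {x e} [x e f|x [] x' e' f q IH] // qn; rewrite new_cons0 in qn.
have [kq|] := posnP (krun q); last first.
  by move=> /(IH qn)[e1 [c qE]] _; exists false, (BCons false f c); exact: existT_cons.
rewrite /= kq add0n lt0b => /andP[/eqP/esym/fone0 e'1 fid].
rewrite {}e'1 in q kq qn IH *.
apply: (isid_elim (P := fun x1 f => forall q : bipath y d x1 true, exists e' (c : bipath y d x e'),
  existT (bipath y d x) false (BCons false f q) = existT (bipath y d x) false (hat c)) fid).
by move=> q0; exists true, q0; rewrite hat1.
Qed.

(** The merge just before the first object over 1 recovers the sequence from its hat; if the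
    sequence begins over 1, the tail of the hat does. *)
Lemma hat_inj y d x e1 (c1 : bipath y d x e1) e2 (c2 : bipath y d x e2) :
  ~~ sorted c1 -> ~~ sorted c2 -> hat c1 = hat c2 ->
  existT (bipath y d x) e1 c1 = existT (bipath y d x) e2 c2.
Proof.
move=> n1 n2 E; have [k1 f1] := krun_fone_hat n1; have [k2 f2] := krun_fone_hat n2.
have kk : krun c1 = krun c2 by apply: succn_inj; rewrite -k1 -k2 E.
have ff : fone c1 = fone c2 by apply: succn_inj; rewrite -f1 -f2 E.
have [f0|f0] := posnP (fone c1); last first.
  have i1 : (fone c1).-1 < fone c1 by lia.
  have i2 : fone c1 <= (fone c1).-1.+1 + krun c1 by lia.
  rewrite -(merge_hat n1 i1 i2) E; apply: merge_hat => //; first by rewrite -ff.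
  by rewrite -ff -kk.
have e1E := fone0 f0; have e2E : e2 = true by apply: (@fone0 _ _ _ _ c2); rewrite -ff.
rewrite {}e1E {}e2E in c1 c2 E n1 n2 k1 f1 k2 f2 kk ff f0 *; congr existT.
rewrite !hat1 in E.
pose P x2 e2 (f2 : hom x2 x) (p2 : bipath y d x2 e2) :=
  existT (fun x => {e & bipath y d x e}) x (existT (bipath y d x) true c1) =
  existT (fun x => {e & bipath y d x e}) x2 (existT (bipath y d x2) e2 p2).
exact: (existT_inj (existT_inj (BCons_inj (P := P) E erefl))).
Qed.

(* A lexicographic order: paths paired by [hat] are compared by the length of the
   smaller one and then by [weight], and the squares leave room for the bound of
   [weight_le]. *)
Definition rank y d x e (p : bipath y d x e) : nat :=
  (bdim p + ~~ odd (krun p) + 2) ^ 2 + weight p.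

Lemma rank_bdim_lt y d x e (p : bipath y d x e) y' d' x' e' (q : bipath y' d' x' e') :
  ~~ odd (krun p) -> bdim q < bdim p -> rank q < rank p.
Proof.
rewrite /rank => ->; have := weight_le q; case: odd => /=; nia.
Qed.

Lemma rank_odd_lt y d x e (p : bipath y d x e) y' d' x' e' (q : bipath y' d' x' e') :
  ~~ odd (krun p) -> odd (krun q) -> bdim q = bdim p -> rank q < rank p.
Proof. move=> kp kq E; have := weight_le q; rewrite /rank kp kq E /=; nia. Qed.

Lemma rank_weight_lt y d x e (p : bipath y d x e) y' d' x' e' (q : bipath y' d' x' e') :
  ~~ odd (krun p) -> bdim q = bdim p -> weight q < weight p -> rank q < rank p.
Proof. rewrite /rank => -> ->; case: odd => /=; nia. Qed.

Lemma rank_hat y d x e (p : bipath y d x e) : ~~ sorted p -> ~~ odd (krun p) ->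
  rank (hat p) = rank p.
Proof.
move=> pn pe; rewrite /rank weight_hat bdim_hat (krun_fone_hat pn).1 /= pe /=.
by rewrite addn0 addn1.
Qed.

(** * The order of construction, in which faces come earlier *)

Lemma krun_cat z c x e (p : bipath z c x e) y d (q : bipath y d z c) :
  ~~ sorted p -> krun (bcat p q) = krun p /\ fone (bcat p q) = fone p.
Proof.
elim: p y d q => {x e} [x [] f|x [] x' e' f p IH] y d q //= pn.
by have [-> ->] := IH y d q pn.
Qed.

Lemma krun_unhat y d x e (p : bipath y d x e) : ~~ sorted p -> odd (krun p) ->
  exists e' (c : bipath y d x e'), [/\ ~~ sorted c, ~~ odd (krun c) &
    existT (bipath y d x) e p = existT (bipath y d x) false (hat c)].
Proof.
move=> pn pk; have [e' [c pE]] := unhat pn (odd_gt0 pk); exists e', c.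
move: pn pk; pose P (t : {e & bipath y d x e}) := ~~ sorted (projT2 t) -> odd (krun (projT2 t)) ->
  [/\ ~~ sorted c, ~~ odd (krun c) & t = existT (bipath y d x) false (hat c)].
rewrite -/(P (existT (bipath y d x) e p)) pE /P /= sorted_hat => cn.
by have [-> _] := krun_fone_hat cn => /=; split.
Qed.

(** The sequences whose values are settled before stage r: those prescribed by G and those of
    smaller rank. *)
Definition lower r y d x e (p : bipath y d x e) := sorted p || (rank p < r).

(** Such a face has the length of p and either a smaller weight or an odd run; in the latter case it
    is the larger member of a pair whose smaller member is shorter than p. *)
Lemma lower_merge_hat i y d x e (p : bipath y d x e) : ~~ sorted p -> ~~ odd (krun p) ->
  i < bdim (hat p) -> ~~ ((i < fone p) && (fone p <= i.+1 + krun p)) ->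
  lower (rank p) (bmerge i (hat p)).
Proof.
move=> pn pk ip nd; rewrite /lower; apply/orP; case sm: (sorted _); [by left|right].
have dm : bdim (bmerge i (hat p)) = bdim p.
  by apply: succn_inj; rewrite bdim_merge // bdim_hat.
have [lt|[kE _]] := weight_merge_hat pn nd (negbT sm); first exact: rank_weight_lt.
by apply: rank_odd_lt => //; rewrite kE.
Qed.

(** An unsorted factor as long as p contains the whole lengthened run, which is odd, so its partner
    is shorter. The excluded case is the one in which the second factor is p itself. *)
Lemma lower_split_hat z c y d x e (p : bipath y d x e) (p1 : bipath z c x false) (p2 : bipath y d z c) :
  ~~ sorted p -> ~~ odd (krun p) -> hat p = bcat p1 p2 -> (bdim p1 != 0) || (krun p != fone p) ->
  lower (rank p) p1 && lower (rank p) p2.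
Proof.
move=> pn pk E nd.
have dE : bdim p1 + bdim p2 = bdim p.
  by apply: succn_inj; rewrite -bdim_cat -E bdim_hat.
apply/andP; split; apply/orP.
  have [|pn1] := boolP (sorted p1); [by left|right].
  have [p1lt|] := ltnP (bdim p1) (bdim p); first exact: rank_bdim_lt.
  move=> p1ge; apply: rank_odd_lt => //; last by lia.
  by have [<- _] := krun_cat p2 pn1; rewrite -E (krun_fone_hat pn).1.
have [|pn2] := boolP (sorted p2); [by left|right].
have [p2lt|p2ge] := ltnP (bdim p2) (bdim p); first exact: rank_bdim_lt.
have p10 : bdim p1 = 0 by lia.
rewrite p10 /= in nd.
suff : odd (krun p2) by move=> ?; apply: rank_odd_lt => //; lia.
clear p2ge dE pn2; destruct p as [x [] f|x [] x' e' f q]; rewrite ?eqxx //= in nd pn.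
move: pk; have /negbTE := nd; rewrite -/(fone (BCons false f q)) -/(krun (BCons false f q)) krun_fone_cons /= => -> .
rewrite addn0 => qk; move: p10 E; clear nd.
suff H e0 (p1' : bipath z c x e0) : bdim p1' = 0 -> BCons e0 f (hat q) = bcat p1' p2 -> odd (krun p2).
  exact: H.
case: p1' f => {x p1} // x {}e0 g f _ /= E.
apply: (BCons_inj (P := fun _ _ _ p => odd (krun p)) E).
by rewrite (krun_fone_hat pn).1.
Qed.

(** A sequence with odd run is [hat c] for some c of the same rank, and each of its faces is either
    c or of smaller rank. *)
Lemma lower_merge r i y d x e (p : bipath y d x e) :
  lower r p -> i < bdim p -> lower r (bmerge i p).
Proof.
case/orP => [sp _|lt ip]; first by rewrite /lower sorted_merge.
have [sp|pn] := boolP (sorted p); first by rewrite /lower sorted_merge.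
suff : lower (rank p).+1 (bmerge i p).
  by move=> /orP[sm|mlt]; rewrite /lower ?sm //; apply/orP; right; lia.
have [pk|pk] := boolP (odd (krun p)); last first.
  apply/orP; right; apply: leq_trans (leqnSn _); apply: rank_bdim_lt => //.
  by rewrite -(bdim_merge ip).
have [e' [c [cn ck pE]]] := krun_unhat pn pk; move: ip.
pose P (t : {e & bipath y d x e}) := i < bdim (projT2 t) -> lower (rank (projT2 t)).+1 (bmerge i (projT2 t)).
rewrite -/(P (existT (bipath y d x) e p)) pE /P /= rank_hat // => ip.
have [/andP[i1 i2]|nd] := boolP ((i < fone c) && (fone c <= i.+1 + krun c)).
  pose P' (t : {e & bipath y d x e}) := lower (rank c).+1 (projT2 t).
  rewrite -/(P' (existT (bipath y d x) false (bmerge i (hat c)))) merge_hat // /P' /=.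
  by rewrite /lower ltnS leqnn orbT.
have /orP[sm|mlt] := lower_merge_hat cn ck ip nd; rewrite /lower ?sm //.
by apply/orP; right; lia.
Qed.

Lemma lower_split r z c y d x e (p1 : bipath z c x e) (p2 : bipath y d z c) :
  lower r (bcat p1 p2) -> lower r p1 && lower r p2.
Proof.
have [sp|pn] := boolP (sorted (bcat p1 p2)).
  by move: sp; rewrite sorted_cat /lower => /andP[-> ->].
rewrite {1}/lower (negbTE pn) /= => lt.
suff /andP[l1 l2] : lower (rank (bcat p1 p2)).+1 p1 && lower (rank (bcat p1 p2)).+1 p2.
  by move: l1 l2; rewrite /lower; case: sorted; case: sorted => //=; lia.
have [pk|pk] := boolP (odd (krun (bcat p1 p2))); last first.
  have dE := bdim_cat p1 p2; rewrite /lower.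
  rewrite (ltn_trans (rank_bdim_lt pk _) (ltnSn _)) ?orbT; last by lia.
  by rewrite (ltn_trans (rank_bdim_lt pk _) (ltnSn _)) ?orbT; last by lia.
have [e' [c' [cn ck pE]]] := krun_unhat pn pk.
have eF : e = false := congr1 (@projT1 _ _) pE.
subst e; have {}pE := existT_inj pE; rewrite pE rank_hat //.
have [nd|] := boolP ((bdim p1 != 0) || (krun c' != fone c')).
  have /andP[] := lower_split_hat cn ck (esym pE) nd.
  by rewrite /lower; case: sorted; case: sorted => //=; lia.
rewrite negb_or !negbK => /andP[/eqP p10 /eqP cfull].
move: pE p10; rewrite hat_full //.
suff H e0 (p1' : bipath z c x e0) : e0 = false -> bcat p1' p2 = BCons e0 (idm x) c' -> bdim p1' = 0 ->
    lower (rank c').+1 p1' && lower (rank c').+1 p2 by exact: H.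
case: p1' c' {p1 pn lt pk cn ck cfull} => //= {}x {}e0 f c' -> /esym E _.
rewrite {1}/lower /=.
apply: (BCons_inj (P := fun _ _ _ p => lower (rank c').+1 p) E).
by rewrite /lower ltnS leqnn orbT.
Qed.

End bipaths.

(** * Extending families over cubes *)

Section extension.
Local Open Scope nat_scope.
Context (R : realType) (X : category) (C : contCategory) (obj : X -> bool -> C).
Local Notation I := (unitI R).
Local Notation I0 := (@I0 R).
Local Notation I1 := (@I1 R).
Local Notation Q := (prod_topology (fun _ : nat => I)).
Local Notation endp := (endp R).
Local Notation H x e y d := (chom (obj x e) (obj y d)).

Definition bifamily := forall y d x e, @bipath X y d x e -> Q -> H x e y d.

Definition bapp (F : bifamily) y d x e (p : bipath y d x e) : Q -> H x e y d :=
  F y d x e p.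

(* The first k coordinates are the parameters of the family; the following ones
   are the parameters of the path. *)
Variable k : nat.

(** The parameters that belong to the second factor once j path parameters are cut off. *)
Definition shift (j : nat) (s : Q) : Q := fun n => if n < k then s n else s (n + j).

Variable B : bifamily.

(* The value which the face equations prescribe for F at p on the face (j, c). *)
Definition faceval (F : bifamily) y d x e (p : bipath y d x e) (j : nat) (c : bool) (s : Q) :
    H x e y d :=
  if j < k then bapp B p s
  else if c then
    if bsplit (j - k) p is Some t then
      ccomp (bapp F (projT2 (projT2 t)).2 (shift (j - k).+1 s))
            (bapp F (projT2 (projT2 t)).1 s)
    else bapp B p s
  else bapp F (bmerge (j - k) p) (del j s).

Definition face_eq (F : bifamily) y d x e (p : bipath y d x e) : Prop :=
  forall j c s, j < k + bdim p -> s j = endp c -> bapp F p s = faceval F p j c s.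

Lemma faceval_lt F y d x e (p : bipath y d x e) j c s :
  j < k -> faceval F p j c s = bapp B p s.
Proof. by rewrite /faceval => ->. Qed.

Lemma faceval0 F y d x e (p : bipath y d x e) i s :
  faceval F p (k + i) false s = bapp F (bmerge i p) (del (k + i) s).
Proof. by rewrite /faceval ltnNge leq_addr addKn. Qed.

Lemma faceval1 F z c x e (p : bipath z c x e) y d (q : bipath y d z c) s :
  faceval F (bcat p q) (k + bdim p) true s =
  ccomp (bapp F q (shift (bdim p).+1 s)) (bapp F p s).
Proof. by rewrite /faceval ltnNge leq_addr addKn bsplit_cat. Qed.

Definition facewise (P : forall y d x e, @bipath X y d x e -> Prop) y d x e (p : bipath y d x e) :=
  (forall i, i < bdim p -> P _ _ _ _ (bmerge i p)) /\
  (forall z c (p1 : bipath z c x e) (p2 : bipath y d z c), p = bcat p1 p2 ->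
    P _ _ _ _ p1 /\ P _ _ _ _ p2).

Definition depends (F : bifamily) y d x e (p : bipath y d x e) := dep (k + bdim p) (bapp F p).

Lemma del_del i j (s : Q) : i < j -> del j.-1 (del i s) = del i (del j s).
Proof.
move=> ij; apply/funext => n; rewrite /del /bump; congr (s _).
by case: (leqP i n); case: (leqP j.-1 n); case: (leqP j n) => /=; lia.
Qed.

Lemma del_lt i (s : Q) n : n < i -> del i s n = s n.
Proof. by move=> ni; rewrite /del /bump leqNgt ni. Qed.

Lemma del_ge i (s : Q) n : i <= n -> del i s n = s n.+1.
Proof. by move=> ni; rewrite /del /bump ni. Qed.

Lemma shift_lt j (s : Q) n : n < k -> shift j s n = s n.
Proof. by rewrite /shift => ->. Qed.

Lemma shift_ge j (s : Q) i : shift j s (k + i) = s (k + (j + i)).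
Proof. by rewrite /shift ltnNge leq_addr /=; congr (s _); lia. Qed.

Lemma kP (P : nat -> Prop) : (forall n, n < k -> P n) -> (forall i, P (k + i)) -> forall n, P n.
Proof.
by move=> P1 P2 n; have [/P1//|kn] := ltnP n k; rewrite -(subnKC kn); exact: P2.
Qed.

Lemma shift_shift i j (s : Q) : shift i (shift j s) = shift (j + i) s.
Proof.
apply/funext; apply: kP => [n nk|n]; first by rewrite !shift_lt.
by rewrite !shift_ge; congr (s _); lia.
Qed.

Lemma shift_del i j (s : Q) : i < j -> shift j (del (k + i) s) = shift j.+1 s.
Proof.
move=> ij; apply/funext; apply: kP => [n nk|n].
  by rewrite !shift_lt // del_lt //; lia.
by rewrite !shift_ge del_ge; [congr (s _)|]; lia.
Qed.

Lemma del_shift i j (s : Q) : del (k + i) (shift j s) = shift j (del (k + (j + i)) s).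
Proof.
apply/funext; apply: kP => [n nk|n].
  by rewrite shift_lt // !del_lt ?shift_lt //; lia.
rewrite shift_ge; have [ni|ni] := ltnP n i; first by rewrite !del_lt ?shift_ge //; lia.
by rewrite !del_ge; [rewrite -addnS shift_ge; congr (s _)| |]; lia.
Qed.

Lemma onface_del j (s : Q) : k <= j -> onface k s -> onface k (del j s).
Proof. by move=> kj; apply: onface_dep => n nk; rewrite del_lt //; lia. Qed.

Lemma onface_shift j (s : Q) : onface k s -> onface k (shift j s).
Proof. by apply: onface_dep => n nk; rewrite shift_lt. Qed.

Hypothesis Bface : forall y d x e (p : bipath y d x e) (s : Q) j c, onface k s ->
  j < k + bdim p -> s j = endp c -> bapp B p s = faceval B p j c s.

Lemma face_eq_boundary F y d x e (p : bipath y d x e) (s : Q) :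
  face_eq F p -> onface k s -> bapp F p s = bapp B p s.
Proof.
move=> Fp [j [c [jk sj]]]; rewrite (Fp j c) ?faceval_lt //.
exact: leq_trans (leq_addr _ _).
Qed.

(** The cubical identities: as every face satisfies its own face equations, both sides reduce to the
    same face of codimension two, for two outer faces by associativity of composition. Over the
    boundary of the parameter cube both sides reduce to values of B. *)
Lemma faceval_consistent F y d x e (p : bipath y d x e) :
  facewise (face_eq F) p -> facewise (depends F) p ->
  forall i c j c' s, i < j < k + bdim p -> s i = endp c -> s j = endp c' ->
  faceval F p i c s = faceval F p j c' s.
Proof.
move=> [Fm Fs] [Dm Ds] i c j c' s /andP[ij jp] si sj.
have [ik|ki] := ltnP i k.
  have sk : onface k s by exists i, c.
  rewrite faceval_lt //; have [jk|kj] := ltnP j k; first by rewrite faceval_lt.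
  rewrite (Bface sk jp sj); move: jp sj; rewrite -(subnKC kj) ltn_add2l => jp sj.
  case: c' sj => sj; last first.
    rewrite !faceval0 (face_eq_boundary (Fm _ jp)) //; apply: onface_del sk; lia.
  have [z [c0 [p1 [p2 [pE p1j]]]]] := bcat_split jp.
  have [F1 F2] := Fs _ _ _ _ pE.
  rewrite -p1j pE !faceval1 (face_eq_boundary F1) // (face_eq_boundary F2) //.
  exact: onface_shift.
have kj : k <= j by lia.
move: ij jp si sj; rewrite -(subnKC ki) -(subnKC kj) !ltn_add2l.
move: (i - k) (j - k) => {ki kj} {}i {}j ij jp si sj.
have ip : i < bdim p by lia.
have mdim n : n < bdim p -> bdim (bmerge n p) = (bdim p).-1 by move=> /bdim_merge <-.
case: c si => si; last case: c' sj => sj.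
- have [z [c0 [p1 [p2 [pE p1i]]]]] := bcat_split ip.
  have [F1 F2] := Fs _ _ _ _ pE; have [D1 D2] := Ds _ _ _ _ pE.
  have jE : j = (bdim p1).+1 + (j - i.+1) by lia.
  have jp2 : j - i.+1 < bdim p2 by move: jp; rewrite pE bdim_cat; lia.
  have s2 (c0' : bool) : s (k + j) = endp c0' -> shift (bdim p1).+1 s (k + (j - i.+1)) = endp c0'.
    by move=> <-; rewrite shift_ge; congr (s _); lia.
  rewrite -{1}p1i pE faceval1; case: c' sj => sj; last first.
    have mE : bmerge j (bcat p1 p2) = bcat p1 (bmerge (j - i.+1) p2).
      by rewrite {1}jE bmerge_catr.
    rewrite faceval0 (F2 (k + (j - i.+1)) false); last 2 first.
    + by rewrite ltn_add2l.
    + exact: s2.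
    rewrite faceval0; move: (Fm j jp); rewrite pE mE.
    move=> /(_ (k + bdim p1) true (del (k + j) s)) ->; last 2 first.
    + by rewrite ltn_add2l bdim_cat; lia.
    + by rewrite del_lt ?p1i //; lia.
    rewrite faceval1 del_shift; congr (ccomp (bapp F _ (shift _ (del _ s))) _); first by lia.
    by apply: D1 => n n1; rewrite del_lt //; lia.
  have [z' [c1 [r [q [p2E rj]]]]] := bcat_split jp2.
  rewrite (F2 (k + (j - i.+1)) true); last 2 first.
  + by rewrite ltn_add2l.
  + exact: s2.
  rewrite -rj {1}p2E faceval1.
  have pE' : p = bcat (bcat p1 r) q by rewrite bcatA -p2E.
  have jE' : j = bdim (bcat p1 r) by rewrite bdim_cat; lia.
  rewrite p2E -bcatA jE' faceval1 shift_shift -jE'.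
  have [F3 _] := Fs _ _ _ _ pE'.
  rewrite (F3 (k + bdim p1) true); last 2 first.
  + by rewrite bdim_cat; lia.
  + by rewrite p1i.
  rewrite faceval1 ccompA; congr (ccomp (ccomp (bapp F _ (shift _ s)) _) _); lia.
- have [z [c0 [p1 [p2 [pE p1j]]]]] := bcat_split jp.
  have [F1 F2] := Fs _ _ _ _ pE.
  have i1 : i < bdim p1 by lia.
  rewrite faceval0 -p1j {2}pE faceval1 (F1 (k + i) false) ?ltn_add2l // faceval0.
  move: (Fm i ip); rewrite pE bmerge_catl // => /(_ (k + bdim (bmerge i p1)) true) ->.
  + rewrite faceval1; congr (ccomp (bapp F _ _) _).
    by rewrite bdim_merge // shift_del.
  + by rewrite ltn_add2l bdim_cat; lia.
  + have := bdim_merge i1 => p1E; rewrite del_ge; last by lia.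
    by rewrite -sj; congr (s _); lia.
- rewrite !faceval0.
  rewrite (Fm i ip (k + j.-1) false) ?ltn_add2l ?mdim //; last 2 first.
  + by lia.
  + by rewrite del_ge; [rewrite -sj; congr (s _)|]; lia.
  rewrite (Fm j jp (k + i) false) ?ltn_add2l ?mdim //; last 2 first.
  + by lia.
  + by rewrite del_lt //; lia.
  rewrite !faceval0 bmerge_merge //; congr (bapp F _ _).
  have -> : k + j.-1 = (k + j).-1 by lia.
  by rewrite del_del //; lia.
Qed.

Definition good (F : bifamily) y d x e (p : bipath y d x e) : Prop :=
  [/\ face_eq F p, depends F p & continuous (bapp F p)].

Lemma facewise_impl (P P' : forall y d x e, @bipath X y d x e -> Prop) y d x e (p : bipath y d x e) :
  (forall y d x e (q : bipath y d x e), P _ _ _ _ q -> P' _ _ _ _ q) ->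
  facewise P p -> facewise P' p.
Proof.
move=> PP' [h1 h2]; split=> [i ip|z c p1 p2 pE]; first exact/PP'/h1.
by have [? ?] := h2 _ _ _ _ pE; split; exact: PP'.
Qed.

Lemma faceval_ext F F' y d x e (p : bipath y d x e) j c s :
  j < k + bdim p ->
  facewise (fun _ _ _ _ q => bapp F q = bapp F' q) p -> faceval F p j c s = faceval F' p j c s.
Proof.
move=> jp [Em Es]; have [jk|kj] := ltnP j k; first by rewrite !faceval_lt.
move: jp; rewrite -(subnKC kj) ltn_add2l => jp; case: c; last by rewrite !faceval0 Em.
have [z [c0 [p1 [p2 [pE p1j]]]]] := bcat_split jp.
by have [E1 E2] := Es _ _ _ _ pE; rewrite -p1j pE !faceval1 E1 E2.
Qed.

Hypothesis Bdep : forall y d x e (p : bipath y d x e), depends B p.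
Hypothesis Bcont : forall y d x e (p : bipath y d x e), facewise_continuous k (bapp B p).

Lemma shift_continuous j : continuous (shift j).
Proof.
by apply: prod_continuous => n; rewrite /shift; case: (n < k); exact: component_continuous.
Qed.

Lemma faceval_dep F y d x e (p : bipath y d x e) j c :
  j < k + bdim p -> facewise (depends F) p -> dep (k + bdim p) (faceval F p j c).
Proof.
move=> jp [Dm Ds] s s' ss; have [jk|kj] := ltnP j k.
  by rewrite !faceval_lt //; exact: Bdep.
move: jp; rewrite -(subnKC kj) ltn_add2l => jp; case: c.
  have [z [c0 [p1 [p2 [pE p1j]]]]] := bcat_split jp.
  have [D1 D2] := Ds _ _ _ _ pE; rewrite pE bdim_cat in ss.
  rewrite -p1j pE !faceval1; congr ccomp.
    apply: D2; apply: kP => [n nk _|n]; first by rewrite !shift_lt ?ss //; lia.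
    by rewrite ltn_add2l !shift_ge => n2; apply: ss; lia.
  by apply: D1 => n n1; apply: ss; lia.
rewrite !faceval0; apply: (Dm _ jp) => n np; rewrite /del /bump.
have pE := bdim_merge jp.
by apply: ss; case: leqP => /=; lia.
Qed.

Lemma faceval_continuous F y d x e (p : bipath y d x e) j c :
  j < k + bdim p -> facewise (fun _ _ _ _ q => continuous (bapp F q)) p ->
  continuous (fun s => faceval F p j c (upd j (endp c) s)).
Proof.
move=> jp [Cm Cs]; have [jk|kj] := ltnP j k.
  have -> : (fun s => faceval F p j c (upd j (endp c) s)) = (fun s => bapp B p (upd j (endp c) s)).
    by apply/funext => s; rewrite faceval_lt.
  exact: Bcont.
move: jp; rewrite -(subnKC kj) ltn_add2l; move: (j - k) => {kj} {}j jp.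
apply: (@continuous_updc R _ (faceval F p (k + j) c)); case: c.
  have [z [c0 [p1 [p2 [pE p1j]]]]] := bcat_split jp.
  have [C1 C2] := Cs _ _ _ _ pE.
  have -> : faceval F p (k + j) true =
      (fun s => ccomp (bapp F p2 (shift (bdim p1).+1 s)) (bapp F p1 s)).
    by apply/funext => s; rewrite -p1j pE faceval1.
  apply: (@comp_continuous _ _ _ (fun s => (bapp F p2 (shift (bdim p1).+1 s), bapp F p1 s))
    (fun u => ccomp u.1 u.2)); last exact: ccomp_continuous.
  by apply: pair_continuous C1; apply: comp_continuous C2; exact: shift_continuous.
have -> : faceval F p (k + j) false = (fun s => bapp F (bmerge j p) (del (k + j) s)).
  by apply/funext => s; rewrite faceval0.
apply: comp_continuous (Cm j jp); exact: del_continuous.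
Qed.

Hypothesis Hinh : forall y d x e, @bipath X y d x e -> inhabited (H x e y d).

Lemma boundary_value F y d x e (p : bipath y d x e) : facewise (good F) p ->
  exists b : Q -> H x e y d, [/\ dep (k + bdim p) b, facewise_continuous (k + bdim p) b &
    forall j c s, j < k + bdim p -> s j = endp c -> b s = faceval F p j c s].
Proof.
move=> gp; have Fp : facewise (face_eq F) p by apply: facewise_impl gp => ? ? ? ? ? [].
have Dp : facewise (depends F) p by apply: facewise_impl gp => ? ? ? ? ? [].
have Cp : facewise (fun _ _ _ _ q => continuous (bapp F q)) p.
  by apply: facewise_impl gp => ? ? ? ? ? [].
have cons i c j c' s : i < k + bdim p -> j < k + bdim p -> s i = endp c -> s j = endp c' ->
    faceval F p i c s = faceval F p j c' s.
  move=> ip jp si sj; have [ij|ji|ij] := ltngtP i j.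
  - by apply: (faceval_consistent Fp Dp) => //; rewrite ij.
  - by apply: esym; apply: (faceval_consistent Fp Dp) => //; rewrite ji.
  - by congr (faceval _ _ _ _ _) => //; apply: (@endp_inj R); rewrite -si -sj ij.
have [h0] := Hinh p.
(* A boundary point takes the value of some face through it; interior points get the default
   [h0]. *)
pose b s := if pselect (onface (k + bdim p) s) is left h then
  let j := sval (cid h) in faceval F p j (sval (cid (svalP (cid h)))) s else h0.
have bE j c s : j < k + bdim p -> s j = endp c -> b s = faceval F p j c s.
  move=> jp sj; rewrite /b; case: pselect => [h|[]]; last by exists j, c.
  move: (svalP (cid h)) => h'; case: (svalP (cid h')) => ? ?.
  exact: cons.
exists b; split => //.
- move=> s s' ss; have [[j [c [jp sj]]]|ns] := pselect (onface (k + bdim p) s).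
    rewrite (bE j c s) // (bE j c s') -?ss //; exact: faceval_dep.
  rewrite /b; case: pselect => // _; case: pselect => // h.
  by case: ns; apply: onface_dep h => j jp; rewrite ss.
- move=> j c jp; have -> : (fun s => b (upd j (endp c) s)) = (fun s => faceval F p j c (upd j (endp c) s)).
    by apply/funext => s; apply: bE; rewrite ?updE.
  exact: faceval_continuous.
Qed.

Record bicell := BiCell {
  cy : X; cd : bool; cx : X; ce : bool; cpath : bipath cy cd cx ce }.

Lemma bicell_inj y d x e (p q : bipath y d x e) : BiCell p = BiCell q -> p = q.
Proof.
pose f (c : bicell) := existT (fun y => {d & {x & {e & bipath y d x e}}}) (cy c)
  (existT (fun d => {x & {e & bipath (cy c) d x e}}) (cd c)
  (existT (fun x => {e & bipath (cy c) (cd c) x e}) (cx c)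
  (existT (fun e => bipath (cy c) (cd c) (cx c) e) (ce c) (cpath c)))).
move=> /(congr1 f); rewrite /f /= => E.
exact: (existT_inj (existT_inj (existT_inj (existT_inj E)))).
Qed.

(** Injectivity makes the new values unambiguous; the transport along an equality of cells
    disappears by proof irrelevance. *)
Lemma override (J : Type) (a : J -> bicell) (F : bifamily)
    (v : forall j, Q -> H (cx (a j)) (ce (a j)) (cy (a j)) (cd (a j))) : injective a ->
  exists F' : bifamily, (forall j, bapp F' (cpath (a j)) = v j) /\
    forall y d x e (p : bipath y d x e), (forall j, a j <> BiCell p) -> bapp F' p = bapp F p.
Proof.
move=> aI; pose V c := Q -> H (cx c) (ce c) (cy c) (cd c).
pose G (c : bicell) : V c := match pselect (exists j, a j = c) with
  | left h => eq_rect _ V (v (sval (cid h))) c (svalP (cid h))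
  | right _ => bapp F (cpath c) end.
exists (fun y d x e p => G (BiCell p)); split=> [j|y d x e p np].
  have -> : bapp (fun y d x e p => G (BiCell p)) (cpath (a j)) = G (a j).
    by rewrite /bapp; case: (a j).
  rewrite /G; case: pselect => [h|[]]; last by exists j.
  move: (svalP (cid h)); move: (sval (cid h)) => j' E; have jj := aI _ _ E.
  by case: _ / jj E => E; rewrite (Prop_irrelevance E erefl).
by rewrite /bapp /G; case: pselect => // -[j E]; case: (np j E).
Qed.

(** The comparison morphism, an identity for e = 0 and later the component of G for e = 1.
    Precomposition with it relates the values at p to those at [hat p]. *)
Variable wt : forall x e, H x false x e.
Arguments wt : clear implicits.
Hypothesis wt0 : forall x, wt x false = cidm (obj x false).
Hypothesis wtB : forall x e s, bapp B (BOne e false (idm x)) s = wt x e.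
Hypothesis wtW : forall x e y d, weak_equiv R (fun g : H x e y d => ccomp g (wt x e)).

Lemma shift1 s : shift 1 s = del k s.
Proof.
by apply/funext => n; rewrite /shift /del /bump; case: (ltnP n k) => //= nk; rewrite addn1.
Qed.

(** The range of i is empty if p begins over 1, so [wt x e] is an identity here; it is written to
    give the same formula as on the outer face. *)
Lemma faceval_merge_hat F y d x e (p : bipath y d x e) i s : ~~ sorted p ->
  i < fone p -> fone p <= i.+1 + krun p ->
  faceval F (hat p) (k + i) false s = ccomp (bapp F p (del (k + i) s)) (wt x e).
Proof.
move=> pn i1 i2; have mE := merge_hat pn i1 i2; rewrite faceval0.
have eF : e = false by case/esym: (congr1 (@projT1 _ _) mE).
subst e; by rewrite (existT_inj mE) wt0 ccompm1.
Qed.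

(** The outer face cuts off the initial identity of [hat p], at which the family takes the value
    [wt x e]. *)
Lemma faceval_split_hat F y d x e (p : bipath y d x e) s : ~~ sorted p ->
  (forall y d x e (q : bipath y d x e), sorted q -> bapp F q = bapp B q) ->
  krun p = fone p ->
  faceval F (hat p) k true s = ccomp (bapp F p (del k s)) (wt x e).
Proof.
move=> pn FB full; rewrite hat_full //.
have -> : BCons false (idm x) p = bcat (BOne e false (idm x)) p by [].
rewrite -[X in faceval _ _ X](addn0 k) -[X in k + X]/(bdim (BOne e false (idm x))).
by rewrite faceval1 shift1 (FB _ _ _ _ (BOne e false (idm x))) // wtB.
Qed.

Lemma facewise_hat (P : forall y d x e, @bipath X y d x e -> Prop) y d x e (p : bipath y d x e) :
  ~~ sorted p -> ~~ odd (krun p) ->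
  (forall y d x e (q : bipath y d x e), lower (rank p) q -> P y d x e q) -> P y d x e p ->
  facewise P (hat p).
Proof.
move=> pn pk Pl Pp; split=> [i ip|z c p1 p2 pE].
  have [/andP[i1 i2]|nd] := boolP ((i < fone p) && (fone p <= i.+1 + krun p)); last first.
    by apply: Pl; exact: lower_merge_hat.
  pose P' (t : {e & bipath y d x e}) := P _ _ _ _ (projT2 t).
  by rewrite -[P _ _ _ _ _]/(P' (existT _ false (bmerge i (hat p)))) merge_hat.
have [nd|] := boolP ((bdim p1 != 0) || (krun p != fone p)).
  by have /andP[? ?] := lower_split_hat pn pk pE nd; split; exact: Pl.
rewrite negb_or !negbK => /andP[/eqP p10 /eqP full].
move: p10 pE; rewrite hat_full //.
suff W e0 (p1' : bipath z c x e0) : e0 = false -> bdim p1' = 0 ->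
    BCons e0 (idm x) p = bcat p1' p2 -> P _ _ _ _ p1' /\ P _ _ _ _ p2 by exact: W.
case: p1' p pn pk Pl Pp full => //= {p1} {}x {}e0 f p pn pk Pl Pp full e00 _ E.
split; first by apply: Pl; rewrite /lower /= e00.
exact: (BCons_inj (P := fun _ _ _ q => P _ _ _ _ q) E).
Qed.

Lemma facewise_lower y d x e (p : bipath y d x e) : ~~ odd (krun p) ->
  facewise (fun _ _ _ _ q => lower (rank p) q) p.
Proof.
move=> pk; split=> [i ip|z c p1 p2 pE].
  by apply/orP; right; apply: rank_bdim_lt => //; rewrite -(bdim_merge ip).
by split; apply/orP; right; apply: rank_bdim_lt => //; rewrite pE bdim_cat; lia.
Qed.

(** Being good involves only the values at q and at its faces, and all of these are [lower]. *)
Lemma good_ext F F' r y d x e (q : bipath y d x e) :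
  (forall y d x e (q : bipath y d x e), lower r q -> bapp F' q = bapp F q) ->
  lower r q -> good F q -> good F' q.
Proof.
move=> FF' lq [Fq Dq Cq]; split; rewrite /depends ?FF' //.
move=> j c s jq sj; rewrite FF' // (Fq j c) //; apply: faceval_ext => //.
split=> [i iq|z c' p1 p2 qE]; first by rewrite FF' // lower_merge.
by move: lq; rewrite qE => /lower_split/andP[l1 l2]; rewrite !FF'.
Qed.

(** * Filling a sequence together with its partner *)

Section pair.
Variables (y : X) (d : bool) (x : X) (e : bool) (p : bipath y d x e).
Hypotheses (pn : ~~ sorted p) (pk : ~~ odd (krun p)).

(** The faces of [hat p] that carry p. If not [full], they are the krun p + 1 merges from [base] on,
    and the last one is single. If [full], they are the krun p merges from [k] on and the outer face
    (k, 1), which is single. The others are paired in order, as krun p is even. *)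
Let full := krun p == fone p.
Let base := if full then k else k + (fone p - (krun p).+1).
Let single := if full then k else base + krun p.
Let pairs : pred nat := fun i => (base <= i < base + krun p) && ~~ odd (i - base).

Let pairs_bound i : pairs i -> i < k + bdim p.
Proof.
move=> /andP[/andP[_ ib] _]; have := fone_le_bdim pn; have := krun_le_fone p.
by move: ib; rewrite /base /full; case: eqP => _; lia.
Qed.

Let single_bound : single <= k + bdim p.
Proof.
have := fone_le_bdim pn; have := krun_le_fone p.
by rewrite /single /base /full; case: eqP => /=; lia.
Qed.

Let pairs_alt i : pairs i -> ~~ pairs i.+1.
Proof.
move=> /andP[/andP[bi _] ev]; rewrite /pairs subSn //= ev.
by rewrite andbF.
Qed.

Let pairs_single i : pairs i -> full = false -> single <> i /\ single <> i.+1.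
Proof.
rewrite /pairs /single => /andP[/andP[bi ib] ev] -> /=; split; first by lia.
move=> E; have : krun p = (i - base).+1 by lia.
by move=> kE; move: pk; rewrite kE /= negbK (negbTE ev).
Qed.

Let designatedP i c : designated pairs single full i c =
  if c then full && (i == k) else (k <= i) && ((i - k < fone p) && (fone p <= (i - k).+1 + krun p)).
Proof.
rewrite /designated /pairface xpair_eqE; case: c => /=.
  by rewrite orbF andbC /single; case: full.
have pairE : pairs i || (0 < i) && pairs i.-1 = (base <= i < base + krun p).
  apply/orP/idP => [[/andP[]//|]|/[dup] ib /andP[bi ik]].
    case: i => //= i /andP[/andP[bi ik] ev]; rewrite leqW //=.
    rewrite ltn_neqAle ik andbT; apply/eqP => E; move: pk.
    have -> : krun p = (i - base).+1 by lia.
    by rewrite /= ev.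
  have [od|ev] := boolP (odd (i - base)); last by left; rewrite /pairs ib.
  right; case: i bi ik ib od => [|i] bi ik ib; first by rewrite sub0n.
  have [E|bi'] : base = i.+1 \/ base <= i by lia.
    by rewrite E subnn.
  by rewrite subSn //= /pairs bi' => ->; rewrite andbT (ltn_trans _ ik).
have := krun_le_fone p; rewrite pairE /single /base; case E : full; move/eqP: E => E kf.
  by rewrite andbF /=; lia.
by rewrite andbT /=; lia.
Qed.

(** The conclusion holds for every family with these values at the pair, so that all pairs of one
    rank can be filled independently. *)
Lemma fill_pair (F : bifamily) :
  (forall y d x e (q : bipath y d x e), sorted q -> bapp F q = bapp B q) ->
  (forall y d x e (q : bipath y d x e), lower (rank p) q -> good F q) ->
  exists (g : Q -> H x e y d) (h : Q -> H x false y d), forall F' : bifamily,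
    bapp F' p = g -> bapp F' (hat p) = h ->
    (forall y d x e (q : bipath y d x e), lower (rank p) q -> bapp F' q = bapp F q) ->
    good F' p /\ good F' (hat p).
Proof.
move=> FB Fgood.
have pfaces := facewise_lower pk.
have [b [bdep bcont bE]] := boundary_value (facewise_impl Fgood pfaces).
(* At p only the boundary is known. That is enough for the face equations of p, hence for the
   consistency of the faces of [hat p]. *)
have [|F1 [F1p F1q]] := @override unit (fun=> BiCell p) F (fun=> b); first by move=> [] [].
have {}F1p : bapp F1 p = b := F1p tt.
have lowF1 y' d' x' e' (q : bipath y' d' x' e') : lower (rank p) q -> bapp F1 q = bapp F q.
  move=> ql; apply: F1q => _ E; move: ql.
  pose P (c : bicell) := lower (rank p) (cpath c).
  by rewrite -[lower _ _]/(P (BiCell q)) -E /P /lower /= (negbTE pn) ltnn.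
have F1B y' d' x' e' (q : bipath y' d' x' e') : sorted q -> bapp F1 q = bapp B q.
  by move=> sq; rewrite lowF1 ?FB // /lower sq.
have F1face : face_eq F1 p /\ depends F1 p.
  split; last by rewrite /depends F1p.
  move=> j c s jp sj; rewrite F1p (bE j c) //; apply: faceval_ext => //.
  by apply: facewise_impl pfaces => ? ? ? ? q ql; rewrite lowF1.
have hfaces : facewise (fun _ _ _ _ q => face_eq F1 q /\ depends F1 q) (hat p).
  apply: facewise_hat => // y' d' x' e' q ql.
  by have [] : good F1 q by apply: good_ext lowF1 _ _ => //; exact: Fgood.
have M1 : k + bdim (hat p) = (k + bdim p).+1 by rewrite bdim_hat addnS.
pose v i c s := faceval F1 (hat p) i c (upd i (endp c) s).
have desig_val F2 i c s : (forall y d x e (q : bipath y d x e), sorted q -> bapp F2 q = bapp B q) ->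
    designated pairs single full i c ->
    faceval F2 (hat p) i c s = ccomp (bapp F2 p (del i s)) (wt x e).
  move=> F2B; rewrite designatedP; case: c => [/andP[/eqP fl /eqP ->]|/andP[ki /andP[i1 i2]]].
    exact: faceval_split_hat.
  by rewrite -(subnKC ki); exact: faceval_merge_hat.
have nondesig F2 F3 i c s : (forall y d x e (q : bipath y d x e), lower (rank p) q -> bapp F2 q = bapp F3 q) ->
    i <= k + bdim p -> ~~ designated pairs single full i c ->
    faceval F2 (hat p) i c s = faceval F3 (hat p) i c s.
  move=> F23 ip; rewrite designatedP; have [ik|ki] := ltnP i k; first by rewrite !faceval_lt.
  move: ip; rewrite -(subnKC ki) leq_add2l; move: (i - k) => {ki} {}i ip.
  have ih : i < bdim (hat p) by rewrite bdim_hat.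
  case: c; last first.
    by rewrite addKn /= => nd; rewrite !faceval0 F23 //; exact: lower_merge_hat.
  rewrite /= -[X in _ == X]addn0 eqn_add2l => nd.
  have [z [c0 [p1 [p2 [pE p1i]]]]] := bcat_split ih.
  have /andP[l1 l2] : lower (rank p) p1 && lower (rank p) p2.
    by apply: lower_split_hat pE _ => //; move: nd; rewrite negb_and orbC p1i.
  by rewrite -p1i pE !faceval1 !F23.
have phic : continuous (fun g : H x e y d => ccomp g (wt x e)).
  apply: (@comp_continuous _ _ _ (fun g : H x e y d => (g, wt x e)) (fun u => ccomp u.1 u.2)).
    by apply: pair_continuous; [move=> ?; exact: cvg_id|exact: cst_continuous].
  exact: ccomp_continuous.
have [h0] := Hinh p.
(* [b] may be discontinuous in the interior. The faces that are not designated do not involve p, so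
   their continuity is read off from a family that is constant at p. *)
have [|F2 [F2p F2q]] := @override unit (fun=> BiCell p) F (fun=> fun=> h0); first by move=> [] [].
have {}F2p : bapp F2 p = (fun=> h0) := F2p tt.
have lowF2 y' d' x' e' (q : bipath y' d' x' e') : lower (rank p) q -> bapp F2 q = bapp F q.
  move=> ql; apply: F2q => _ E; move: ql.
  pose P (c : bicell) := lower (rank p) (cpath c).
  by rewrite -[lower _ _]/(P (BiCell q)) -E /P /lower /= (negbTE pn) ltnn.
have F2c : facewise (fun _ _ _ _ q => continuous (bapp F2 q)) (hat p).
  apply: facewise_hat => // [y' d' x' e' q ql|].
    by have [] : good F2 q by apply: good_ext lowF2 _ _ => //; exact: Fgood.
  by rewrite F2p; exact: cst_continuous.
have [|||g [h [[gc gd] gb [hc hd] hn hdes]]] :=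
  @multi_fill R _ _ _ phic (@wtW x e y d) (k + bdim p) pairs single full single_bound
    pairs_bound pairs_alt pairs_single b v bdep bcont.
- move=> i c ip nd; split.
    have -> : v i c = (fun s => faceval F2 (hat p) i c (upd i (endp c) s)).
      apply/funext => s; apply: nondesig => // *; rewrite lowF1 ?lowF2 //.
    by apply: faceval_continuous => //; rewrite M1 ltnS.
  move=> s s' ss; rewrite /v.
  have ip' : i < k + bdim (hat p) by rewrite M1 ltnS.
  apply: (faceval_dep (F := F1) _ ip'); first by apply: facewise_impl hfaces => ? ? ? ? ? [].
  by rewrite M1 => n nM; rewrite /upd ss.
- by move=> i c s _ di si; rewrite /v upd_id // desig_val // F1p.
- move=> i c j c' s /andP[ij jM] si sj; rewrite /v !upd_id //.
  apply: faceval_consistent => //; last by rewrite ij M1 ltnS.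
    by apply: facewise_impl hfaces => ? ? ? ? ? [].
  by apply: facewise_impl hfaces => ? ? ? ? ? [].
exists g, h => F' F'p F'h F'low.
have F'B y' d' x' e' (q : bipath y' d' x' e') : sorted q -> bapp F' q = bapp B q.
  by move=> sq; rewrite F'low ?FB // /lower sq.
split; split; rewrite /depends ?F'p ?F'h ?M1 //.
- move=> j c s jp sj; rewrite F'p gb; last by exists j, c.
  rewrite (bE j c) //; apply: faceval_ext => //.
  by apply: facewise_impl pfaces => ? ? ? ? q ql; rewrite F'low.
- move=> j c s; rewrite M1 ltnS F'h => jp sj.
  have [dj|nd] := boolP (designated pairs single full j c).
    by rewrite (hdes j c) // desig_val // F'p.
  rewrite (hn j c) // /v upd_id //; apply: nondesig => // *.
  by rewrite lowF1 ?F'low.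
Qed.


End pair.

(** * Induction on the rank *)

Hypothesis Bgood : forall y d x e (p : bipath y d x e), sorted p -> good B p.

(** Apart from its partner, a sequence of rank r has only faces that are [lower], so all pairs of
    rank r are filled at once. *)
Lemma extend_rank r (F : bifamily) :
  (forall y d x e (q : bipath y d x e), sorted q -> bapp F q = bapp B q) ->
  (forall y d x e (q : bipath y d x e), lower r q -> good F q) ->
  exists F' : bifamily,
    (forall y d x e (q : bipath y d x e), lower r q -> bapp F' q = bapp F q) /\
    (forall y d x e (q : bipath y d x e), lower r.+1 q -> good F' q).
Proof.
move=> FB Fg.
pose K := {c : bicell | [&& ~~ sorted (cpath c), ~~ odd (krun (cpath c)) & rank (cpath c) == r]}.
have Kn (c : K) : ~~ sorted (cpath (sval c)) by case: c => c /= /and3P[].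
have Kk (c : K) : ~~ odd (krun (cpath (sval c))) by case: c => c /= /and3P[].
have Kr (c : K) : rank (cpath (sval c)) = r by case: c => c /= /and3P[_ _ /eqP].
have fill (c : K) := fill_pair (Kn c) (Kk c) FB.
have {}fill (c : K) : exists g h, forall F' : bifamily,
    bapp F' (cpath (sval c)) = g -> bapp F' (hat (cpath (sval c))) = h ->
    (forall y d x e (q : bipath y d x e), lower r q -> bapp F' q = bapp F q) ->
    good F' (cpath (sval c)) /\ good F' (hat (cpath (sval c))).
  by have := fill c; rewrite (Kr c); apply.
pose g c := sval (cid (fill c)).
pose h c := sval (cid (svalP (cid (fill c)))).
have ghP c := svalP (cid (svalP (cid (fill c)))).
pose a (j : K * bool) := match j with
  | (c, true) => BiCell (hat (cpath (sval c))) | (c, false) => sval c end.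
pose v (j : K * bool) : Q -> H (cx (a j)) (ce (a j)) (cy (a j)) (cd (a j)) :=
  match j with (c, true) => h c | (c, false) => g c end.
have ak j : odd (krun (cpath (a j))) = j.2.
  by case: j => c []; [rewrite /= (krun_fone_hat (Kn c)).1 /= Kk|apply/negbTE/Kk].
(* The parity of the run determines the flag, and [hat_inj] then determines the pair. *)
have aI : injective a.
  move=> [c1 b1] [c2 b2] E; have : b1 = b2 by rewrite -[b1]/(c1, b1).2 -ak E ak.
  move: E => /[swap] <- {b2}; case: b1 => /= E; congr pair; apply: val_inj => //=.
  move: (Kn c1) (Kn c2) E; rewrite -!/(sval _); case: (sval c1) (sval c2) => y1 d1 x1 e1 p1 [y2 d2 x2 e2 p2] /=.
  move=> n1 n2 E; have yE := congr1 cy E; have dE := congr1 cd E; have xE := congr1 cx E.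
  rewrite /= in yE dE xE; subst y2 d2 x2.
  have := hat_inj n1 n2 (bicell_inj E).
  exact: (congr1 (fun t : {e & bipath y1 d1 x1 e} => BiCell (projT2 t))).
have [F' [F'a F'q]] := override F v aI.
have ar j : ~~ sorted (cpath (a j)) /\ rank (cpath (a j)) = r.
  by case: j => c [] /=; rewrite ?sorted_hat ?rank_hat ?Kn ?Kr ?Kk.
have F'low y d x e (q : bipath y d x e) : lower r q -> bapp F' q = bapp F q.
  move=> ql; apply: F'q => j E; move: ql; have [jn jr] := ar j.
  pose P (c : bicell) := lower r (cpath c).
  by rewrite -[lower _ _]/(P (BiCell q)) -E /P /lower (negbTE jn) jr ltnn.
have Kgood (c : K) : good F' (cpath (sval c)) /\ good F' (hat (cpath (sval c))).
  exact: (ghP c F' (F'a (c, false)) (F'a (c, true)) F'low).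
have even_good y d x e (q : bipath y d x e) : ~~ sorted q -> ~~ odd (krun q) -> rank q = r ->
    good F' q /\ good F' (hat q).
  move=> qn qk qr.
  have cP : [&& ~~ sorted (cpath (BiCell q)), ~~ odd (krun (cpath (BiCell q))) & rank (cpath (BiCell q)) == r].
    by rewrite /= qn qk qr eqxx.
  exact: (Kgood (exist _ (BiCell q) cP)).
exists F'; split => // y d x e q lq.
have [ql|] := boolP (lower r q); first by apply: good_ext F'low _ _ => //; exact: Fg.
rewrite negb_or => /andP[qn qr].
have {lq}qr : rank q = r by move: lq; rewrite /lower (negbTE qn) /=; lia.
have [qk|qk] := boolP (odd (krun q)); last by have [] := even_good _ _ _ _ q qn qk qr.
have [e' [c [cn ck qE]]] := krun_unhat qn qk; move: qr.
pose P (t : {e & bipath y d x e}) := rank (projT2 t) = r -> good F' (projT2 t).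
rewrite -/(P (existT _ e q)) qE /P /= rank_hat // => cr.
by have [] := even_good _ _ _ _ c cn ck cr.
Qed.

Theorem extension : exists F : bifamily,
  (forall y d x e (p : bipath y d x e), good F p) /\
  (forall y d x e (p : bipath y d x e), sorted p -> bapp F p = bapp B p).
Proof.
pose S r := {F : bifamily | (forall y d x e (q : bipath y d x e), sorted q -> bapp F q = bapp B q) /\
  (forall y d x e (q : bipath y d x e), lower r q -> good F q)}.
pose h0 y d x e (p : bipath y d x e) : H x e y d :=
  inhabited_witness (Hinh p).
pose F0 : bifamily := fun y d x e p => if sorted p then B p else fun=> h0 _ _ _ _ p.
have F0B y d x e (q : bipath y d x e) : sorted q -> bapp F0 q = bapp B q.
  by rewrite /bapp /F0 => ->.
have F0S : (forall y d x e (q : bipath y d x e), sorted q -> bapp F0 q = bapp B q) /\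
    (forall y d x e (q : bipath y d x e), lower 0 q -> good F0 q).
  split => // y d x e q; rewrite /lower ltn0 orbF => sq.
  apply: (good_ext (F := B) (r := 0)) (Bgood sq); last by rewrite /lower sq.
  by move=> ? ? ? ? q'; rewrite /lower ltn0 orbF => /F0B.
have step r (F : S r) : exists F' : S r.+1,
    forall y d x e (q : bipath y d x e), lower r q -> bapp (sval F') q = bapp (sval F) q.
  have [FB Fg] := svalP F; have [F' [F'F F'g]] := extend_rank FB Fg.
  have F'S : (forall y d x e (q : bipath y d x e), sorted q -> bapp F' q = bapp B q) /\
      (forall y d x e (q : bipath y d x e), lower r.+1 q -> good F' q).
    by split => // y d x e q sq; rewrite F'F ?FB // /lower sq.
  by exists (exist _ F' F'S).
pose fix T r : S r := if r is r'.+1 then sval (cid (step r' (T r'))) else exist _ F0 F0S.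
have TS r y d x e (q : bipath y d x e) : lower r q -> bapp (sval (T r.+1)) q = bapp (sval (T r)) q.
  by move: q; exact: (svalP (cid (step r (T r)))).
have Tle r n y d x e (q : bipath y d x e) : lower r q -> r <= n -> bapp (sval (T n)) q = bapp (sval (T r)) q.
  move=> lq; elim: n => [|n IH]; first by rewrite leqn0 => /eqP ->.
  rewrite leq_eqVlt => /orP[/eqP <- //|]; rewrite ltnS => rn; rewrite TS ?IH //.
  by move: lq; rewrite /lower => /orP[->//|lt]; rewrite (leq_trans lt rn) orbT.
have TB r y d x e (q : bipath y d x e) : sorted q -> bapp (sval (T r)) q = bapp B q.
  by have [+ _] := svalP (T r); apply.
(* The value at p is final from stage rank p + 1 on. *)
pose F : bifamily := fun y d x e p => bapp (sval (T (rank p).+1)) p.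
exists F; split=> [y d x e p|y d x e p sp]; last exact: TB.
apply: (good_ext (F := sval (T (rank p).+1)) (r := (rank p).+1)).
- move=> y' d' x' e' q /orP[sq|qr]; first by rewrite [LHS]TB // TB.
  by apply: esym; apply: Tle => //; rewrite /lower ltnSn orbT.
- by rewrite /lower ltnSn orbT.
- by have [_] := svalP (T (rank p).+1); apply; rewrite /lower ltnSn orbT.
Qed.

End extension.

(** * Flexible functors as families *)

Section chains_paths.
Local Open Scope nat_scope.
Context (X : category).

Section general.
Variables (W : category) (w : W -> bool).
Local Notation Y := (prodC X W).

(** Stated for any second factor with labelled objects, so that it serves [isoI] and [arrowI]
    alike. *)
Fixpoint to_path n (A B : Y) : chain n A B -> bipath B.1 (w B.2) A.1 (w A.2) :=
  match n return chain n A B -> bipath B.1 (w B.2) A.1 (w A.2) with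
  | 0 => fun f => BOne (w B.2) (w A.2) f.1
  | _.+1 => fun c => BCons (w A.2) (projT2 c).1.1 (to_path (projT2 c).2)
  end.

Lemma bdim_to_path n (A B : Y) (c : chain n A B) : bdim (to_path c) = n.
Proof. by elim: n A c => //= n IH A c; rewrite IH. Qed.

Lemma to_path_cat p q (A Z B : Y) (c : chain p A Z) (c' : chain q Z B) :
  to_path (chain_cat c c') = bcat (to_path c) (to_path c').
Proof. by elim: p A c => //= p IH A c; rewrite IH. Qed.

Lemma to_path_merge n i (A B : Y) (c : chain n.+1 A B) : i <= n ->
  to_path (chain_merge i c) = bmerge i (to_path c).
Proof.
have pre m A' Z (f : hom Z A') (c' : chain m Z B) :
    to_path (chain_precomp f c') = bpre (to_path c') (w A'.2) f.1.
  by case: m c' => [|m] c'.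
elim: n i A c => [|n IH] [|i] A c // ni; try exact: pre.
by rewrite /= IH.
Qed.

End general.

Definition dchain (Y : category) (A B : Y) := {n & chain n A B}.

Definition dcons (Y : category) (A Z B : Y) (f : hom Z A) (u : dchain Z B) : dchain A B :=
  existT (fun n => chain n A B) (projT1 u).+1 (existT _ Z (f, projT2 u)).

Local Notation Yi := (prodC X isoI).
Local Notation Ya := (prodC X arrowI).
Local Notation pathi := (@to_path isoI id _ _ _).
Local Notation patha := (@to_path arrowI id _ _ _).

Fixpoint from_path y d x e (p : bipath y d x e) : @dchain Yi (x, e) (y, d) :=
  match p with
  | BOne x e f => existT (fun n => @chain Yi n (x, e) (y, d)) 0 ((f, tt) : @hom Yi (y, d) (x, e))
  | BCons x e x' e' f q => @dcons Yi (x, e) (x', e') (y, d) (f, tt) (from_path q)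
  end.

Lemma from_pathK y d x e (p : bipath y d x e) : pathi (projT2 (from_path p)) = p.
Proof. by elim: p => //= {x e} x e x' e' f p IH; rewrite -[RHS]/(BCons e f p); congr BCons. Qed.

Lemma to_pathK n y d x e (c : @chain Yi n (x, e) (y, d)) :
  from_path (pathi c) = existT (fun n => @chain Yi n (x, e) (y, d)) n c.
Proof.
elim: n x e c => [|n IH] x e /= c; first by case: c => f [].
case: c => -[x' e'] [[f []] c] /=.
by rewrite (IH x' e' c).
Qed.

(** The proof of sortedness supplies the arrows of [arrowI]. *)
Fixpoint lift_path y d x e (p : bipath y d x e) : sorted p -> @dchain Ya (x, e) (y, d) :=
  match p in bipath _ _ x e return sorted p -> @dchain Ya (x, e) (y, d) with
  | BOne x e f => fun h => existT (fun n => @chain Ya n (x, e) (y, d)) 0 ((f, h) : @hom Ya (y, d) (x, e))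
  | BCons x e x' e' f q => fun h => @dcons Ya (x, e) (x', e') (y, d) (f, proj1 (andP h)) (lift_path (proj2 (andP h)))
  end.

Lemma lift_pathK y d x e (p : bipath y d x e) (h : sorted p) : patha (projT2 (lift_path h)) = p.
Proof. by elim: p h => //= {x e} x e x' e' f p IH h; rewrite -[RHS]/(BCons e f p); congr BCons. Qed.

Lemma sorted_to_path n (A B : Ya) (c : chain n A B) : sorted (patha c).
Proof. by elim: n A c => [|n IH] A /= c; [exact: c.2|rewrite IH (projT2 c).1.2]. Qed.

Lemma lift_to_path n y d x e (c : @chain Ya n (x, e) (y, d)) (h : sorted (patha c)) :
  lift_path h = existT (fun n => @chain Ya n (x, e) (y, d)) n c.
Proof.
elim: n x e c h => [|n IH] x e /= c h.
  by case: c h => f h' h; rewrite (bool_irrelevance h h').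
case: c h => -[x' e'] [[f h'] c] /= h.
by rewrite (IH x' e' c) /dcons /= (bool_irrelevance (proj1 (andP h)) h').
Qed.

Lemma to_path_incl n (A B : Ya) (c : chain n A B) :
  pathi (chain_map (prod_functor X inclI) c) = patha c.
Proof. by elim: n A c => //= n IH A c; rewrite -[RHS]/(BCons _ _ _) -IH. Qed.

End chains_paths.

(** * Values of flexible functors as maps on the infinite cube *)

Section flexible_values.
Local Open Scope nat_scope.
Context (R : realType) (C : contCategory).
Local Notation I := (unitI R).
Local Notation I0 := (@I0 R).
Local Notation I1 := (@I1 R).
Local Notation Q := (prod_topology (fun _ : nat => I)).

Definition trunc n (t : Q) : cube R n := fun i => t i.
Arguments trunc : clear implicits.

Lemma trunc_continuous n : continuous (trunc n).
Proof. by apply: prod_continuous => i; exact: component_continuous. Qed.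

Section general.
Variables (Z : category) (T : Z -> C).

Lemma flexibleP (G : flexible R T) : is_flexible (set_val G).
Proof. by have := valP G; rewrite inE set_valE. Qed.

Definition fapp (G : flexible R T) (A B : Z) (u : dchain A B) (t : Q) : chom (T A) (T B) :=
  family_app (set_val G) (projT2 u) (trunc _ t).

Lemma fapp_dep G A B (u : dchain A B) : dep (projT1 u) (fapp G u).
Proof.
move=> t t' tt'; rewrite /fapp; congr (family_app _ _ _).
by apply/funext => i; exact: tt'.
Qed.

Lemma family_app_continuous (G : flexFamily R T) n A B (c : chain n A B) :
  continuous (family_app G c).
Proof. exact: (@cts_fun _ _ (G (CSeq c))). Qed.

Lemma fapp_continuous G A B (u : dchain A B) : continuous (fapp G u).
Proof.
apply: (@comp_continuous _ _ _ (trunc (projT1 u)) (family_app (set_val G) (projT2 u))).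
  exact: trunc_continuous.
exact: family_app_continuous.
Qed.

Lemma fapp_face0 (G : flexible R T) n A B (c : chain n.+1 A B) i t : i <= n -> t i = I0 ->
  fapp G (existT (fun n => chain n A B) n.+1 c) t =
  fapp G (existT (fun n => chain n A B) n (chain_merge i c)) (del i t).
Proof.
move=> ni ti; have [G0 _ _] := flexibleP G.
by rewrite /fapp /= (G0 _ _ _ _ _ (Ordinal (ni : i < n.+1))).
Qed.

Lemma fapp_face1 (G : flexible R T) p q A Z0 B (c : chain p A Z0) (c' : chain q Z0 B) t :
  t p = I1 ->
  fapp G (existT (fun n => chain n A B) (p + q.+1) (chain_cat c c')) t =
  ccomp (fapp G (existT (fun n => chain n Z0 B) q c') (fun j => t (p + j.+1)))
        (fapp G (existT (fun n => chain n A Z0) p c) t).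
Proof.
move=> tp; have [_ G1 _] := flexibleP G.
rewrite /fapp /= G1 //=; last by rewrite /trunc /= addn0.
Qed.

Lemma fapp_id (G : flexible R T) A t :
  fapp G (existT (fun n => chain n A A) 0 (idm A : chain 0 A A)) t = cidm (T A).
Proof. by have [_ _ Gid] := flexibleP G; rewrite /fapp Gid. Qed.

End general.

Lemma flexible_ext (Z : category) (T : Z -> C) (G G' : flexible R T) :
  (forall n (A B : Z) (c : chain n A B) t, family_app (set_val G) c t = family_app (set_val G') c t) ->
  G = G'.
Proof.
move=> GG; apply: val_inj; rewrite -!set_valE; apply: functional_extensionality_dep => -[n A B c].
by apply/continuousEP => t; exact: GG.
Qed.

End flexible_values.
Arguments trunc {R} n t.

(** * Precomposition with a morphism invertible up to homotopy *)

Section precomposition.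
Context (R : realType) (C : contCategory).

Lemma precomp_continuous (A B D : C) (w : chom A B) : continuous (fun g : chom B D => ccomp g w).
Proof.
apply: (@comp_continuous _ _ _ (fun g : chom B D => (g, w)) (fun u => ccomp u.1 u.2)).
  by apply: pair_continuous; [move=> ?; exact: cvg_id|exact: cst_continuous].
exact: ccomp_continuous.
Qed.

(** A path from the identity to u is a homotopy from the identity map to precomposition with u. *)
Lemma weak_equiv_precomp_joined (A D : C) (u : chom A A) : joined R _ u (cidm A) ->
  weak_equiv R (fun g : chom A D => ccomp g u).
Proof.
move=> /joined_sym[p pc [p0 p1]].
have := @weak_equiv_homotopic_id R (chom A D) (fun z => ccomp z.2 (p z.1)).
rewrite /= p1; apply; last by move=> z; rewrite p0 ccompm1.
apply: (@comp_continuous _ _ _ (fun z : unitI R * chom A D => (z.2, p z.1)) (fun u => ccomp u.1 u.2)); last exact: ccomp_continuous.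
apply: pair_continuous; first by move=> z; exact: cvg_snd.
by apply: (@comp_continuous _ _ _ fst p) => // z; exact: cvg_fst.
Qed.

Lemma weak_equiv_precomp (A B D : C) (w : chom A B) (v : chom B A) :
  joined R _ (ccomp v w) (cidm A) -> joined R _ (ccomp w v) (cidm B) ->
  weak_equiv R (fun g : chom B D => ccomp g w).
Proof.
move=> vw wv; apply: (@weak_equiv_cancel _ _ _ _ (fun g => ccomp g v)).
- exact: precomp_continuous.
- exact: precomp_continuous.
- under [X in weak_equiv _ X]eq_fun do rewrite -ccompA.
  exact: weak_equiv_precomp_joined.
- under [X in weak_equiv _ X]eq_fun do rewrite -ccompA.
  exact: weak_equiv_precomp_joined.
Qed.

Lemma invertible_pi0 (A B : C) (w : chom A B) :
  @invertible (pi0 R C) A B (pi0_class R w) <->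
  exists v : chom B A, joined R _ (ccomp v w) (cidm A) /\ joined R _ (ccomp w v) (cidm B).
Proof.
split=> [[g]|[v [vw wv]]]; last first.
  by exists (pi0_class R v); rewrite /= pi0_compE; apply/pi0_classP.
rewrite -(pi0_class_surj g) /= !pi0_compE => /pi0_classP ? /pi0_classP ?.
by exists (repr g).
Qed.

End precomposition.

(** * Equivalences that extend a given morphism *)

Section equivalences.
Local Open Scope nat_scope.
Context (R : realType) (X : category) (C : contCategory).
Context (T0 T1 : flexFunctor R X C) (G : flexMorphism T0 T1).
Local Notation I := (unitI R).
Local Notation I0 := (@I0 R).
Local Notation I1 := (@I1 R).
Local Notation Q := (prod_topology (fun _ : nat => I)).
Local Notation endp := (endp R).
Local Notation Yi := (prodC X isoI).
Local Notation Ya := (prodC X arrowI).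
Local Notation pathi := (@to_path X isoI id _ _ _).
Local Notation patha := (@to_path X arrowI id _ _ _).

Definition obj (x : X) (e : bool) : C := if e then T1 x else T0 x.

Local Notation H x e y d := (chom (obj x e) (obj y d)).
Local Notation E := (equivalences_extending G).
Local Notation flexi := (flexible R (ends T0 T1 : Yi -> C)).

Definition isovalue (F : flexi) y d x e (p : bipath y d x e) (t : Q) : H x e y d :=
  fapp F (from_path p) t.

Definition arrvalue y d x e (p : bipath y d x e) (sp : sorted p) (t : Q) : H x e y d :=
  fapp (set_val G) (lift_path sp) t.

Lemma isovalue_to_path (F : flexi) n x e y d (c : @chain Yi n (x, e) (y, d)) t :
  isovalue F (pathi c) t = family_app (set_val F) c (trunc n t).
Proof.
by rewrite -[RHS]/(fapp F (existT (fun n => @chain Yi n (x, e) (y, d)) n c) t) -to_pathK.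
Qed.

Lemma arrvalue_to_path n x e y d (c : @chain Ya n (x, e) (y, d)) (h : sorted (patha c)) t :
  arrvalue h t = family_app (set_val (set_val G)) c (trunc n t).
Proof.
by rewrite -[RHS]/(fapp (set_val G) (existT (fun n => @chain Ya n (x, e) (y, d)) n c) t) -(lift_to_path h).
Qed.

Lemma isovalue_face0 (F : flexi) y d x e (p : bipath y d x e) i t :
  i < bdim p -> t i = I0 -> isovalue F p t = isovalue F (bmerge i p) (del i t).
Proof.
rewrite -(from_pathK p); case: (from_path p) => n c /=; rewrite (@bdim_to_path X isoI id _ _ _ c).
case: n c => // n c ni ti.
rewrite -(@to_path_merge X isoI id _ _ _ _ c) // !isovalue_to_path.
exact: (fapp_face0 F c ni ti).
Qed.

Lemma isovalue_face1 (F : flexi) z c x e (p : bipath z c x e) y d (q : bipath y d z c) t :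
  t (bdim p) = I1 ->
  isovalue F (bcat p q) t = ccomp (isovalue F q (fun j => t (bdim p + j.+1))) (isovalue F p t).
Proof.
rewrite -(from_pathK p) -(from_pathK q).
case: (from_path p) => m cp /=; case: (from_path q) => n cq /=; rewrite (@bdim_to_path X isoI id _ _ _ cp) => tm.
rewrite -(@to_path_cat X isoI id _ _ _ _ _ cp cq) !isovalue_to_path.
exact: (fapp_face1 F cp cq tm).
Qed.

Lemma arrvalue_face0 y d x e (p : bipath y d x e) (h : sorted p) i (h' : sorted (bmerge i p)) t :
  i < bdim p -> t i = I0 -> arrvalue h t = arrvalue h' (del i t).
Proof.
move: (lift_path h) (lift_pathK h) => u uE; move: h h'; rewrite -{}uE.
case: u => n c /= h h'; rewrite (@bdim_to_path X arrowI id _ _ _ c).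
case: n c h h' => // n c h h' ni ti; move: h'.
rewrite -(@to_path_merge X arrowI id _ _ _ _ c) // => h'; rewrite !arrvalue_to_path.
exact: (fapp_face0 (set_val G) c ni ti).
Qed.

Lemma arrvalue_face1 z c x e (p : bipath z c x e) y d (q : bipath y d z c) t
    (h : sorted (bcat p q)) (hp : sorted p) (hq : sorted q) :
  t (bdim p) = I1 ->
  arrvalue h t = ccomp (arrvalue hq (fun j => t (bdim p + j.+1))) (arrvalue hp t).
Proof.
move: (lift_path hp) (lift_pathK hp) (lift_path hq) (lift_pathK hq) => u uE u' uE'.
move: h hp hq; rewrite -{}uE -{}uE'.
case: u => m cp /=; case: u' => n cq /=; rewrite (@bdim_to_path X arrowI id _ _ _ cp).
rewrite -(@to_path_cat X arrowI id _ _ _ _ _ cp cq) => h hp hq tm; rewrite !arrvalue_to_path.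
exact: (fapp_face1 (set_val G) cp cq tm).
Qed.

Lemma extendingP (F : E) : flexible_restrict (prod_functor X inclI) (set_val F) = set_val G.
Proof. exact: (set_mem (valP F)).2. Qed.

Lemma isovalue_sorted (F : E) y d x e (p : bipath y d x e) (h : sorted p) t :
  isovalue (set_val F) p t = arrvalue h t.
Proof.
move: (lift_path h) (lift_pathK h) => u uE; move: h; rewrite -{}uE.
case: u => n c /= h; rewrite arrvalue_to_path.
transitivity (family_app (set_val (flexible_restrict (prod_functor X inclI) (set_val F))) c (trunc n t)).
  rewrite -(to_path_incl c).
  exact: (isovalue_to_path (set_val F) (chain_map (prod_functor X inclI) c) t).
exact: (congr1 (fun F' => family_app (set_val F') c (trunc n t)) (extendingP F)).
Qed.

Lemma dim_lift_path (y : X) d x e (p : bipath y d x e) (h : sorted p) : projT1 (lift_path h) = bdim p.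
Proof. by rewrite -[in RHS](lift_pathK h) (@bdim_to_path X arrowI id _ _ _ (projT2 (lift_path h))). Qed.

Lemma dim_from_path (y : X) d x e (p : bipath y d x e) : projT1 (from_path p) = bdim p.
Proof. by rewrite -[in RHS](from_pathK p) (@bdim_to_path X isoI id _ _ _ (projT2 (from_path p))). Qed.

Section family.
Variable k : nat.

Definition dropk (s : Q) : Q := fun n => s (k + n).

Lemma dropk_continuous : continuous dropk.
Proof. exact: reindex_continuous. Qed.

Lemma dropk_del i s : dropk (del (k + i) s) = del i (dropk s).
Proof.
apply/funext => n; rewrite /dropk /del /bump leq_add2l.
by congr (s _); rewrite addnCA.
Qed.

Lemma dropk_shift j s : dropk (shift k j.+1 s) = fun n => dropk s (j + n.+1).
Proof. by apply/funext => n; rewrite /dropk shift_ge; congr (s _); lia. Qed.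

Variable U : bifamily R obj.
Hypothesis Udep : forall y d x e (p : bipath y d x e), depends k U p.
Hypothesis Ucont : forall y d x e (p : bipath y d x e), facewise_continuous k (bapp U p).
(** Over each boundary point U comes from an actual equivalence, which supplies the face equations
    there. *)
Hypothesis Uiso : forall s, onface k s -> exists F : E, forall s', (forall n, n < k -> s' n = s n) ->
  forall y d x e (p : bipath y d x e), bapp U p s' = isovalue (set_val F) p (dropk s').

(** The known data: G on sorted sequences, and elsewhere U, which is meaningful over the boundary of
    the parameter cube. *)
Definition bdfamily : bifamily R obj := fun y d x e p s =>
  if pselect (is_true (sorted p)) is left h then arrvalue h (dropk s) else U p s.

Lemma bdfamily_sorted y d x e (p : bipath y d x e) (h : sorted p) s :
  bapp bdfamily p s = arrvalue h (dropk s).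
Proof.
rewrite /bapp /bdfamily; case: pselect => [h'|//].
by rewrite (Prop_irrelevance h' h).
Qed.

Lemma bdfamily_iso s : onface k s -> exists F : E, forall s', (forall n, n < k -> s' n = s n) ->
  forall y d x e (p : bipath y d x e), bapp bdfamily p s' = isovalue (set_val F) p (dropk s').
Proof.
move=> /Uiso[F UF]; exists F => s' ss y d x e p.
have [h|h] := boolP (sorted p); first by rewrite bdfamily_sorted isovalue_sorted.
rewrite -UF // /bapp /bdfamily; case: pselect => // h'.
by rewrite h' in h.
Qed.

Lemma bdfamily_face y d x e (p : bipath y d x e) (s : Q) j c : onface k s ->
  j < k + bdim p -> s j = endp c -> bapp bdfamily p s = faceval k bdfamily bdfamily p j c s.
Proof.
move=> /bdfamily_iso[F BF] jp sj; have [jk|kj] := ltnP j k; first by rewrite faceval_lt.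
move: jp sj; rewrite -(subnKC kj) ltn_add2l; move: (j - k) => {kj} {}j jp sj.
case: c sj => sj.
  have [z [c [p1 [p2 [pE p1j]]]]] := bcat_split jp.
  rewrite -p1j pE faceval1 !BF //; last by move=> n nk; rewrite shift_lt.
  by rewrite isovalue_face1 ?dropk_shift // /dropk p1j.
rewrite faceval0 !BF //; last by move=> n nk; rewrite del_lt //; lia.
by rewrite (isovalue_face0 _ jp) // dropk_del.
Qed.

Lemma bdfamily_good y d x e (p : bipath y d x e) : sorted p -> good k bdfamily bdfamily p.
Proof.
move=> sp; split.
- move=> j c s jp sj; have [jk|kj] := ltnP j k; first by rewrite faceval_lt.
  move: jp sj; rewrite -(subnKC kj) ltn_add2l; move: (j - k) => {kj} {}j jp sj.
  case: c sj => sj.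
    have [z [c [p1 [p2 [pE p1j]]]]] := bcat_split jp.
    move: (sp); rewrite -p1j pE sorted_cat => /andP[s1 s2].
    have s12 : sorted (bcat p1 p2) by rewrite -pE.
    rewrite faceval1 (bdfamily_sorted s12) (bdfamily_sorted s1) (bdfamily_sorted s2).
    by rewrite (arrvalue_face1 s12 s1 s2) ?dropk_shift // /dropk p1j.
  have sm := sorted_merge j sp.
  rewrite faceval0 (bdfamily_sorted sp) (bdfamily_sorted sm) dropk_del.
  exact: arrvalue_face0.
- move=> s s' ss; rewrite !bdfamily_sorted; apply: fapp_dep => n.
  by rewrite dim_lift_path => np; apply: ss; rewrite ltn_add2l.
- have -> : bapp bdfamily p = (fun s => arrvalue sp (dropk s)).
    by apply/funext => s; rewrite bdfamily_sorted.
  by apply: comp_continuous dropk_continuous _; exact: fapp_continuous.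
Qed.

Lemma bdfamily_dep y d x e (p : bipath y d x e) : depends k bdfamily p.
Proof.
have [/bdfamily_good[]//|ns] := boolP (sorted p).
move=> s s' ss; rewrite /bapp /bdfamily; case: pselect => [h|_]; last exact: Udep.
by rewrite h in ns.
Qed.

Lemma bdfamily_cont y d x e (p : bipath y d x e) : facewise_continuous k (bapp bdfamily p).
Proof.
have [/bdfamily_good[_ _ pc]|ns] := boolP (sorted p); first by move=> j c jk; exact: continuous_updc.
have -> : bapp bdfamily p = bapp U p.
  apply/funext => s; rewrite /bapp /bdfamily; case: pselect => // h.
  by rewrite h in ns.
exact: Ucont.
Qed.

Definition comparison (x : X) (e : bool) : H x false x e :=
  match e with true => component G x | false => cidm _ end.

Lemma arrvalue_unit x e (h : sorted (BOne e false (idm x))) t : arrvalue h t = comparison x e.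
Proof.
rewrite /arrvalue; case: e h => h /=.
  rewrite /component /flexible_hom /flexible_app /fapp /= (bool_irrelevance h arrow_u).
  have tE : trunc 0 t = (fun=> I0) by apply/funext => -[].
  by rewrite tE.
rewrite (bool_irrelevance h (@idm arrowI false)).
exact: (@fapp_id R C Ya (ends T0 T1) (set_val G) (x, false) t).
Qed.

Lemma bdfamily_unit x e s :
  bapp bdfamily (BOne e false (idm x)) s = comparison x e.
Proof.
have h : sorted (BOne e false (idm x)) by [].
by rewrite (bdfamily_sorted h) arrvalue_unit.
Qed.

End family.

Definition invertible_components := forall A : X,
  @invertible (pi0 R C) (T0 A) (T1 A) (pi0_class R (component G A)).

Lemma comparison_weak_equiv (inv : invertible_components) x e y d :
  weak_equiv R (fun g : H x e y d => ccomp g (comparison x e)).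
Proof.
case: e => /=; last exact/weak_equiv_precomp_joined/joined_refl.
have /invertible_pi0[v [vw wv]] := inv x.
exact: weak_equiv_precomp vw wv.
Qed.

Lemma chom_inhabited (inv : invertible_components) y d x e :
  @bipath X y d x e -> inhabited (H x e y d).
Proof.
move=> p; have {p}[f] : inhabited (hom y x).
  by elim: p => {x e} [x e f|x e x' e' f p [g]]; constructor; [exact: f|exact: compm f g].
have f0 : chom (T0 x) (T0 y) := flexible_hom (flex_map T0) f.
have f1 : chom (T1 x) (T1 y) := flexible_hom (flex_map T1) f.
have /invertible_pi0[v _] := inv x.
constructor; rewrite /obj; case: e; case: d => //.
  exact: ccomp f0 v.
exact: ccomp f1 (component G x).
Qed.

Lemma extend_boundary (inv : invertible_components) k (U : bifamily R obj) :
  (forall y d x e (p : bipath y d x e), depends k U p) ->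
  (forall y d x e (p : bipath y d x e), facewise_continuous k (bapp U p)) ->
  (forall s, onface k s -> exists F : E, forall s', (forall n, n < k -> s' n = s n) ->
    forall y d x e (p : bipath y d x e), bapp U p s' = isovalue (set_val F) p (dropk k s')) ->
  exists F : bifamily R obj,
    (forall y d x e (p : bipath y d x e), good k (bdfamily k U) F p) /\
    (forall y d x e (p : bipath y d x e), sorted p -> bapp F p = bapp (bdfamily k U) p).
Proof.
move=> Ud Uc Ui; apply: (@extension R X C obj k (bdfamily k U) _ _ _ _ comparison).
- by move=> *; exact: bdfamily_face.
- by move=> *; exact: bdfamily_dep.
- by move=> *; exact: bdfamily_cont.
- exact: chom_inhabited.
- by [].
- exact: bdfamily_unit.
- exact: comparison_weak_equiv.
- by move=> *; exact: bdfamily_good.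
Qed.

(** * From families back to maps into the space of equivalences *)

Section reconstruction.
Variables (k : nat) (U F : bifamily R obj).
Hypothesis Fgood : forall y d x e (p : bipath y d x e), good k (bdfamily k U) F p.
Hypothesis FB : forall y d x e (p : bipath y d x e), sorted p -> bapp F p = bapp (bdfamily k U) p.

(** Path parameters are stored from coordinate k on; the coordinates from k + n on are filled with
    [I0]. *)
Definition plug n (s : Q) (t : cube R n) : Q :=
  fun j => if j < k then s j else oapp t I0 (insub (j - k)).

Lemma plug_continuous n : continuous (fun u : Q * cube R n => plug u.1 u.2).
Proof.
apply: prod_continuous => j; rewrite /plug; case: (j < k).
  apply: (@comp_continuous _ _ _ fst (fun s : Q => s j)); first by move=> z; exact: cvg_fst.
  exact: component_continuous.
case: insub => [i|] /=; last exact: cst_continuous.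
apply: (@comp_continuous _ _ _ snd (fun t : cube R n => t i)); first by move=> z; exact: cvg_snd.
exact: component_continuous.
Qed.

Lemma plug_lt n s (t : cube R n) j : j < k -> plug s t j = s j.
Proof. by rewrite /plug => ->. Qed.

Lemma plug_ge n s (t : cube R n) (i : 'I_n) : plug s t (k + i) = t i.
Proof. by rewrite /plug ltnNge leq_addr addKn /= insubT //= => ?; congr t; exact: val_inj. Qed.

Lemma trunc_plug n s (t : cube R n) : trunc n (dropk k (plug s t)) = t.
Proof. by apply/funext => i; exact: plug_ge. Qed.

Definition celleval (s : Q) (n : nat) (A B : Yi) (c : chain n A B) (t : cube R n) :
    chom (ends T0 T1 A) (ends T0 T1 B) :=
  bapp F (pathi c) (plug s t).

Lemma celleval_continuous2 n (A B : Yi) (c : chain n A B) :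
  continuous (fun u : Q * cube R n => celleval u.1 c u.2).
Proof.
apply: (@comp_continuous _ _ _ (fun u : Q * cube R n => plug u.1 u.2) (bapp F (pathi c))).
  exact: plug_continuous.
by have [] := Fgood (pathi c).
Qed.

Lemma celleval_continuous s n (A B : Yi) (c : chain n A B) : continuous (celleval s c).
Proof.
apply: (@comp_continuous _ _ _ (fun t => (s, t)) (fun u : Q * cube R n => celleval u.1 c u.2)).
  by apply: pair_continuous; [exact: cst_continuous|move=> ?; exact: cvg_id].
exact: celleval_continuous2.
Qed.

Definition cellfamily (s : Q) : flexFamily R (ends T0 T1 : Yi -> C) :=
  fun c => mkcts (celleval_continuous (s := s) (c := cchain c)).

Lemma cellfamilyE s n (A B : Yi) (c : chain n A B) t :
  family_app (cellfamily s) c t = bapp F (pathi c) (plug s t).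
Proof. by []. Qed.

Lemma plug_bump n s (t : cube R n.+1) (i : 'I_n.+1) j : j < k + n ->
  del (k + i) (plug s t) j = plug s (fun m => t (lift i m)) j.
Proof.
move=> jn; have [jk|kj] := ltnP j k; first by rewrite del_lt ?plug_lt //; lia.
move: jn; rewrite -(subnKC kj) ltn_add2l; move: (j - k) => m mn.
have -> : m = Ordinal mn :> nat by [].
rewrite (plug_ge s (fun m => t (lift i m))) -(plug_ge s t) /del; congr (plug _ _ _).
by rewrite /= /bump leq_add2l addnCA.
Qed.

Lemma cellfamily_flexible s : is_flexible (cellfamily s).
Proof.
split.
- move=> n A B c t i ti; rewrite !cellfamilyE.
  have [Fc _ _] := Fgood (pathi c); have ic : i < bdim (pathi c) by rewrite bdim_to_path.
  rewrite (Fc (k + i) false) ?ltn_add2l ?plug_ge // faceval0 -to_path_merge; last first.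
    by rewrite -ltnS.
  have [_ Fm _] := Fgood (pathi (chain_merge i c)); apply: Fm => j.
  by rewrite bdim_to_path; exact: plug_bump.
- move=> p q A Z B c c' t tp; rewrite !cellfamilyE to_path_cat.
  have [Fc _ _] := Fgood (bcat (pathi c) (pathi c')).
  have pE : k + p = k + @rshift p q.+1 ord0 by rewrite /= addn0.
  have dc : bdim (pathi c) = p := @bdim_to_path X isoI id _ _ _ c.
  rewrite (Fc (k + bdim (pathi c)) true); last 2 first.
  + by rewrite ltn_add2l bdim_cat; lia.
  + by rewrite dc pE plug_ge.
  rewrite faceval1; congr ccomp.
    have [_ Fd _] := Fgood (pathi c'); apply: Fd => j; rewrite bdim_to_path => jq.
    have [jk|kj] := ltnP j k; first by rewrite shift_lt ?plug_lt.
    move: jq; rewrite -(subnKC kj) ltn_add2l; move: (j - k) => m mq.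
    rewrite shift_ge dc; have -> : m = Ordinal mq :> nat by [].
    rewrite (plug_ge s (fun j => t (rshift p (lift ord0 j)))) -(plug_ge s t); congr (plug _ _ _).
    by rewrite /= /bump /=; lia.
  have [_ Fd _] := Fgood (pathi c); apply: Fd => j; rewrite bdim_to_path => jp.
  have [jk|kj] := ltnP j k; first by rewrite !plug_lt.
  move: jp; rewrite -(subnKC kj) ltn_add2l; move: (j - k) => m mp.
  have -> : m = Ordinal mp :> nat by [].
  by rewrite (plug_ge s (fun j => t (lshift q.+1 j))) -(plug_ge s t).
- move=> A t; rewrite cellfamilyE /=.
  have h : sorted (BOne A.2 A.2 (idm A.1)) by exact: implybb.
  rewrite FB // (bdfamily_sorted _ _ h) /arrvalue /=.
  rewrite (bool_irrelevance h (@idm arrowI A.2)).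
  by case: A h t => x e h t; exact: (@fapp_id R C Ya (ends T0 T1) (set_val G) (x, e)).
Qed.

Definition cellflexible (s : Q) : flexi := SigSub (mem_set (cellfamily_flexible s)).

Lemma cellflexibleE s n (A B : Yi) (c : chain n A B) t :
  family_app (set_val (cellflexible s)) c t = bapp F (pathi c) (plug s t).
Proof. by []. Qed.

Lemma cellflexible_restrict s :
  flexible_restrict (prod_functor X inclI) (cellflexible s) = set_val G.
Proof.
apply: flexible_ext => n [x e] [y d] c t.
transitivity (bapp F (pathi (chain_map (prod_functor X inclI) c)) (plug s t)); first by [].
have h := sorted_to_path c; rewrite to_path_incl FB // (bdfamily_sorted _ _ h).
by rewrite arrvalue_to_path trunc_plug.
Qed.

Lemma chain_map_slice (i : bool) n (A B : X) (c : chain n A B) :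
  chain_map (slice X (i : isoI)) c =
  chain_map (prod_functor X inclI) (chain_map (slice X (i : arrowI)) c).
Proof. by elim: n A c => //= n IH A c; rewrite IH. Qed.

Lemma flexible_restrict_slice (F' : flexi) (i : bool) :
  flexible_restrict (prod_functor X inclI) F' = set_val G ->
  flexible_restrict (slice X (i : isoI)) F' = flexible_restrict (slice X (i : arrowI)) (set_val G).
Proof.
move=> <-; apply: flexible_ext => n A B c t.
transitivity (family_app (set_val F') (chain_map (slice X (i : isoI)) c) t); first by [].
by rewrite chain_map_slice.
Qed.

Lemma cellflexible_extends s : (cellflexible s) \in [set F | is_flexEquivalence (T0 := T0) (T1 := T1) F /\
  flexible_restrict (prod_functor X inclI) F = set_val G].
Proof.
have [G0 G1] : is_flexMorphism (set_val G) := set_mem (valP G).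
have FG := cellflexible_restrict s.
apply: mem_set; split => //; split; first by rewrite (flexible_restrict_slice false).
by rewrite (flexible_restrict_slice true).
Qed.

Definition cellequivalence (s : Q) : E := SigSub (cellflexible_extends s).

(** The topologies are initial, so one cell may be treated at a time; there, joint continuity in the
    parameters and the cube coordinates is curried into the compact-open topology. *)
Lemma cellequivalence_continuous : continuous cellequivalence.
Proof.
apply: continuous_comp_initial; apply: continuous_comp_initial; apply: prod_continuous => -[n A B c].
apply: continuous_comp_initial.
have := @continuous_curry_fun _ _ _ (fun u : Q * cube R n => celleval u.1 c u.2) (@celleval_continuous2 n A B c).
exact.
Qed.

(** Over the boundary the face equations force F to be the prescribed family, which is the one of F'
    there. *)
Lemma cellequivalence_boundary s (F' : E) : onface k s ->
  (forall s', (forall n, n < k -> s' n = s n) ->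
    forall y d x e (p : bipath y d x e), bapp U p s' = isovalue (set_val F') p (dropk k s')) ->
  cellequivalence s = F'.
Proof.
move=> sk UF; apply: val_inj; rewrite -!set_valE; apply: flexible_ext => n [x e] [y d] c t.
rewrite cellflexibleE; have [Fp _ _] := Fgood (pathi c).
have pk : onface k (plug s t) by apply: onface_dep sk => j jk; rewrite plug_lt.
rewrite (face_eq_boundary Fp pk) -[RHS]/(family_app (set_val (set_val F')) c t).
rewrite -[in RHS](trunc_plug s t) -isovalue_to_path.
have [h|h] := boolP (sorted (pathi c)).
  by rewrite (bdfamily_sorted _ _ h) (isovalue_sorted F' h).
rewrite -UF; last by move=> j jk; rewrite plug_lt.
by rewrite /bapp /bdfamily; case: pselect => // h'; rewrite h' in h.
Qed.

End reconstruction.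

End equivalences.

(** * Cubes are compact and Hausdorff *)

Section cubes.
Context (R : realType).

Lemma unitI_compact : compact [set: unitI R].
Proof.
have -> : [set: unitI R] = @clamp R @` (`[0%R, 1%R]%classic : set R).
  apply/seteqP; split => // t _; exists (set_val t); last exact: clampK.
  by rewrite /= in_itv /=; exact: unitI_itv.
apply: continuous_compact; last exact: segment_compact.
by apply: continuous_subspaceT; exact: clamp_continuous.
Qed.

Lemma unitI_hausdorff : hausdorff_space (unitI R).
Proof.
move=> p q pq; apply: unitI_inj; apply: (@Rhausdorff R) => A B Ap Bq.
have [||t [At Bt]] := pq (set_val @^-1` A) (set_val @^-1` B).
- exact: unitI_val_continuous.
- exact: unitI_val_continuous.
- by exists (set_val t).
Qed.

Lemma cube_compact n : compact [set: cube R n].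
Proof.
have := @tychonoff 'I_n (fun=> unitI R) (fun=> setT) (fun=> unitI_compact).
by congr (compact _); apply/seteqP; split.
Qed.

Lemma cube_hausdorff n : hausdorff_space (cube R n).
Proof. by apply: hausdorff_product => _; exact: unitI_hausdorff. Qed.

Lemma cube_locally_compact n : locally_compact [set: cube R n].
Proof.
move=> t _; exists setT; first by rewrite withinET; exact: filterT.
by split; [exact: cube_compact|exact: closedT].
Qed.

Lemma cube_regular n : regular_space (cube R n).
Proof. by move=> t; apply: compact_regular (@cube_hausdorff n) (@cube_compact n) _; exact: filterT. Qed.

End cubes.

(** * Existence of extensions and vanishing of homotopy groups *)

Section extension_space.
Local Open Scope nat_scope.
Context (R : realType) (X : category) (C : contCategory).
Context (T0 T1 : flexFunctor R X C) (G : flexMorphism T0 T1).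
Local Notation I := (unitI R).
Local Notation I0 := (@I0 R).
Local Notation I1 := (@I1 R).
Local Notation Q := (prod_topology (fun _ : nat => I)).
Local Notation endp := (endp R).
Local Notation E := (equivalences_extending G).

(** Evaluation is jointly continuous for the compact-open topology because the cube is locally
    compact and regular. *)
Lemma isovalue_continuous (u : Q -> E) (f : Q -> Q) y d x e (p : @bipath X y d x e) :
  continuous u -> continuous f -> continuous (fun s => isovalue (set_val (u s)) p (f s)).
Proof.
move=> uc fc; rewrite /isovalue /fapp; case: (from_path p) => n c /=.
pose K := continuousType (cube R n) (chom (ends T0 T1 (x, e)) (ends T0 T1 (y, d))).
pose c' := CSeq c.
have gc : continuous (fun s => (set_val (set_val (u s))) c' : K).
  have u1 : continuous (fun s => set_val (u s)).
    by apply: (@comp_continuous _ _ _ u set_val) => //; exact: initial_continuous.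
  have u2 : continuous (fun s => set_val (set_val (u s))).
    by apply: (@comp_continuous _ _ _ (fun s => set_val (u s)) set_val) => //; exact: initial_continuous.
  apply: (@comp_continuous _ _ _ (fun s => set_val (set_val (u s))) (fun G : flexFamily R _ => G c')) => //.
  exact: component_continuous.
have tc : continuous (fun s => trunc n (f s)).
  by apply: (@comp_continuous _ _ _ f (trunc n)) => //; exact: trunc_continuous.
apply: (@comp_continuous _ _ _ (fun s => ((set_val (set_val (u s))) c' : K, trunc n (f s))) (@eval _ _)).
  exact: pair_continuous.
exact: eval_continuous (@cube_locally_compact R n) (@cube_regular R n).
Qed.

(** On the sequence (x, e), (x, e'), (x, e) of identities F is a path from its value at the
    composite, an identity, to the composite of its two values. *)
Lemma isovalue_inverse (F : E) (x : X) (e e' : bool) :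
  joined R _ (ccomp (isovalue (set_val F) (BOne e e' (idm x)) (fun=> I0))
                    (isovalue (set_val F) (BOne e' e (idm x)) (fun=> I0)))
    (cidm (obj T0 T1 x e)).
Proof.
apply: joined_sym; pose p := BCons e (idm x) (BOne e e' (idm x)).
exists (fun t => isovalue (set_val F) p (fun=> t)).
  apply: (@comp_continuous _ _ _ (fun t => (fun=> t) : Q) (isovalue (set_val F) p)).
    by apply: prod_continuous => _ t; exact: cvg_id.
  exact: fapp_continuous.
split.
  rewrite (@isovalue_face0 _ _ _ _ _ (set_val F) _ _ _ _ p 0) //= comp1m.
  exact: (@fapp_id R C (prodC X isoI) (ends T0 T1) (set_val F) (x, e)).
have -> : p = bcat (BOne e' e (idm x)) (BOne e e' (idm x)) by [].
by rewrite isovalue_face1 //; congr ccomp; apply: fapp_dep.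
Qed.

Lemma components_invertible : (exists F : E, True) -> invertible_components G.
Proof.
move=> [F _] A; apply/invertible_pi0.
exists (isovalue (set_val F) (BOne false true (idm A)) (fun=> I0)).
have h : sorted (BOne true false (idm A)) by [].
have wE : component G A = isovalue (set_val F) (BOne true false (idm A)) (fun=> I0).
  by rewrite (isovalue_sorted F h) arrvalue_unit.
rewrite wE; split; first exact: (isovalue_inverse F A false true).
exact: (isovalue_inverse F A true false).
Qed.

(** The parameter cube has dimension 0 and empty boundary, so U is a placeholder. *)
Lemma extension_exists : invertible_components G -> exists F : E, True.
Proof.
move=> inv.
pose U : bifamily R (obj T0 T1) := fun y d x e p _ =>
  inhabited_witness (chom_inhabited inv p).
have noface (s : Q) : ~ onface 0 s by move=> [i [c []]].
have [||| F [Fg FB]] := @extend_boundary _ _ _ _ _ G inv 0 U.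
- by move=> y d x e p s s' _.
- by move=> y d x e p i c.
- by move=> s /noface.
by exists (cellequivalence Fg FB (fun=> I0)).
Qed.

(** f, g and the constant z form a family over the boundary of the (n + 1)-cube, and its extension
    to the cube is the homotopy. *)
Lemma spheroids_homotopic : invertible_components G -> forall n (z : E), pi_trivial R n z.
Proof.
move=> inv n z f g [fc fz] [gc gz].
(* Time is the last coordinate n of the parameter cube. *)
pose u (s : Q) : E := if `[< s n = I1 >] then g (trunc n s) else
  if `[< s n = I0 >] then f (trunc n s) else z.
have u0 s : s n = I0 -> u s = f (trunc n s).
  rewrite /u => s0; rewrite asboolF ?asboolT // s0; exact: I0_neq_I1.
have u1 s : s n = I1 -> u s = g (trunc n s) by rewrite /u => s1; rewrite asboolT.
have trunc_bd s : onface n s -> cube_boundary R n (trunc n s).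
  move=> [i [c [ni si]]]; exists (Ordinal ni); rewrite /trunc /= si.
  by case: c {si} => /=; [right|left].
have uz s : onface n s -> u s = z.
  by move=> /trunc_bd sn; rewrite /u gz // fz //; case: asboolP => // _; case: asboolP.
have udep s s' : (forall j, j < n.+1 -> s' j = s j) -> u s' = u s.
  move=> ss; rewrite /u ss //; have -> // : trunc n s' = trunc n s.
  by apply/funext => i; apply: ss; exact: leqW.
have uc i c : i < n.+1 -> continuous (fun s => u (upd i (endp c) s)).
  rewrite ltnS leq_eqVlt => /orP[/eqP ->|ni].
    case: c.
      have -> : (fun s => u (upd n (endp true) s)) = (fun s => g (trunc n (upd n (endp true) s))).
        by apply/funext => s; rewrite u1 // updE.
      apply: (@comp_continuous _ _ _ (fun s => trunc n (upd n (endp true) s)) g) => //.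
      by apply: (@continuous_updc R _ (trunc n)); exact: trunc_continuous.
    have -> : (fun s => u (upd n (endp false) s)) = (fun s => f (trunc n (upd n (endp false) s))).
      by apply/funext => s; rewrite u0 // updE.
    apply: (@comp_continuous _ _ _ (fun s => trunc n (upd n (endp false) s)) f) => //.
    by apply: (@continuous_updc R _ (trunc n)); exact: trunc_continuous.
  have -> : (fun s => u (upd i (endp c) s)) = (fun=> z).
    by apply/funext => s; rewrite uz //; exists i, c; rewrite updE.
  exact: cst_continuous.
pose U : bifamily R (obj T0 T1) := fun y d x e p s => isovalue (set_val (u s)) p (dropk n.+1 s).
have [|||F [Fg FB]] := @extend_boundary _ _ _ _ _ G inv n.+1 U.
- move=> y d x e p s s' ss; rewrite /bapp /U (@udep s' s); last by move=> j jn; apply: ss; lia.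
  by apply: fapp_dep => j; rewrite dim_from_path => jp; apply: ss; rewrite ltn_add2l.
- move=> y d x e p i c ni; apply: isovalue_continuous; first exact: uc.
  by apply: (@continuous_updc R _ (dropk n.+1)); exact: dropk_continuous.
- by move=> s _; exists (u s) => s' ss y d x e p; rewrite /bapp /U (udep s).
(* Moves the time coordinate from the front to position n. *)
pose q (w : I * cube R n) : Q := fun j => if j == n then w.1 else oapp w.2 I0 (insub j).
have qn w : q w n = w.1 by rewrite /q eqxx.
have qi w (i : 'I_n) : q w i = w.2 i.
  rewrite /q ltn_eqF // insubT //= => ?; congr (w.2 _); exact: val_inj.
have qt w : trunc n (q w) = w.2 by apply/funext => i; exact: qi.
have qc : continuous q.
  apply: prod_continuous => j; rewrite /q; case: (j == n); first by move=> w; exact: cvg_fst.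
  case: insub => [i|] /=; last exact: cst_continuous.
  apply: (@comp_continuous _ _ _ snd (fun t : cube R n => t i)); first by move=> w; exact: cvg_snd.
  exact: component_continuous.
have Fu w : onface n.+1 (q w) -> cellequivalence Fg FB (q w) = u (q w).
  by move=> qw; apply: cellequivalence_boundary => // s' ss y d x e p; rewrite /bapp /U (udep (q w)).
exists (fun w => cellequivalence Fg FB (q w)).
  apply: (@comp_continuous _ _ _ q (cellequivalence Fg FB)) => //.
  exact: cellequivalence_continuous.
split=> [t|t|s t [i ti]].
- by rewrite Fu ?u0 ?qt //; exists n, false; rewrite qn.
- by rewrite Fu ?u1 ?qt //; exists n, true; rewrite qn.
- have qb : onface n (q (s, t)).
    by case: ti => ti; [exists i, false|exists i, true]; rewrite qi.
  by rewrite Fu ?uz //; apply: onface_leq qb.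
Qed.

End extension_space.

Theorem theorem2p2 (R : realType) (X : category) (C : contCategory)
    (T0 T1 : flexFunctor R X C) (G : flexMorphism T0 T1) :
  ((exists F : equivalences_extending G, True) <->
   (forall A : X,
      @invertible (pi0 R C) (T0 A) (T1 A) (pi0_class R (component G A)))) /\
  ((exists F : equivalences_extending G, True) ->
   weakly_contractible R (equivalences_extending G)).
Proof.
split; first by split=> [|inv]; [exact: components_invertible|exact: extension_exists].
by move=> EF; split => //; exact/spheroids_homotopic/components_invertible.
Qed.
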